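(* Let $N\ge 2$ and let $\mathfrak F_N=\{f_1,\dots,f_N\}$, identified with the label set $\{1,\dots,N\}$, be polynomial functions on $\mathbb R$ of degree at most two, with associated lines $L_a=\{y=\frac{df_a}{dx}=t_ax+s_a\}\subset\mathbb R^2$ ($t_a,s_a\in\mathbb R$), such that $t_a\neq t_b$ for $a\neq b$ and no three of the lines $L_1,\dots,L_N$ meet in one point. For $a\ne b$ let $v_{ab}=v_{ba}$ be the intersection point of $L_a$ and $L_b$. Then there exists an $A_\infty$-category $\mathcal C(\mathfrak F_N)$ over $\mathbb R$ with set of objects $\mathfrak F_N$ such that: (i) For $a\ne b\in\mathfrak F_N$, the graded vector space $V_{ab}:=\mathrm{Hom}_{\mathcal C(\mathfrak F_N)}(a,b)$ is concentrated in degrees zero and one, with $V^0_{ab}=\mathbb R\cdot[v_{ab}]$, $V^1_{ab}=0$ if $t_a<t_b$, and $V^0_{ab}=0$, $V^1_{ab}=\mathbb R\cdot[v_{ab}]$ if $t_a>t_b$, where $[v_{ab}]$ is a basis element attached to the point $v_{ab}$. (ii) Let $k\ge 1$ and let $a_1,\dots,a_{k+1}\in\mathfrak F_N$ be pairwise distinct, and put $\vec v:=(v_{a_1a_2},\dots,v_{a_ka_{k+1}},v_{a_{k+1}a_1})$. If $k=1$, the differential $m_1:V_{a_1a_2}\to V_{a_1a_2}$ is zero. If $k\ge 2$, then the structure constant $c(\vec v)\in\mathbb R$ in $$m_k([v_{a_1a_2}],\dots,[v_{a_ka_{k+1}}])=c(\vec v)\cdot[v_{a_1a_{k+1}}]$$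 is zero if $\vec v$ does not form a clockwise convex polygon, and $c(\vec v)=\pm e^{-\mathrm{Area}(\vec v)}$, with an appropriate sign $\pm$, if $\vec v$ forms a clockwise convex polygon, where $\mathrm{Area}(\vec v)$ is the area of that polygon. (iii) $\mathcal C(\mathfrak F_N)$ is homotopy equivalent to the DG category $\mathcal C_{DR}(\mathfrak F_N)$.
   Context: All vector spaces are over $\mathbb R$. **$A_\infty$-categories.** An $A_\infty$-category $\mathcal C$ consists of a set of objects, a $\mathbb Z$-graded vector space $V_{ab}=\mathrm{Hom}_{\mathcal C}(a,b)$ for each pair of objects, and multilinear maps $m_n:V_{a_1a_2}\otimes\cdots\otimes V_{a_na_{n+1}}\to V_{a_1a_{n+1}}$ of degree $2-n$ for all $n\ge1$ and all objects, such that for all $n\ge 1$ and composable homogeneous $w_1,\dots,w_n$ $$0=\sum_{k+l=n+1}\sum_{j=0}^{k-1}(-1)^{\sigma}m_k(w_1,\dots,w_j,m_l(w_{j+1},\dots,w_{j+l}),w_{j+l+1},\dots,w_n),$$ with $\sigma=(j+1)(l+1)+l(|w_1|+\cdots+|w_j|)$. No units are required. A DG category is an $A_\infty$-category with $m_n=0$ for $n\ge3$. The suspension $s(\mathcal C)$ has the same objects and $\mathrm{Hom}_{s(\mathcal C)}(a,b)=\mathrm{Hom}_{\mathcal C}(a,b)[1]$ (so $s$ lowers degree by one), with degree-one operations $m_n(o_1,\dots,o_n)=(-1)^{\sum_{i=1}^{n-1}(n-i)|o_i|}\,s\,m_n(s^{-1}o_1,\dots,s^{-1}o_n)$. An $A_\infty$-functor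 $\mathcal G=\{g,g_1,g_2,\dots\}:s(\mathcal C)\to s(\mathcal C')$ consists of a map $g$ on objects and degree-zero multilinear maps $g_k:\mathrm{Hom}_{s(\mathcal C)}(a_1,a_2)\otimes\cdots\otimes\mathrm{Hom}_{s(\mathcal C)}(a_k,a_{k+1})\to\mathrm{Hom}_{s(\mathcal C')}(g(a_1),g(a_{k+1}))$, $k\ge1$, with, for all $n\ge1$, $$\sum_{i}\sum_{k_1+\cdots+k_i=n}m'_i(g_{k_1}\otimes\cdots\otimes g_{k_i})=\sum_{i+l+j=n}g_{i+1+j}(\mathbf 1^{\otimes i}\otimes m_l\otimes\mathbf 1^{\otimes j}).$$ It is a homotopy equivalence if $g$ is a bijection on objects and every $g_1:\mathrm{Hom}_{s(\mathcal C)}(a,b)\to\mathrm{Hom}_{s(\mathcal C')}(g(a),g(b))$ induces an isomorphism on cohomology with respect to $m_1$. Two $A_\infty$-categories are homotopy equivalent if there is a homotopy equivalence between them (this is an equivalence relation). **The DG category $\mathcal C_{DR}(\mathfrak F_N)$.** Its set of objects is $\mathfrak F_N$. For all $a,b\in\mathfrak F_N$ (including $a=b$), $\mathrm{Hom}_{\mathcal C_{DR}(\mathfrak F_N)}(a,b)=\Omega(\mathbb R)=\Omega^0(\mathbb R)\oplus\Omega^1(\mathbb R)$, where $\Omega^0(\mathbb R)=\mathcal S(\mathbb R)$ is the space of (real-valued) Schwartz functions and $\Omega^1(\mathbb R)=\mathcal S(\mathbb R)\,dx$. The differential $m_1=d_{ab}:\Omega^0(\mathbb R)\to\Omega^1(\mathbb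 R)$ on $\mathrm{Hom}(a,b)$ is $d_{ab}=d-df_{ab}\wedge$, with $d$ the exterior derivative and $f_{ab}=f_a-f_b$; the composition $m_2$ is the wedge product. **Clockwise convex polygons.** $\mathbb R^2$ has coordinates $(x,y)$ with the standard orientation. In the situation of (ii) with $k\ge2$, cyclically consecutive points of $\vec v$ are distinct. The sequence $\vec v$ forms a clockwise convex polygon if its points are, in this cyclic order, the successive vertices of a convex polygon whose boundary is traversed once in the clockwise direction, i.e. the interior angle at each vertex (with respect to clockwise traversal) lies in $(0,\pi]$. *)

(* Defs.v *)
From HB Require Import structures.
From mathcomp Require Import all_boot all_order all_algebra.
From mathcomp Require Import all_classical all_reals all_analysis.
From mathcomp Require Import ring.

Set Implicit Arguments.
Unset Strict Implicit.
Unset Printing Implicit Defensive.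

Import Order.TTheory GRing.Theory Num.Theory.
Import numFieldNormedType.Exports.

Local Open Scope classical_set_scope.
Local Open Scope ring_scope.

Inductive path_of (Ob : Type) (E : Ob -> Ob -> Type) : Ob -> Ob -> Type :=
| pnil a : path_of E a a
| pcons a b c : E a b -> path_of E b c -> path_of E a c.

Arguments pnil {Ob E} a.
Arguments pcons {Ob E a b c} x p.

Section Paths.
Variables (Ob : Type) (E : Ob -> Ob -> Type).

Fixpoint plen a b (p : path_of E a b) : nat :=
  if p is pcons _ _ _ _ p' then (plen p').+1 else 0%N.

Fixpoint pcat a b c (p : path_of E a b) : path_of E b c -> path_of E a c :=
  match p in path_of _ a b return path_of E b c -> path_of E a c with
  | pnil _ => id
  | pcons _ _ _ x p' => fun q => pcons x (pcat p' q)
  end.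

(* All factorisations of p as a concatenation of two paths, empty ones
   included: there are (plen p).+1 of them. *)
Fixpoint splits a b (p : path_of E a b) :
    seq {c : Ob & (path_of E a c * path_of E c b)%type} :=
  match p in path_of _ a b
    return seq {c : Ob & (path_of E a c * path_of E c b)%type} with
  | pnil a => [:: existT _ a (pnil a, pnil a)]
  | pcons a _ _ x p' =>
      existT _ a (pnil a, pcons x p') ::
      [seq existT _ (tag u) (pcons x (tagged u).1, (tagged u).2)
         | u <- splits p']
  end.

(* All factorisations of p as a concatenation of nonempty paths, each one given
   as a path of paths: the first edge either forms a block by itself or is
   added to the first block of a factorisation of the remaining path. *)
Fixpoint blocks a b (p : path_of E a b) : seq (path_of (path_of E) a b) :=
  match p in path_of _ a b return seq (path_of (path_of E) a b) with
  | pnil a => [:: pnil a]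
  | pcons _ _ _ x p' =>
      flatten [seq pcons (pcons x (pnil _)) P ::
                 match P in path_of _ b c
                   return E _ b -> seq (path_of (path_of E) _ c) with
                 | pnil _ => fun=> [::]
                 | pcons _ _ _ q P' => fun x => [:: pcons (pcons x q) P']
                 end x | P <- blocks p']
  end.

End Paths.

Fixpoint pmap (Ob Ob' : Type) (E : Ob -> Ob -> Type) (E' : Ob' -> Ob' -> Type)
    (g : Ob -> Ob') (h : forall a b, E a b -> E' (g a) (g b)) a b
    (p : path_of E a b) : path_of E' (g a) (g b) :=
  match p in path_of _ a b return path_of E' (g a) (g b) with
  | pnil a => pnil (g a)
  | pcons _ _ _ x p' => pcons (h _ _ x) (pmap h p')
  end.

Definition sgnz (R : fieldType) (z : int) : R := (-1) ^ z.

Section Graded.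
Variables (R : fieldType) (Ob : Type).

(* V a b d is the degree d part of the graded module of morphisms from a to b *)
Definition graded_quiver := Ob -> Ob -> int -> lmodType R.

Definition helt (V : graded_quiver) a b := {d : int & V a b d}.

(* composable sequences of homogeneous elements *)
Definition hpath (V : graded_quiver) := path_of (helt V).

Definition hel (V : graded_quiver) a b d (x : V a b d) : helt V a b :=
  existT _ d x.

Fixpoint hdeg (V : graded_quiver) a b (p : hpath V a b) : int :=
  if p is pcons _ _ _ x p' then tag x + hdeg p' else 0.

(* Operations m_n (for all n at once) on composable sequences. The value
   m p : forall e, W e lists the components of an element of a graded module in
   all degrees. *)
Definition multilinear (V : graded_quiver) a b (W : int -> lmodType R)
    (m : hpath V a b -> forall e, W e) :=
  forall c d (p : hpath V a c) (q : hpath V d b) i (k : R) (x y : V c d i) e,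
    m (pcat p (pcons (hel (k *: x + y)) q)) e =
    k *: m (pcat p (pcons (hel x) q)) e + m (pcat p (pcons (hel y) q)) e.

Record ainf_category := AinfCategory {
  ahom : graded_quiver;
  mult : forall a b, hpath ahom a b -> forall e, ahom a b e;
  (* there is no operation m_0 *)
  mult_nil : forall a e, mult (pnil a) e = 0;
  mult_multilinear : forall a b, multilinear (@mult a b);
  mult_degree : forall a b (p : hpath ahom a b) (e : int),
    e != hdeg p + 2 - (plen p)%:Z -> mult p e = 0;
  (* The pairs (u, w) enumerate the ways to write p as p1, p2, p3 with p2
     nonempty. *)
  mult_relation : forall a b (p : hpath ahom a b) (e : int),
    \sum_(u <- splits p)
     \sum_(w <- splits (tagged u).2 | (0 < plen (tagged w).1)%N)
       (let p1 := (tagged u).1 in let p2 := (tagged w).1 in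
        let p3 := (tagged w).2 in
        let j := (plen p1)%:Z in let l := (plen p2)%:Z in
        sgnz R ((j + 1) * (l + 1) + l * hdeg p1) *:
        mult (pcat p1 (pcons (hel (mult p2 (hdeg p2 + 2 - l))) p3)) e) = 0
}.

(* Hom_{s(C)}(a, b) = Hom_C(a, b)[1]; the suspension s is the identity on
   underlying elements. *)
Definition shom (C : ainf_category) : graded_quiver :=
  fun a b d => ahom C a b (d + 1).

Definition desusp (C : ainf_category) a b (p : hpath (shom C) a b) :
    hpath (ahom C) a b :=
  pmap (E' := helt (ahom C)) (g := id)
    (fun a b (x : helt (shom C) a b) => hel (tagged x : ahom C a b (tag x + 1)))
    p.

(* sum_{i = 1}^{n - 1} (n - i) |o_i| *)
Fixpoint susp_exponent (V : graded_quiver) a b (p : hpath V a b) : int :=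
  if p is pcons _ _ _ x p' then (plen p')%:Z * tag x + susp_exponent p' else 0.

Definition smult (C : ainf_category) a b (p : hpath (shom C) a b) (e : int) :
    shom C a b e :=
  sgnz R (susp_exponent p) *: mult (desusp p) (e + 1).

Definition sdiff (C : ainf_category) a b d (x : shom C a b d) :
    shom C a b (d + 1) := smult (pcons (hel x) (pnil b)) (d + 1).

End Graded.

Record ainf_functor (R : fieldType) (Ob Ob' : Type)
    (C : ainf_category R Ob) (C' : ainf_category R Ob') := AinfFunctor {
  fob : Ob -> Ob';
  fops : forall a b, hpath (shom C) a b -> forall e, shom C' (fob a) (fob b) e;
  (* there is no component g_0 *)
  fops_nil : forall a e, fops (pnil a) e = 0;
  fops_multilinear : forall a b, multilinear (@fops a b);
  fops_degree : forall a b (p : hpath (shom C) a b) (e : int),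
    e != hdeg p -> fops p e = 0;
  (* The sign on the right is the Koszul sign of moving the degree one
     operation m_l past the elements of p1. *)
  fops_relation : forall a b (p : hpath (shom C) a b) (e : int),
    (0 < plen p)%N ->
    \sum_(P <- blocks p)
       smult (pmap (E' := helt (shom C')) (g := fob)
                (fun c d (q : hpath (shom C) c d) => hel (fops q (hdeg q))) P) e
    = \sum_(u <- splits p)
       \sum_(w <- splits (tagged u).2 | (0 < plen (tagged w).1)%N)
         (let p1 := (tagged u).1 in let p2 := (tagged w).1 in
          let p3 := (tagged w).2 in
          sgnz R (hdeg p1) *:
          fops (pcat p1 (pcons (hel (smult p2 (hdeg p2 + 1))) p3)) e)
}.

Section HomotopyEquivalence.
Variables (R : fieldType) (Ob Ob' : Type).
Variables (C : ainf_category R Ob) (C' : ainf_category R Ob').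

Definition flin (G : ainf_functor C C') a b d (x : shom C a b d) :
    shom C' (fob G a) (fob G b) d := fops G (pcons (hel x) (pnil b)) d.

(* The map induced by g_1 on cohomology is injective and surjective. The first
   clause is about a cocycle of degree d + 1, the coboundaries in that degree
   being the images of the elements of degree d. *)
Definition iso_on_cohomology (G : ainf_functor C C') a b :=
  forall d : int,
    (forall x : shom C a b (d + 1), sdiff x = 0 ->
       (exists y : shom C' (fob G a) (fob G b) d, flin G x = sdiff y) ->
       exists z : shom C a b d, x = sdiff z) /\
    (forall y : shom C' (fob G a) (fob G b) (d + 1), sdiff y = 0 ->
       exists (x : shom C a b (d + 1)) (z : shom C' (fob G a) (fob G b) d),
         sdiff x = 0 /\ flin G x = y + sdiff z).

Definition homotopy_equivalence (G : ainf_functor C C') :=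
  bijective (fob G) /\ forall a b, iso_on_cohomology G a b.

Definition homotopy_equivalent :=
  exists G : ainf_functor C C', homotopy_equivalence G.

End HomotopyEquivalence.

Section Schwartz.
Variable R : realType.
Implicit Types (f g h : R -> R).

Definition schwartz_fun f :=
  (forall n x, derivable (derive1n n f) x 1) /\
  (forall m n, exists C, forall x, `|x ^+ m * derive1n n f x| <= C).

(* Coinduction: to belong to the Schwartz space it is enough to belong to some
   class of rapidly decreasing derivable functions stable by derivation. *)
Lemma schwartz_coind (A : (R -> R) -> Prop) :
  (forall f, A f -> [/\ forall x, derivable f x 1,
     forall m, exists C, forall x, `|x ^+ m * f x| <= C & A (derive1 f)]) ->
  forall f, A f -> schwartz_fun f.
Proof.
move=> HA f Af.
have An n : A (derive1n n f).
  elim: n => [|n IH]; first by rewrite derive1n0.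
  by rewrite derive1nS; have [] := HA _ IH.
by split=> [n x|m n]; have [H1 H2 _] := HA _ (An n).
Qed.

Lemma schwartz_derivable f x : schwartz_fun f -> derivable f x 1.
Proof. by case=> /(_ 0%N x). Qed.

Lemma schwartz_bounded f m :
  schwartz_fun f -> exists C, forall x, `|x ^+ m * f x| <= C.
Proof. by case=> _ /(_ m 0%N). Qed.

Lemma schwartz_derive1 f : schwartz_fun f -> schwartz_fun (derive1 f).
Proof.
case=> H1 H2; split.
  by move=> n x; have := H1 n.+1 x; rewrite /derive1n iterSr.
by move=> m n; have := H2 m n.+1; rewrite /derive1n iterSr.
Qed.

Lemma schwartz0 : schwartz_fun (0 : R -> R).
Proof.
apply: (schwartz_coind (A := fun f => f = cst 0)) => // _ ->; split.
- by move=> x; exact: derivable_cst.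
- by move=> m; exists 0 => x; rewrite mulr0 normr0.
- by apply/funext => x; rewrite derive1_cst.
Qed.

Lemma schwartzDl (k : R) f g :
  schwartz_fun f -> schwartz_fun g -> schwartz_fun (k *: f + g).
Proof.
move=> sf sg; apply: (schwartz_coind (A := fun h => exists u v,
  [/\ schwartz_fun u, schwartz_fun v & h = k *: u + v])); last by exists f, g.
move=> _ [u [v [su sv ->]]].
have du x : derivable u x 1 by exact: schwartz_derivable.
have dv x : derivable v x 1 by exact: schwartz_derivable.
split.
- by move=> x; apply: derivableD => //; exact: derivableZ.
- move=> m; have [C1 H1] := schwartz_bounded m su.
  have [C2 H2] := schwartz_bounded m sv; exists (`|k| * C1 + C2) => x.
  have -> : x ^+ m * (k *: u + v) x = k * (x ^+ m * u x) + x ^+ m * v x.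
    by rewrite /GRing.scale/= mulrDr mulrCA.
  apply: le_trans (ler_normD _ _) _; apply: lerD => //.
  by rewrite normrM ler_wpM2l.
- exists (derive1 u), (derive1 v); split; try exact: schwartz_derive1.
  apply/funext => x; rewrite derive1E deriveD //; last exact: derivableZ.
  by rewrite deriveZ // -!derive1E.
Qed.

Lemma schwartzM f g :
  schwartz_fun f -> schwartz_fun g -> schwartz_fun (f \* g).
Proof.
move=> sf sg.
pose S (l : seq ((R -> R) * (R -> R))) := \sum_(p <- l) (p.1 \* p.2) : R -> R.
pose A h := exists2 l, {in l, forall p, schwartz_fun p.1 /\ schwartz_fun p.2} &
                       h = S l.
apply: (schwartz_coind (A := A)); last first.
  exists [:: (f, g)]; first by move=> p; rewrite inE => /eqP ->.
  by rewrite /S big_seq1.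
move=> _ [l Hl ->]; elim: l Hl => [|[u v] l IH] Hl.
  rewrite /S big_nil; split.
  - by move=> x; exact: derivable_cst.
  - by move=> m; exists 0 => x; rewrite mulr0 normr0.
  - exists [::] => //; rewrite /S big_nil.
    by apply/funext => x; rewrite derive1_cst.
have [|dS bS [l' Hl' eS]] := IH.
  by move=> p pl; apply: Hl; rewrite inE pl orbT.
have [su sv] : schwartz_fun u /\ schwartz_fun v by apply: (Hl (u, v)); exact: mem_head.
have du x : derivable u x 1 by exact: schwartz_derivable.
have dv x : derivable v x 1 by exact: schwartz_derivable.
have duv x : derivable (u \* v) x 1 by exact: derivableM.
have SE : S ((u, v) :: l) = (u \* v) + S l by rewrite /S big_cons.
rewrite SE; split.
- by move=> x; exact: derivableD.
- move=> m; have [C1 H1] := schwartz_bounded m su.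
  have [C2 H2] := schwartz_bounded 0 sv; have [C3 H3] := bS m.
  exists (C1 * C2 + C3) => x.
  have -> : x ^+ m * (u \* v + S l) x = (x ^+ m * u x) * (x ^+ 0 * v x) + x ^+ m * S l x.
    by rewrite expr0 mul1r mulrDr mulrA.
  apply: le_trans (ler_normD _ _) _; apply: lerD => //.
  by rewrite normrM ler_pM.
- exists [:: (derive1 u, v), (u, derive1 v) & l'].
    move=> p; rewrite !inE => /or3P[/eqP->|/eqP->|/Hl'//]; split => //=;
      exact: schwartz_derive1.
  apply/funext => x; rewrite derive1E deriveD // /S 2!big_cons -/(S l') -eS.
  rewrite deriveM //= -!derive1E addrA; congr (_ + _).
  change (u x * derive1 v x + v x * derive1 u x =
          derive1 u x * v x + u x * derive1 v x).
  by rewrite addrC [v x * _]mulrC.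
Qed.

Lemma schwartz_mulX f : schwartz_fun f -> schwartz_fun (id \* f).
Proof.
move=> sf; apply: (schwartz_coind (A := fun h => exists u v,
  [/\ schwartz_fun u, schwartz_fun v & h = (id \* u) + v])); last first.
  by exists f, 0; split => //; [exact: schwartz0|rewrite addr0].
move=> _ [u [v [su sv ->]]].
have du x : derivable u x 1 by exact: schwartz_derivable.
have dv x : derivable v x 1 by exact: schwartz_derivable.
have diu x : derivable (id \* u) x 1.
  by apply: derivableM => //; exact: derivable_id.
split.
- by move=> x; exact: derivableD.
- move=> m; have [C1 H1] := schwartz_bounded m.+1 su.
  have [C2 H2] := schwartz_bounded m sv; exists (C1 + C2) => x.
  have -> : x ^+ m * ((id \* u) + v) x = x ^+ m.+1 * u x + x ^+ m * v x.
    by rewrite mulrDr exprSr mulrA.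
  by apply: le_trans (ler_normD _ _) _; apply: lerD.
- exists (derive1 u), (1 *: u + derive1 v); split; first exact: schwartz_derive1.
    by apply: schwartzDl => //; exact: schwartz_derive1.
  apply/funext => x; rewrite derive1E deriveD // deriveM //.
  rewrite derive_id -!derive1E addrA scale1r; congr (_ + _ + _).
  by rewrite /GRing.scale/= mulr1.
Qed.

Lemma schwartz_mulpoly (p : {poly R}) f :
  schwartz_fun f -> schwartz_fun (fun x => p.[x] * f x).
Proof.
move=> sf; elim/poly_ind: p => [|p c IH].
  have -> : (fun x => (0 : {poly R}).[x] * f x) = 0.
    by apply/funext => x; rewrite horner0 mul0r.
  exact: schwartz0.
have -> : (fun x => (p * 'X + c%:P).[x] * f x) =
          c *: f + (id \* (fun x => p.[x] * f x)).
  apply/funext => x; rewrite hornerMXaddC mulrDl addrC.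
  by rewrite [p.[x] * x]mulrC -mulrA.
by apply: schwartzDl => //; exact: schwartz_mulX.
Qed.

Definition schwartz : {pred R -> R} := fun f => `[< schwartz_fun f >].

Record schwartzType :=
  SchwartzFun { schwartz_val :> R -> R; _ : schwartz_val \in schwartz }.

HB.instance Definition _ := [isSub for schwartz_val].
HB.instance Definition _ := [Choice of schwartzType by <:].

Lemma schwartz_submod_closed : submod_closed schwartz.
Proof.
split=> [|k f g /asboolP sf /asboolP sg]; apply/asboolP.
  exact: schwartz0.
exact: schwartzDl.
Qed.

HB.instance Definition _ :=
  GRing.isSubmodClosed.Build R (R -> R) schwartz schwartz_submod_closed.
HB.instance Definition _ := [SubChoice_isSubLmodule of schwartzType by <:].

Lemma schwartzP (f : schwartzType) : schwartz_fun f.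
Proof. exact: (asboolW (valP f)). Qed.

Definition mk_schwartz f (sf : schwartz_fun f) : schwartzType :=
  SchwartzFun (asboolT sf).

Implicit Types (u v : schwartzType).

Definition sderive u : schwartzType :=
  mk_schwartz (schwartz_derive1 (schwartzP u)).

Definition smul u v : schwartzType :=
  mk_schwartz (schwartzM (schwartzP u) (schwartzP v)).

Definition smulpoly (p : {poly R}) u : schwartzType :=
  mk_schwartz (schwartz_mulpoly p (schwartzP u)).

Lemma schwartz_ext u v : (forall x, u x = v x) -> u = v.
Proof. by move=> uv; apply/val_inj/funext. Qed.

Lemma sval_lin (k : R) u v x : (k *: u + v) x = k * u x + v x.
Proof. by []. Qed.

Lemma sval0 x : (0 : schwartzType) x = 0.
Proof. by []. Qed.

Lemma svalD u v x : (u + v) x = u x + v x.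
Proof. by []. Qed.

Lemma svalN u x : (- u) x = - u x.
Proof. by []. Qed.

Lemma svalZ (k : R) u x : (k *: u) x = k * u x.
Proof. by []. Qed.

Lemma sderiveE u x : sderive u x = derive1 u x.
Proof. by []. Qed.

Lemma smulE u v x : smul u v x = u x * v x.
Proof. by []. Qed.

Lemma smulpolyE p u x : smulpoly p u x = p.[x] * u x.
Proof. by []. Qed.

Lemma sderive_lin (k : R) u v :
  sderive (k *: u + v) = k *: sderive u + sderive v.
Proof.
have du x : derivable u x 1 by exact/schwartz_derivable/schwartzP.
have dv x : derivable v x 1 by exact/schwartz_derivable/schwartzP.
apply: schwartz_ext => x; rewrite svalD svalZ !sderiveE.
have -> : derive1 (k *: u + v) x = derive1 (k *: (u : R -> R) + (v : R -> R)) x.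
  by [].
rewrite !derive1E deriveD ?deriveZ //; exact: derivableZ.
Qed.

Lemma sderiveM u v : sderive (smul u v) = smul (sderive u) v + smul u (sderive v).
Proof.
have du x : derivable u x 1 by exact/schwartz_derivable/schwartzP.
have dv x : derivable v x 1 by exact/schwartz_derivable/schwartzP.
apply: schwartz_ext => x; rewrite svalD !smulE !sderiveE.
have -> : derive1 (smul u v) x = derive1 ((u : R -> R) \* (v : R -> R)) x by [].
rewrite !derive1E deriveM //.
by rewrite addrC /GRing.scale/= [v x * _]mulrC.
Qed.

End Schwartz.

Section Splits.
Variables (V : zmodType) (Ob : Type) (E : Ob -> Ob -> Type).

Lemma big_splits_cons a b c (x : E a b) (p : path_of E b c)
    (F : {d : Ob & (path_of E a d * path_of E d c)%type} -> V) :
  \sum_(u <- splits (pcons x p)) F u =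
  F (existT _ a (pnil a, pcons x p)) +
  \sum_(u <- splits p) F (existT _ (tag u) (pcons x (tagged u).1, (tagged u).2)).
Proof. by rewrite /= big_cons big_map. Qed.

Lemma big_splits_nil a (F : {d : Ob & (path_of E a d * path_of E d a)%type} -> V) :
  \sum_(u <- splits (pnil a)) F u = F (existT _ a (pnil a, pnil a)).
Proof. by rewrite /= big_seq1. Qed.

Lemma big_splits_eq0 a b (p : path_of E a b)
    (F : {d : Ob & (path_of E a d * path_of E d b)%type} -> V) :
  (forall d q r, (plen q + plen r)%N = plen p -> F (existT _ d (q, r)) = 0) ->
  \sum_(u <- splits p) F u = 0.
Proof.
elim: p F => [a'|a' b' c' x p IH] F HF.
  by rewrite big_seq1 HF.
rewrite big_splits_cons HF // add0r; apply: IH => d q r qr.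
by rewrite HF //= addSn qr.
Qed.

End Splits.

#[local] Arguments splits : simpl never.

Section DeRham.
Variables (R : realType) (Ob : Type) (f : Ob -> {poly R}).

Local Notation S := (schwartzType R).

Definition Omega (d : int) : lmodType R :=
  match d with
  | Posz 0 => S
  | Posz 1 => S
  | _ => 'rV[R]_0
  end.

(* (phi, psi) : S * S stands for the form phi + psi dx *)
Definition form (d : int) : Omega d -> S * S :=
  match d return Omega d -> S * S with
  | Posz 0 => fun phi => (phi, 0)
  | Posz 1 => fun psi => (0, psi)
  | _ => fun=> (0, 0)
  end.

Definition form_part (w : S * S) (d : int) : Omega d :=
  match d return Omega d with
  | Posz 0 => w.1
  | Posz 1 => w.2
  | _ => 0
  end.

Definition dform a b (w : S * S) : S * S :=
  (0, sderive w.1 - smulpoly (f a - f b)^`() w.1).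

Definition wedge (w w' : S * S) : S * S :=
  (smul w.1 w'.1, smul w.1 w'.2 + smul w.2 w'.1).

Definition dr_hom : graded_quiver R Ob := fun _ _ => Omega.

Definition dr_form a b (p : hpath dr_hom a b) : S * S :=
  match p with
  | pcons a c _ x (pnil _) => dform a c (form (tagged x))
  | pcons _ _ _ x (pcons _ _ _ y (pnil _)) =>
      wedge (form (tagged x)) (form (tagged y))
  | _ => 0
  end.

Definition dr_mult a b (p : hpath dr_hom a b) e : dr_hom a b e :=
  form_part (dr_form p) e.

Lemma form_lin d (k : R) (x y : Omega d) : form (k *: x + y) = k *: form x + form y.
Proof.
by case: d x y => [[|[|n]]|n] x y /=; congr pair => /=; rewrite ?scaler0 ?addr0.
Qed.

Lemma form_part_lin d (k : R) w w' :
  form_part (k *: w + w') d = k *: form_part w d + form_part w' d.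
Proof. by case: d => [[|[|n]]|n] //=; rewrite scaler0 addr0. Qed.

Lemma form_part0 d : form_part 0 d = 0.
Proof. by case: d => [[|[|n]]|n]. Qed.

Lemma dform_lin a b (k : R) w w' :
  dform a b (k *: w + w') = k *: dform a b w + dform a b w'.
Proof.
congr pair; first by rewrite /= scaler0 addr0.
rewrite /= sderive_lin; apply: schwartz_ext => x.
by rewrite !(svalD, svalN, svalZ, smulpolyE); ring.
Qed.

Lemma wedge_linl (k : R) w w' z : wedge (k *: w + w') z = k *: wedge w z + wedge w' z.
Proof.
congr pair; rewrite /=; apply: schwartz_ext => x;
by rewrite !(svalD, svalN, svalZ, smulE); ring.
Qed.

Lemma wedge_linr (k : R) w w' z : wedge z (k *: w + w') = k *: wedge z w + wedge z w'.
Proof.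
congr pair; rewrite /=; apply: schwartz_ext => x;
by rewrite !(svalD, svalN, svalZ, smulE); ring.
Qed.

Lemma wedge0l z : wedge 0 z = 0.
Proof. by have := wedge_linl (-1) 0 0 z; rewrite scaler0 addr0 scaleN1r addNr. Qed.

Lemma wedge0r z : wedge z 0 = 0.
Proof. by have := wedge_linr (-1) 0 0 z; rewrite scaler0 addr0 scaleN1r addNr. Qed.

Lemma dform0 a b : dform a b 0 = 0.
Proof. by have := dform_lin a b (-1) 0 0; rewrite scaler0 addr0 scaleN1r addNr. Qed.

Lemma dr_form_lin c d a b (p : hpath dr_hom a c) (q : hpath dr_hom d b) i (k : R)
    (x y : dr_hom c d i) :
  dr_form (pcat p (pcons (hel (k *: x + y)) q)) =
  k *: dr_form (pcat p (pcons (hel x) q)) + dr_form (pcat p (pcons (hel y) q)).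
Proof.
case: p x y => [a'|a' c1 c' u p] x y.
  case: q => [b'|d' d1 b' v q] /=; first by rewrite form_lin dform_lin.
  by case: q v => [b''|d2 d3 b'' w q] v /=;
    rewrite ?form_lin ?wedge_linl ?scaler0 ?addr0.
case: p u x y => [c2|c2 c3 c4 u' p] u x y /=.
  by case: q => [b'|d' d1 b' v q] /=; rewrite ?form_lin ?wedge_linr ?scaler0 ?addr0.
by case: p u' x y => [c5|c5 c6 c7 u'' p] u' x y /=; rewrite scaler0 addr0.
Qed.

Lemma dr_mult_multilinear a b : multilinear (@dr_mult a b).
Proof. by move=> c d p q i k x y e; rewrite /dr_mult dr_form_lin form_part_lin. Qed.

Lemma dr_mult_degree a b (p : hpath dr_hom a b) (e : int) :
  e != hdeg p + 2 - (plen p)%:Z -> dr_mult p e = 0.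
Proof.
rewrite /dr_mult; case: p => [a'|a' c b' [i x] p]; first by rewrite form_part0.
case: p x => [b''|c' c1 b'' [j y] p] x /=.
  case: i x => [[|[|i]]|i] x; case: e => [[|[|e]]|e] //= He;
  first [exact: (congr1 snd (dform0 _ _))|by []].
case: p y => [b3|c2 c3 b3 z p] y /=; last by rewrite form_part0.
case: i x => [[|[|i]]|i] x; case: j y => [[|[|j]]|j] y;
case: e => [[|[|e]]|e] //= He; try by [];
by apply: schwartz_ext => t; rewrite !(svalD, smulE, sval0) ?(mulr0, mul0r, addr0).
Qed.

Lemma form_partK a b (p : hpath dr_hom a b) :
  form (dr_mult p (hdeg p + 2 - (plen p)%:Z)) = dr_form p.
Proof.
have E (w : S * S) (d : int) :
    (forall e, e != d -> form_part w e = 0) -> form (form_part w d) = w.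
  case: w => w0 w1 H; have := H 0; have := H 1.
  by case: d H => [[|[|d]]|d] H /= H1 H0; rewrite ?(H1 isT) ?(H0 isT).
by apply: E => e He; exact: dr_mult_degree.
Qed.

Definition dr_insert a b c d (p : hpath dr_hom a b) (w : S * S)
    (q : hpath dr_hom c d) : S * S :=
  match p, q with
  | pnil _, pnil _ => dform a d w
  | pnil _, pcons _ _ _ y (pnil _) => wedge w (form (tagged y))
  | pcons _ _ _ y (pnil _), pnil _ => wedge (form (tagged y)) w
  | _, _ => 0
  end.

Lemma dr_insertE a b c d (p : hpath dr_hom a b) (x : helt dr_hom b c)
    (q : hpath dr_hom c d) :
  dr_form (pcat p (pcons x q)) = dr_insert p (form (tagged x)) q.
Proof.
case: p x => [a'|a' c1 b' u p] x; first by case: q x => [d'|c' c2 d' v [|]].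
case: p u x => [b''|c3 c4 b'' u' p] u x /=; last by case: p u' x.
by case: q x => [|].
Qed.

Lemma dr_insert0 a b c d (p : hpath dr_hom a b) (q : hpath dr_hom c d) :
  dr_insert p 0 q = 0.
Proof.
case: p => [a'|a' c1 b' u [b''|c3 c4 b'' u' p]] //=.
  case: q => [d'|c' c2 d' v [e'|? ? ? ? ?]] //=; first exact: dform0.
  exact: wedge0l.
case: q => [d'|? ? ? ? ?] //=; exact: wedge0r.
Qed.

Lemma dr_insert_ge2 a b c d (p : hpath dr_hom a b) w (q : hpath dr_hom c d) :
  (2 <= plen p + plen q)%N -> dr_insert p w q = 0.
Proof.
case: p => [a'|a' c1 b' u [b''|c3 c4 b'' u' p]] //=.
  by case: q => [d'|c' c2 d' v [|]].
by case: q => [|].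
Qed.

Lemma dr_form_ge3 a b (p : hpath dr_hom a b) : (3 <= plen p)%N -> dr_form p = 0.
Proof. by case: p => [a'|a' c b' x [|? ? ? y [|]]]. Qed.

Lemma dform_dform a b w : dform a b (dform a b w) = 0.
Proof.
congr pair; rewrite /=; apply: schwartz_ext => x.
rewrite svalD svalN smulpolyE sval0 mulr0 subr0 sderiveE.
by rewrite (_ : schwartz_val 0 = cst 0) // derive1_cst.
Qed.

Lemma dform_wedge a b c d (x : Omega d) w :
  dform a c (wedge (form x) w) =
  wedge (dform a b (form x)) w + sgnz R d *: wedge (form x) (dform b c w).
Proof.
have -> : dform a c (wedge (form x) w) =
    (0, smul (dform a b (form x)).2 w.1 + smul (form x).1 (dform b c w).2).
  congr pair => /=; rewrite sderiveM; apply: schwartz_ext => t.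
  rewrite !(svalD, svalN, smulE, smulpolyE) !derivB !hornerD !hornerN; ring.
rewrite /sgnz; case: d x => [[|[|d]]|d] x;
congr pair; rewrite /=; apply: schwartz_ext => t;
by rewrite ?(expr0z, expr1z) !(svalD, svalN, svalZ, smulE, sval0, smulpolyE);
  rewrite -?[sderive 0]/(_ 0); ring.
Qed.

Lemma wedgeA w1 w2 w3 : wedge (wedge w1 w2) w3 = wedge w1 (wedge w2 w3).
Proof.
congr pair; rewrite /=; apply: schwartz_ext => t;
by rewrite !(svalD, smulE); ring.
Qed.

Lemma sgnz_double (z : int) : sgnz R (2 * z) = 1.
Proof. by rewrite /sgnz -exprz_exp -[_ ^ 2]/((-1) ^+ 2) sqrrN expr1n exp1rz. Qed.

Lemma sgnz3 : sgnz R ((0%:Z + 1) * (2%:Z + 1)) = -1.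
Proof. by rewrite /sgnz -[_ ^ _]/((-1) ^+ 3) exprS sqrrN expr1n mulr1. Qed.

Lemma dr_relation_form a b (p : hpath dr_hom a b) :
  \sum_(u <- splits p)
    \sum_(w <- splits (tagged u).2 | (0 < plen (tagged w).1)%N)
      sgnz R (((plen (tagged u).1)%:Z + 1) * ((plen (tagged w).1)%:Z + 1) +
              (plen (tagged w).1)%:Z * hdeg (tagged u).1) *:
      dr_insert (tagged u).1 (dr_form (tagged w).1) (tagged w).2 = 0.
Proof.
have [n4|] := leqP 4 (plen p).
  apply: big_splits_eq0 => c p1 q E1; rewrite big_mkcond.
  apply: big_splits_eq0 => d p2 p3 E2 /=; case: ifP => // _.
  have [l3|l3] := leqP 3 (plen p2).
    by rewrite dr_form_ge3 // dr_insert0 scaler0.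
  rewrite dr_insert_ge2 ?scaler0 //; move: E2 E1 n4 l3 => /= <- <-.
  by rewrite ltnS addnCA => n4 l3; rewrite -(leq_add2l 2) (leq_trans n4) // leq_add2r.
move=> n3; under eq_bigr do rewrite big_mkcond.
case: p n3 => [a'|a' c b' [i x] p] H; first by rewrite !big_splits_nil.
case: p x H => [b''|c' c1 b'' [j y] p] x H.
  rewrite !(big_splits_cons, big_splits_nil) /=.
  by rewrite dform_dform scaler0 !addr0.
case: p y H => [b3|c2 c3 b3 [k z] p] y H.
  rewrite !(big_splits_cons, big_splits_nil) /= addr0 (dform_wedge a' c').
  rewrite mulr0 addr0 (sgnz_double 1) sgnz3.
  have -> : ((1%:Z + 1) * (1%:Z + 1) + 1%:Z * (i + 0)) = 2 * 2 + i.
    by rewrite addr0 mul1r.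
  rewrite {2}/sgnz expfzDr ?oppr_eq0 ?oner_eq0 // -!/(sgnz R _) sgnz_double mul1r.
  by rewrite scale1r scaleN1r !add0r addr0 -addrA opprD subrK subrr.
case: p z H => [b4|c4 c5 b5 t p] z H; last by case/negP: H.
do 20 ?rewrite (big_splits_cons, big_splits_nil) /=.
rewrite mulr0 [_ + 0]addr0 sgnz3 dform0 !scaler0 !(add0r, addr0).
have -> : (1%:Z + 1) * (2%:Z + 1) + 2%:Z * i = 2 * (3 + i).
  by rewrite [RHS]mulrDr; congr (_ + _).
rewrite sgnz_double.
by rewrite scale1r scaleN1r wedgeA addNr.
Qed.

Lemma dr_mult_relation a b (p : hpath dr_hom a b) (e : int) :
  \sum_(u <- splits p)
   \sum_(w <- splits (tagged u).2 | (0 < plen (tagged w).1)%N)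
     (let p1 := (tagged u).1 in let p2 := (tagged w).1 in
      let p3 := (tagged w).2 in
      let j := (plen p1)%:Z in let l := (plen p2)%:Z in
      sgnz R ((j + 1) * (l + 1) + l * hdeg p1) *:
      dr_mult (pcat p1 (pcons (hel (dr_mult p2 (hdeg p2 + 2 - l))) p3)) e) = 0.
Proof.
have fD w w' : form_part (w + w') e = form_part w e + form_part w' e.
  by have := form_part_lin e 1 w w'; rewrite !scale1r.
rewrite -[RHS](form_part0 e) -(dr_relation_form p).
rewrite (big_morph _ fD (form_part0 e)); apply: eq_bigr => u _.
rewrite (big_morph _ fD (form_part0 e)); apply: eq_bigr => w _ /=.
rewrite /dr_mult dr_insertE /= -/(dr_mult _ _) form_partK.
by rewrite -[in RHS](addr0 (_ *: _)) form_part_lin form_part0 addr0.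
Qed.

Lemma dr_mult_nil a e : dr_mult (pnil a) e = 0.
Proof. exact: form_part0. Qed.

Definition C_DR : ainf_category R Ob :=
  AinfCategory dr_mult_nil dr_mult_multilinear dr_mult_degree dr_mult_relation.

End DeRham.

Section Plane.
Variable R : realType.
Implicit Types (p q r : R * R) (ps : seq (R * R)).

Definition line (t s : R) : set (R * R) := [set z | z.2 = t * z.1 + s].

Definition cross p q : R := p.1 * q.2 - p.2 * q.1.

Definition rotate (theta : R) p : R * R :=
  (cos theta * p.1 - sin theta * p.2, sin theta * p.1 + cos theta * p.2).

(* theta is the angle at p, between the incoming edge from q and the outgoing
   edge to r, of the region lying to the right of the path q, p, r *)
Definition interior_angle q p r (theta : R) :=
  exists2 lambda : R, 0 < lambda &
    r - p = (lambda * (rotate theta (q - p)).1,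
             lambda * (rotate theta (q - p)).2).

Definition vertex ps (i : nat) : R * R := nth (0, 0) ps (i %% size ps).

Definition edge_point ps (i : nat) (lambda : R) : R * R :=
  ((1 - lambda) * (vertex ps i).1 + lambda * (vertex ps i.+1).1,
   (1 - lambda) * (vertex ps i).2 + lambda * (vertex ps i.+1).2).

(* The second clause is convexity, all vertices lying on the right of every
   edge; the third one says that the boundary is traversed exactly once. *)
Definition clockwise_convex_polygon ps :=
  let n := size ps in
  [/\ (3 <= n)%N,
      forall i j, (i < n)%N -> (j < n)%N ->
        cross (vertex ps i.+1 - vertex ps i) (vertex ps j - vertex ps i) <= 0,
      forall i j (lambda mu : R), (i < n)%N -> (j < n)%N ->
        0 <= lambda < 1 -> 0 <= mu < 1 ->
        edge_point ps i lambda = edge_point ps j mu -> i = j /\ lambda = mu &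
      forall i, (i < n)%N -> exists2 theta : R, 0 < theta <= pi &
        interior_angle (vertex ps i) (vertex ps i.+1) (vertex ps i.+2) theta].

Definition convex_hull ps : set (R * R) :=
  [set z | exists w : nat -> R,
     [/\ forall i, 0 <= w i, \sum_(i < size ps) w i = 1,
         z.1 = \sum_(i < size ps) w i * (vertex ps i).1 &
         z.2 = \sum_(i < size ps) w i * (vertex ps i).2]].

Definition area ps : R :=
  fine ((@lebesgue_measure R \x @lebesgue_measure R)%E (convex_hull ps)).

End Plane.

Section Vertices.
Variables (R : realType) (Ob : Type) (t : Ob -> R).

(* The degree of [v_ab]; meaningful only when the slopes are distinct. *)
Definition vdeg (a b : Ob) : int := if t a < t b then 0 else 1.

(* the composable sequence [v_{a1 a2}], ..., [v_{ak ak+1}], where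
   a1 = a and s = [:: a2; ...; ak+1] *)
Fixpoint vpath (V : graded_quiver R Ob) (e : forall a b, V a b (vdeg a b))
    (a : Ob) (s : seq Ob) : hpath V a (last a s) :=
  match s return hpath V a (last a s) with
  | [::] => pnil a
  | b :: s' => pcons (hel (e a b)) (vpath e b s')
  end.

End Vertices.

(* Main.v *)
(** The differential of [C_DR f] on Hom(a, b) is conjugate, by the factor
    [exp (f_a - f_b)], to the plain derivative. If [t_a < t_b] its cohomology is
    spanned by the Gaussian [exp (f_a - f_b)] in degree zero, and otherwise by
    [exp (f_a - f_b)] times a bump in degree one. The A-infinity category is the
    homotopy transfer of [C_DR f] along such representatives, the bump attached
    to [(a, b)] being placed at an integer, the rank of the point [v_ab] among
    all intersection points, ordered lexicographically: bumps at distinct points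
    have disjoint supports, and along each line ranks are ordered as the points.

    In the conjugated coordinates the trees of the transfer are then locally
    constant away from the bumps, with values 0, 1 and -1. By induction on the
    number of objects, the value is nonzero exactly if a walk along the lines
    [L_a1, ..., L_ak+1], reversing its direction where the slope increases, is
    possible. So the constant of [a1, ..., ak+1] is 1 or -1 if the polygon with
    vertices [v_a1a2, ..., v_ak+1a1] turns to the right at every vertex and has
    two points where the horizontal direction is reversed, and 0 otherwise; the
    second condition is forced by the degrees, and the two together mean that
    the polygon is convex and clockwise.

    Going back from the conjugated coordinates to basis elements normalised at
    [v_ab] multiplies the constant by the exponential of minus the cyclic sum of
    the numbers [(f_a - f_b) (v_ab)]. As [f_a] is a primitive of the equation of
    [L_a], this sum is the integral of [y dx] along the boundary, that is the
    area. *)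

Require Import Defs.
From HB Require Import structures.
From mathcomp Require Import all_boot all_order all_algebra.
From mathcomp Require Import all_classical all_reals all_analysis.
From mathcomp Require Import ring lra zify.

Set Implicit Arguments.
Unset Strict Implicit.
Unset Printing Implicit Defensive.

Import Order.TTheory GRing.Theory Num.Theory.
Import numFieldNormedType.Exports.

Local Open Scope classical_set_scope.
Local Open Scope ring_scope.

(** * Homotopy transfer *)

(** Each transferred Hom space, also that of an object with itself, is a line. An operation is
    therefore a number attached to a list of objects, and the transfer is proved for such lists
    before degrees and dependently typed paths enter.

    The main obstacle is cancellation: a structure constant is a sum over trees, so locating nonzero
    terms does not suffice to find 1, -1 or 0. A sum of trees with one ascent solves a differential
    equation whose sources, besides its own bump, are one bump at the first vertex and one at the
    last; the direction in which the rest of the walk leads from one to the other allows only one of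
    them to occur ([one_jump]). If the first slope is below the last, the constant is a sum of
    products evaluated at a point, and two nonzero products would mean two passages through one
    abscissa without a reversal in between ([crosses_unique]).

    An intermediate tree is a function and has no polygon attached to it. The induction describes
    its value at an integer [m] by a walk closed up by the vertical segment over [m] ([closes]). *)

Section SplitSeq.
Variable T : Type.

Fixpoint splitseq (l : seq T) : seq (seq T * seq T) :=
  if l is x :: l' then ([::], l) :: [seq (x :: u.1, u.2) | u <- splitseq l']
  else [:: ([::], [::])].

Variable W : zmodType.
Implicit Types (l : seq T) (Phi : seq T -> seq T -> W).

Lemma big_splitseq_cons x l Phi :
  \sum_(u <- splitseq (x :: l)) Phi u.1 u.2 =
  Phi [::] (x :: l) + \sum_(u <- splitseq l) Phi (x :: u.1) u.2.
Proof. by rewrite /= big_cons big_map. Qed.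

Lemma big_splitseq_nil Phi :
  \sum_(u <- splitseq [::]) Phi u.1 u.2 = Phi [::] [::].
Proof. exact: big_seq1. Qed.

#[local] Arguments splitseq : simpl never.

(** Congruence that gives access to [u ++ v = l]. The summand is a curried function, so that the
    induction can absorb the head of [l] into it. *)
Lemma eq_big_splitseq l Phi Psi :
  (forall u v, u ++ v = l -> Phi u v = Psi u v) ->
  \sum_(u <- splitseq l) Phi u.1 u.2 = \sum_(u <- splitseq l) Psi u.1 u.2.
Proof.
elim: l Phi Psi => [|x l IH] Phi Psi H; first by rewrite !big_seq1 H.
rewrite !big_splitseq_cons H //; congr (_ + _).
by apply: (IH (fun u v => Phi (x :: u) v) (fun u v => Psi (x :: u) v)) => u v uv;
  apply: H; rewrite /= uv.
Qed.

Lemma big_splitseq_closed l Phi (K : W -> Prop) :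
  K 0 -> (forall x y, K x -> K y -> K (x + y)) ->
  (forall u v, u ++ v = l -> K (Phi u v)) ->
  K (\sum_(u <- splitseq l) Phi u.1 u.2).
Proof.
move=> K0 KD; elim: l Phi => [|x l IH] Phi H; first by rewrite big_splitseq_nil; exact: H.
rewrite big_splitseq_cons; apply: KD; first exact: H.
by apply: (IH (fun u v => Phi (x :: u) v)) => u v uv; apply: H; rewrite /= uv.
Qed.

(** Both sides enumerate the ways to cut [l] into three; associativity of the product enters the
    transfer through this exchange. *)
Lemma big_splitseq_assoc l (Phi : seq T -> seq T -> seq T -> W) :
  \sum_(u <- splitseq l) \sum_(w <- splitseq u.2) Phi u.1 w.1 w.2 =
  \sum_(u <- splitseq l) \sum_(w <- splitseq u.1) Phi w.1 w.2 u.2.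
Proof.
elim: l Phi => [|x l IH] Phi; first by rewrite !big_seq1.
rewrite (big_splitseq_cons x l (fun u1 u2 => \sum_(w <- splitseq u2) Phi u1 w.1 w.2)).
rewrite (big_splitseq_cons x l (fun u1 u2 => \sum_(w <- splitseq u1) Phi w.1 w.2 u2)).
rewrite big_splitseq_cons big_seq1 -addrA; congr (_ + _).
rewrite (IH (fun u1 u2 u3 => Phi (x :: u1) u2 u3)) -big_split /=.
by apply: eq_bigr => u _; rewrite [RHS](big_splitseq_cons x u.1 (fun p q => Phi p q u.2)).
Qed.

(** A cut falls on one side or the other of [x], which in the transfer is the output of an inner
    operation. *)
Lemma big_splitseq_catcons l x r Phi :
  \sum_(u <- splitseq (l ++ x :: r)) Phi u.1 u.2 =
  \sum_(u <- splitseq l) Phi u.1 (u.2 ++ x :: r) +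
  \sum_(u <- splitseq r) Phi (l ++ x :: u.1) u.2.
Proof.
elim: l Phi => [|y l IH] Phi; first by rewrite [LHS]big_splitseq_cons big_seq1.
rewrite cat_cons [LHS]big_splitseq_cons (IH (fun u v => Phi (y :: u) v)) addrA.
by rewrite (big_splitseq_cons y l (fun u v => Phi u (v ++ x :: r))).
Qed.

Lemma big_splitseq_last l Phi :
  (forall u x v, Phi u (x :: v) = 0) ->
  \sum_(u <- splitseq l) Phi u.1 u.2 = Phi l [::].
Proof.
elim: l Phi => [|x l IH] Phi H; first exact: big_splitseq_nil.
by rewrite big_splitseq_cons H add0r (IH (fun u => Phi (x :: u))).
Qed.

(** Isolates the term whose inner operation takes all the inputs. *)
Lemma big_splitseq_middle l (Phi : seq T -> seq T -> seq T -> W) :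
  (forall u v w, u ++ v ++ w = l -> (0 < size u + size w)%N -> Phi u v w = 0) ->
  \sum_(u <- splitseq l) \sum_(w <- splitseq u.2) Phi u.1 w.1 w.2 = Phi [::] l [::].
Proof.
move=> H.
transitivity (\sum_(u <- splitseq l) if size u.1 is 0 then Phi [::] u.2 [::] else 0).
  pose Psi u r := \sum_(w <- splitseq r) Phi u w.1 w.2.
  apply: (eq_big_splitseq (Phi := Psi)
    (Psi := fun u v => if size u is 0 then Phi [::] v [::] else 0)) => u r ur.
  rewrite /Psi; pose Phi' v w := if (0 < size u + size w)%N then 0 else Phi u v w.
  rewrite (eq_big_splitseq (Phi := Phi u) (Psi := Phi')).
    rewrite big_splitseq_last; first by rewrite /Phi' addn0; case: {+}u.
    by move=> v x w; rewrite /Phi' /= addnS.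
  by move=> v w vw; rewrite /Phi'; case: ifP => // /H -> //; rewrite vw.
case: (l) => [|x l']; first exact: big_seq1.
rewrite (big_splitseq_cons x l' (fun u v => if size u is 0 then Phi [::] v [::] else 0)).
by rewrite /= big1 ?addr0.
Qed.

End SplitSeq.

Section LinearMaps.
Variables (R : pzRingType) (A B : lmodType R) (f : A -> B).
Hypothesis fL : forall k x y, f (k *: x + y) = k *: f x + f y.

Lemma lin0 : f 0 = 0.
Proof. by have := fL (-1) 0 0; rewrite scaler0 addr0 scaleN1r addNr. Qed.

Lemma linD x y : f (x + y) = f x + f y.
Proof. by have := fL 1 x y; rewrite !scale1r. Qed.

Lemma linZ k x : f (k *: x) = k *: f x.
Proof. by have := fL k x 0; rewrite lin0 !addr0. Qed.

Lemma linN x : f (- x) = - f x.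
Proof. by rewrite -scaleN1r linZ scaleN1r. Qed.

Lemma lin_sum I (r : seq I) (F : I -> A) :
  f (\sum_(i <- r) F i) = \sum_(i <- r) f (F i).
Proof. by rewrite (big_morph f linD lin0). Qed.

End LinearMaps.

(* A differential graded category all of whose morphism spaces are carried by
   the same module [A], together with contracting homotopies [h] onto lines
   spanned by cocycles [inc a b]. As transferred operations are only evaluated on
   the [inc a b], a composable sequence of arguments is given by its objects. The
   involution [tau] is the sign of the degree, and [- eps a b] its value on
   [inc a b]. *)
Section Transfer.
Variables (R : comRingType) (A : lmodType R) (Ob : Type).
Variables (mul : A -> A -> A) (tau : A -> A) (d h : Ob -> Ob -> A -> A).
Variables (proj : Ob -> Ob -> A -> R) (inc : Ob -> Ob -> A).
Variable eps : Ob -> Ob -> R.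

Hypothesis mulA : associative mul.
Hypothesis mulDl : forall z k x y, mul (k *: x + y) z = k *: mul x z + mul y z.
Hypothesis mulDr : forall z k x y, mul z (k *: x + y) = k *: mul z x + mul z y.
Hypothesis tau_lin : forall k x y, tau (k *: x + y) = k *: tau x + tau y.
Hypothesis tauM : forall x y, tau (mul x y) = mul (tau x) (tau y).
Hypothesis tauK : involutive tau.
Hypothesis d_lin : forall a b k x y, d a b (k *: x + y) = k *: d a b x + d a b y.
Hypothesis h_lin : forall a b k x y, h a b (k *: x + y) = k *: h a b x + h a b y.
Hypothesis proj_lin : forall a b k x y,
  proj a b (k *: x + y) = k *: (proj a b x : R^o) + proj a b y.
Hypothesis d_tau : forall a b x, d a b (tau x) = - tau (d a b x).
Hypothesis h_tau : forall a b x, h a b (tau x) = - tau (h a b x).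
Hypothesis dM : forall a b c x y,
  d a c (mul x y) = mul (d a b x) y + mul (tau x) (d b c y).
Hypothesis d_inc : forall a b, d a b (inc a b) = 0.
Hypothesis proj_d : forall a b x, proj a b (d a b x) = 0.
Hypothesis hodge : forall a b x,
  x = d a b (h a b x) + h a b (d a b x) + proj a b x *: inc a b.
Hypothesis eps2 : forall a b, eps a b * eps a b = 1.
Hypothesis tau_inc : forall a b, tau (inc a b) = - eps a b *: inc a b.

Let tau0 : tau 0 = 0 := lin0 tau_lin.
Let mul0l z : mul 0 z = 0 := lin0 (mulDl z).
Let mul0r z : mul z 0 = 0 := lin0 (mulDr z).
Let tauN x : tau (- x) = - tau x := linN tau_lin x.
Let tauZ k x : tau (k *: x) = k *: tau x := linZ tau_lin k x.
Let mulNl z x : mul (- x) z = - mul x z := linN (mulDl z) x.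
Let mulNr z x : mul z (- x) = - mul z x := linN (mulDr z) x.
Let mulZl z k x : mul (k *: x) z = k *: mul x z := linZ (mulDl z) k x.
Let mulZr z k x : mul z (k *: x) = k *: mul z x := linZ (mulDr z) k x.
Let mul_suml z I (r : seq I) F :
  mul (\sum_(i <- r) F i) z = \sum_(i <- r) mul (F i) z :=
  lin_sum (mulDl z) r F.
Let mul_sumr z I (r : seq I) F :
  mul z (\sum_(i <- r) F i) = \sum_(i <- r) mul z (F i) :=
  lin_sum (mulDr z) r F.
Let tau_sum I (r : seq I) F :
  tau (\sum_(i <- r) F i) = \sum_(i <- r) tau (F i) := lin_sum tau_lin r F.
Let d_sum a b I (r : seq I) F :
  d a b (\sum_(i <- r) F i) = \sum_(i <- r) d a b (F i) := lin_sum (@d_lin a b) r F.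
Let h_sum a b I (r : seq I) F :
  h a b (\sum_(i <- r) F i) = \sum_(i <- r) h a b (F i) := lin_sum (@h_lin a b) r F.
Let proj_sum a b I (r : seq I) F :
  proj a b (\sum_(i <- r) F i) = \sum_(i <- r) proj a b (F i) :=
  lin_sum (f := proj a b : A -> R^o) (@proj_lin a b) r F.
Let hN a b x : h a b (- x) = - h a b x := linN (@h_lin a b) x.
Let hZ a b k x : h a b (k *: x) = k *: h a b x := linZ (@h_lin a b) k x.
Let dN a b x : d a b (- x) = - d a b x := linN (@d_lin a b) x.
Let h0 a b : h a b 0 = 0 := lin0 (@h_lin a b).
Let d0 a b : d a b 0 = 0 := lin0 (@d_lin a b).
Let proj0 a b : proj a b 0 = 0 :=
  lin0 (f := proj a b : A -> R^o) (@proj_lin a b).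
Let projZ a b k x : proj a b (k *: x) = k * proj a b x :=
  linZ (f := proj a b : A -> R^o) (@proj_lin a b) k x.

(** The sign of the total degree of the leaves in the suspension. As [tau] is the sign of the
    unsuspended degree, its value on [inc a b] is [- eps a b]. *)
Fixpoint sgl a l : R := if l is b :: l' then eps a b * sgl b l' else 1.

(** The suspended product of the two parts of a cut: on an element of degree n, [- tau] is the sign
    (-1)^(n-1). *)
Definition convol (G : Ob -> seq Ob -> A) a l : A :=
  \sum_(u <- splitseq l) - mul (tau (G a u.1)) (G (last a u.1) u.2).

(* The sum over the planar binary trees whose leaves are the [inc a b], with
   products at the vertices and [- h] at the inner edges and at the root; the
   first argument is only there for termination. *)
Fixpoint tree_rec n a l : A :=
  match n, l with
  | n'.+1, [:: b] => inc a b
  | n'.+1, b :: l' => - h a (last b l') (convol (tree_rec n') a l)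
  | _, _ => 0
  end.

Definition tree a l := tree_rec (size l) a l.
Definition tree2 := convol tree.
Definition tree_const a l : R := proj a (last a l) (tree2 a l).

(** As empty lists contribute 0, only shorter lists matter; this makes [tree_rec] independent of its
    fuel. *)
Lemma eq_convol G G' a l :
  (forall b u, (size u < size l)%N -> G b u = G' b u) ->
  (forall b, G b [::] = 0) -> (forall b, G' b [::] = 0) ->
  convol G a l = convol G' a l.
Proof.
move=> GG G0 G'0.
apply: (eq_big_splitseq (Phi := fun u v => - mul (tau (G a u)) (G (last a u) v))
  (Psi := fun u v => - mul (tau (G' a u)) (G' (last a u) v))) => u v uv.
case: u uv => [|x u] uv; first by rewrite G0 G'0 tau0 !mul0l.
case: v uv => [|y v] uv; first by rewrite G0 G'0 !mul0r.
by rewrite !GG // -uv size_cat /= ?addSn ?addnS !ltnS ?leq_addr ?leq_addl // ltnW // leq_addl.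
Qed.

Lemma tree_rec_nil n b : tree_rec n b [::] = 0.
Proof. by case: n. Qed.

Lemma tree_rec_size n a l : (size l <= n)%N -> tree_rec n a l = tree a l.
Proof.
rewrite /tree; elim/ltn_ind: n a l => n IH a [|b [|c l]] ln.
- by rewrite tree_rec_nil.
- by case: n ln IH.
case: n ln IH => // n ln IH; rewrite /=; congr (- h _ _ _).
apply: eq_convol => [e u|e|e]; rewrite ?tree_rec_nil //.
rewrite /= ltnS => ul.
have E m : (size l < m)%N -> (m <= n)%N -> tree_rec m e u = tree e u.
  by move=> lm mn; apply: IH; [rewrite ltnS|exact: leq_trans lm].
by rewrite (E n ln (leqnn n)) -(E (size l).+1 (ltnSn _) ln).
Qed.

Lemma tree_nil a : tree a [::] = 0.
Proof. by []. Qed.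

Lemma tree1 a b : tree a [:: b] = inc a b.
Proof. by []. Qed.

Lemma treeE a l : (1 < size l)%N -> tree a l = - h a (last a l) (tree2 a l).
Proof.
case: l => [|b [|c l]] // _; rewrite /tree /=; congr (- h _ _ _).
apply: eq_convol => [e u|e|e]; rewrite ?tree_rec_nil //.
by move=> ul; exact: (@tree_rec_size (size l).+1).
Qed.

Lemma tree2_small a l : (size l <= 1)%N -> tree2 a l = 0.
Proof.
case: l => [|b [|c l]] // _; rewrite /tree2 /convol /= ?big_cons big_nil /=.
  by rewrite tree_nil mul0r oppr0 addr0.
by rewrite tree_nil mul0r tau0 mul0l oppr0 !addr0.
Qed.

Lemma tree_const_small a l : (size l <= 1)%N -> tree_const a l = 0.
Proof. by move=> l1; rewrite /tree_const tree2_small // proj0. Qed.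

Lemma sgl_cat a l r : sgl a (l ++ r) = sgl a l * sgl (last a l) r.
Proof. by elim: l a => [|b l IH] a /=; rewrite ?mul1r // IH mulrA. Qed.

Lemma sgl2 a l : sgl a l * sgl a l = 1.
Proof. by elim: l a => [|b l IH] a /=; rewrite ?mulr1 // mulrACA eps2 IH mulr1. Qed.

Lemma tau_tree a l : tau (tree a l) = - sgl a l *: tree a l.
Proof.
have [n] := ubnP (size l); elim: n a l => // n IH a [|b [|c l]] ln.
- by rewrite tree_nil tau0 scaler0.
- by rewrite tree1 tau_inc /= mulr1.
set s := [:: b, c & l] in ln *.
(* The homotopy at the root anticommutes with [tau], so before it the sign is the opposite one. *)
suff E : tau (tree2 a s) = sgl a s *: tree2 a s.
  by rewrite treeE // tauN -[X in - X]opprK -h_tau E hZ scaleNr scalerN opprK.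
rewrite /tree2 /convol tau_sum scaler_sumr.
pose Phi u v := tau (- mul (tau (tree a u)) (tree (last a u) v)).
pose Psi u v := sgl a s *: - mul (tau (tree a u)) (tree (last a u) v).
apply: (eq_big_splitseq (Phi := Phi) (Psi := Psi)) => u v uv.
rewrite /Phi /Psi {Phi Psi}.
case: u uv => [|x u] uv; first by rewrite tree_nil tau0 !(mul0l, oppr0, tau0, scaler0).
case: v uv => [|y v] uv; first by rewrite tree_nil !(mul0r, oppr0, tau0, scaler0).
have su : (size (x :: u) < n)%N.
  by move: ln; rewrite -uv size_cat /= !addnS !addSn !ltnS; apply: leq_ltn_trans; exact: leq_addr.
have sv : (size (y :: v) < n)%N.
  by move: ln; rewrite -uv size_cat /= !addnS !addSn !ltnS; apply: leq_ltn_trans; exact: leq_addl.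
rewrite tauN tauM tauK (IH _ _ sv) [in RHS](IH _ _ su) -uv sgl_cat.
rewrite !(mulZl, mulZr) !scaleNr !opprK.
by rewrite scalerA mulrAC sgl2 mul1r.
Qed.

(** The inner operation on [v] yields a multiple of one basis element, so in the outer list [v]
    shrinks to its last object. *)
Definition ainf_lhs (Z : lmodType R) (F : Ob -> seq Ob -> Z) a l : Z :=
  \sum_(u <- splitseq l) \sum_(w <- splitseq u.2)
    (sgl a u.1 * tree_const (last a u.1) w.1) *:
      F a (u.1 ++ last (last a u.1) w.1 :: w.2).

Definition functor_rel a l :=
  d a (last a l) (tree a l) + tree2 a l = ainf_lhs tree a l.

(* The terms with three factors [tree] cancel by associativity, and those with
   two factors match the ways of splitting [u.1 ++ last _ w.1 :: w.2]. *)
Lemma d_tree2 a l :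
  (forall b u, (size u < size l)%N -> functor_rel b u) ->
  d a (last a l) (tree2 a l) + ainf_lhs tree2 a l = 0.
Proof.
move=> IH.
have dE b u : (size u < size l)%N ->
    d b (last b u) (tree b u) = ainf_lhs tree b u - tree2 b u.
  by move=> /(IH b) <-; rewrite addrK.
(* After the Leibniz rule, the induction hypothesis replaces the differential of a factor by
   [ainf_lhs tree - tree2]; [Q] collects the terms of the first kind and [Q'] those of the
   second. *)
pose Q := \sum_(u <- splitseq l) (mul (tau (ainf_lhs tree a u.1)) (tree (last a u.1) u.2)
   - mul (tree a u.1) (ainf_lhs tree (last a u.1) u.2)).
pose Q' := \sum_(u <- splitseq l) (mul (tree a u.1) (tree2 (last a u.1) u.2)
   - mul (tau (tree2 a u.1)) (tree (last a u.1) u.2)).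
have -> : d a (last a l) (tree2 a l) = Q + Q'.
  rewrite /tree2 /convol d_sum /Q /Q' -big_split /=.
  pose Phi u v := d a (last a l) (- mul (tau (tree a u)) (tree (last a u) v)).
  pose Psi u v := mul (tau (ainf_lhs tree a u)) (tree (last a u) v)
   - mul (tree a u) (ainf_lhs tree (last a u) v) +
   (mul (tree a u) (tree2 (last a u) v) - mul (tau (tree2 a u)) (tree (last a u) v)).
  apply: (eq_big_splitseq (Phi := Phi) (Psi := Psi)) => u v uv.
  rewrite /Phi /Psi {Phi Psi}.
  have ainf0 b : ainf_lhs tree b [::] = 0.
    by rewrite /ainf_lhs big_seq1 big_seq1 tree_const_small // mulr0 scale0r.
  have tree20 b : tree2 b [::] = 0 by rewrite tree2_small.
  case: u uv => [|x u] uv.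
    by rewrite ainf0 tree20 tree_nil !(tau0, mul0l, oppr0, d0, addr0).
  case: v uv => [|y v] uv.
    by rewrite ainf0 tree20 tree_nil !(mul0r, oppr0, d0, addr0).
  have su : (size (x :: u) < size l)%N.
    by rewrite -uv size_cat -[ltnLHS]addn0 ltn_add2l.
  have sv : (size (y :: v) < size l)%N.
    by rewrite -uv size_cat -[ltnLHS]add0n ltn_add2r.
  rewrite dN -uv last_cat (dM _ (last a (x :: u))) d_tau tauK.
  rewrite (dE _ _ su) (dE _ _ sv) mulNl (linD tau_lin) tauN (linD (mulDr _)).
  rewrite (linD (mulDl _)) mulNr mulNl !opprD !opprK.
by rewrite [LHS]addrACA; congr (_ + _); exact: addrC.
have -> : Q' = 0.
  rewrite /Q' big_split /= sumrN; apply/eqP; rewrite subr_eq0; apply/eqP.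
  pose Phi u v w := mul (tree a u) (- mul (tau (tree (last a u) v)) (tree (last (last a u) v) w)).
  transitivity (\sum_(u <- splitseq l) \sum_(w <- splitseq u.2) Phi u.1 w.1 w.2).
    by apply: eq_bigr => u _; rewrite /tree2 /convol mul_sumr.
  rewrite big_splitseq_assoc; apply: eq_bigr => u _.
  rewrite /tree2 /convol tau_sum mul_suml.
  pose Psi v w := mul (tau (- mul (tau (tree a v)) (tree (last a v) w))) (tree (last a u.1) u.2).
  apply: (eq_big_splitseq (Phi := fun v w => Phi v w u.2) (Psi := Psi)) => v w vw.
  by rewrite /Phi /Psi -vw last_cat tauN tauM tauK mulNl mulNr mulA.
rewrite addr0 /Q big_split /= sumrN.
pose c u v := sgl a u * tree_const (last a u) v.
(* In [P3] the product is cut after the output of the inner operation, in [P3'] before it. *)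
pose P3 u v w z := (c u v) *:
  mul (tau (tree a (u ++ last (last a u) v :: w))) (tree (last (last (last a u) v) w) z).
pose P3' u' u v w := c (u' ++ u) v *:
  mul (tau (tree a u')) (tree (last a u') (u ++ last (last (last a u') u) v :: w)).
have -> : ainf_lhs tree2 a l =
   - (\sum_(u <- splitseq l) \sum_(v <- splitseq u.2) \sum_(w <- splitseq v.2) P3 u.1 v.1 w.1 w.2) -
     \sum_(u <- splitseq l) \sum_(v <- splitseq u.2) \sum_(w <- splitseq u.1) P3' w.1 w.2 v.1 v.2.
  rewrite -opprD -big_split -sumrN; apply: eq_bigr => u _ /=.
  rewrite -big_split -sumrN; apply: eq_bigr => v _ /=.
  rewrite /tree2 /convol.
  set x := last _ v.1.
  rewrite (big_splitseq_catcons u.1 x v.2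
    (fun p q => - mul (tau (tree a p)) (tree (last a p) q))).
  rewrite scalerDr [LHS]addrC opprD; congr (_ + _).
    rewrite scaler_sumr -sumrN; apply: eq_bigr => w _.
    by rewrite scalerN /P3 last_cat.
  rewrite scaler_sumr -sumrN.
  pose Phi p q := c u.1 v.1 *: - mul (tau (tree a p)) (tree (last a p) (q ++ x :: v.2)).
  apply: (eq_big_splitseq (Phi := Phi) (Psi := fun p q => - P3' p q v.1 v.2)) => p q pq.
  by rewrite /Phi /P3' scalerN -pq /x -pq last_cat.
have -> : \sum_(u <- splitseq l) mul (tau (ainf_lhs tree a u.1)) (tree (last a u.1) u.2) =
   \sum_(u <- splitseq l) \sum_(v <- splitseq u.2) \sum_(w <- splitseq v.2) P3 u.1 v.1 w.1 w.2.
  transitivity (\sum_(u <- splitseq l) \sum_(v <- splitseq u.1) \sum_(w <- splitseq v.2) P3 v.1 w.1 w.2 u.2).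
    pose Phi u z := mul (tau (ainf_lhs tree a u)) (tree (last a u) z).
    pose Psi u z := \sum_(v <- splitseq u) \sum_(w <- splitseq v.2) P3 v.1 w.1 w.2 z.
    apply: (eq_big_splitseq (Phi := Phi) (Psi := Psi)) => u z _.
    rewrite /Phi /Psi /ainf_lhs tau_sum mul_suml {Phi Psi}.
    pose Phi v r := mul (tau (\sum_(w <- splitseq r)
      c v w.1 *: tree a (v ++ last (last a v) w.1 :: w.2))) (tree (last a u) z).
    pose Psi v r := \sum_(w <- splitseq r) P3 v w.1 w.2 z.
    apply: (eq_big_splitseq (Phi := Phi) (Psi := Psi)) => v r vr.
    rewrite /Phi /Psi tau_sum mul_suml {Phi Psi}.
    pose Phi p q := mul (tau (c v p *: tree a (v ++ last (last a v) p :: q))) (tree (last a u) z).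
    apply: (eq_big_splitseq (Phi := Phi) (Psi := fun p q => P3 v p q z)) => p q pq.
    by rewrite /Phi /P3 tauZ mulZl -vr -pq !last_cat.
  transitivity (\sum_(u <- splitseq l) \sum_(v <- splitseq u.2)
     \sum_(w <- splitseq v.1) P3 u.1 w.1 w.2 v.2).
    by rewrite -(big_splitseq_assoc l (fun x y z => \sum_(w <- splitseq y) P3 x w.1 w.2 z)).
  by apply: eq_bigr => u _; rewrite -(big_splitseq_assoc u.2 (P3 u.1)).
have -> : \sum_(u <- splitseq l) mul (tree a u.1) (ainf_lhs tree (last a u.1) u.2) =
   - \sum_(u <- splitseq l) \sum_(v <- splitseq u.2) \sum_(w <- splitseq u.1) P3' w.1 w.2 v.1 v.2.
  transitivity (- \sum_(u <- splitseq l) \sum_(w <- splitseq u.2) \sum_(v <- splitseq w.2) P3' u.1 w.1 v.1 v.2).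
    rewrite -sumrN; apply: eq_bigr => u _; rewrite /ainf_lhs mul_sumr -sumrN.
    apply: eq_bigr => v _; rewrite mul_sumr -sumrN; apply: eq_bigr => w _.
    rewrite mulZr /P3' /c -scalerN -mulNl tau_tree scaleNr opprK mulZl scalerA sgl_cat last_cat.
    congr (_ *: _); rewrite -[LHS]mul1r -(sgl2 a u.1); ring.
  congr (- _).
  rewrite (big_splitseq_assoc l (fun x y z => \sum_(v <- splitseq z) P3' x y v.1 v.2)).
  by apply: eq_bigr => u _; rewrite exchange_big.
by rewrite opprK addrACA addrN addrN addr0.
Qed.

Lemma ainf_lhs_small (Z : lmodType R) (F : Ob -> seq Ob -> Z) a l :
  (size l <= 1)%N -> ainf_lhs F a l = 0.
Proof.
move=> l1; rewrite /ainf_lhs.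
pose Phi u v w := (sgl a u * tree_const (last a u) v) *:
  F a (u ++ last (last a u) v :: w).
have Phi0 u v w : u ++ v ++ w = l -> Phi u v w = 0.
  move=> uvw; rewrite /Phi tree_const_small ?mulr0 ?scale0r //.
  by apply: leq_trans l1; rewrite -uvw !size_cat addnCA leq_addr.
rewrite (big_splitseq_middle (Phi := Phi)); last by move=> u v w uvw _; exact: Phi0.
by apply: Phi0; rewrite cats0.
Qed.

(** Decompose [tree2] by [hodge]. Since [tree = - h tree2], the left side becomes [h d tree2] plus
    the harmonic part, and [d_tree2] evaluates [d tree2]. Applying [- h] turns [tree2] into [tree]
    on lists longer than one; the list of length one, from the inner operation on all of [l], is
    supplied by the harmonic part. *)
Lemma functor_relP a l : functor_rel a l.
Proof.
have [n] := ubnP (size l); elim: n a l => // n IH a l ln.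
have IH' b u : (size u < size l)%N -> functor_rel b u.
  by move=> ul; apply: IH; apply: leq_trans ul _.
have := d_tree2 a IH'; rewrite /functor_rel => /(canRL (addrK _)); rewrite sub0r => E.
have [l1|l1] := leqP (size l) 1.
  rewrite tree2_small // addr0 ainf_lhs_small //.
  case: l l1 {ln IH IH' E} => [_|b [_|//]]; [exact: d0|exact: d_inc].
have H := hodge a (last a l) (tree2 a l).
rewrite treeE // dN {2}H !addrA addNr add0r E hN -/(tree_const a l).
suff <- : ainf_lhs tree a l + h a (last a l) (ainf_lhs tree2 a l) =
    tree_const a l *: inc a (last a l) by rewrite addrC addrK.
rewrite /ainf_lhs h_sum -big_split /=.
pose Phi u v w := (sgl a u * tree_const (last a u) v) *:
  (tree a (u ++ last (last a u) v :: w) +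
   h a (last a l) (tree2 a (u ++ last (last a u) v :: w))).
transitivity (\sum_(u <- splitseq l) \sum_(w <- splitseq u.2) Phi u.1 w.1 w.2).
  apply: eq_bigr => u _; rewrite h_sum -big_split /=; apply: eq_bigr => w _.
  by rewrite hZ -scalerDr.
rewrite big_splitseq_middle; last first.
  move=> u v w uvw uw; rewrite /Phi treeE; last by rewrite size_cat /= addnS ltnS.
  have [v0|v0] := posnP (size v).
    by rewrite tree_const_small ?v0 // mulr0 scale0r.
  have -> : last a (u ++ last (last a u) v :: w) = last a l.
    by rewrite -uvw !last_cat.
  by rewrite addNr scaler0.
by rewrite /Phi /= mul1r tree1 tree2_small // h0 addr0.
Qed.

(** The image of [d_tree2] under [proj], which kills the exact term. *)
Lemma tree_const_rel a l : ainf_lhs (tree_const : Ob -> seq Ob -> R^o) a l = 0.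
Proof.
have /(congr1 (proj a (last a l))) := @d_tree2 a l (fun b u _ => functor_relP b u).
rewrite proj0 (linD (f := proj a (last a l) : A -> R^o) (@proj_lin _ _)).
rewrite proj_d add0r => <-; rewrite /ainf_lhs proj_sum.
pose Phi u r := \sum_(w <- splitseq r) (sgl a u * tree_const (last a u) w.1) *:
   (tree_const a (u ++ last (last a u) w.1 :: w.2) : R^o).
pose Psi u r := proj a (last a l) (\sum_(w <- splitseq r) (sgl a u * tree_const (last a u) w.1) *:
   (tree2 a (u ++ last (last a u) w.1 :: w.2))).
apply: (eq_big_splitseq (Phi := Phi) (Psi := Psi)) => u r ur.
rewrite /Phi /Psi proj_sum.
pose Phi' v w := (sgl a u * tree_const (last a u) v) *:
   (tree_const a (u ++ last (last a u) v :: w) : R^o).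
pose Psi' v w := proj a (last a l) ((sgl a u * tree_const (last a u) v) *:
   (tree2 a (u ++ last (last a u) v :: w))).
apply: (eq_big_splitseq (Phi := Phi') (Psi := Psi')) => v w vw.
by rewrite /Phi' /Psi' projZ /tree_const -ur -vw !last_cat.
Qed.

End Transfer.


#[local] Arguments splits : simpl never.

(** * A-infinity categories from structure constants *)

Section PathObjects.
Variables (Ob : Type) (E : Ob -> Ob -> Type).

Fixpoint pobj a b (p : path_of E a b) : seq Ob :=
  if p is pcons _ c _ _ p' then c :: pobj p' else [::].

Lemma pobj_last a b (p : path_of E a b) : last a (pobj p) = b.
Proof. by elim: p. Qed.

Lemma size_pobj a b (p : path_of E a b) : size (pobj p) = plen p.
Proof. by elim: p => //= *; congr S. Qed.

Lemma pobj_pcat a b c (p : path_of E a b) (q : path_of E b c) :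
  pobj (pcat p q) = pobj p ++ pobj q.
Proof. by elim: p q => //= a' b' c' x p IH q; rewrite IH. Qed.

Lemma plen_pcat a b c (p : path_of E a b) (q : path_of E b c) :
  plen (pcat p q) = (plen p + plen q)%N.
Proof. by rewrite -!size_pobj pobj_pcat size_cat. Qed.

(** Moves a sum over factorisations of a dependently typed path to the list of its objects, where
    the transfer was carried out. *)
Lemma big_splits_pobj (W : zmodType) a b (p : path_of E a b)
    (F : {d : Ob & (path_of E a d * path_of E d b)%type} -> W)
    (Phi : seq Ob -> seq Ob -> W) :
  (forall c q r, pcat q r = p -> F (existT _ c (q, r)) = Phi (pobj q) (pobj r)) ->
  \sum_(u <- splits p) F u = \sum_(u <- splitseq (pobj p)) Phi u.1 u.2.
Proof.
elim: p F Phi => [a'|a' b' c' x p IH] F Phi H.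
  by rewrite big_splits_nil big_splitseq_nil H.
rewrite big_splits_cons big_splitseq_cons H //; congr (_ + _).
by apply: (IH _ (fun u v => Phi (b' :: u) v)) => c q r qr; rewrite H //= qr.
Qed.

End PathObjects.

Section Signs.
Variable R : fieldType.

Lemma sgnzD (m n : int) : sgnz R (m + n) = sgnz R m * sgnz R n.
Proof. by rewrite /sgnz expfzDr // oppr_eq0 oner_eq0. Qed.

Lemma sgnz0 : sgnz R 0 = 1.
Proof. by []. Qed.

Lemma sgnz1 : sgnz R 1 = -1.
Proof. by rewrite /sgnz expr1z. Qed.

Lemma sgnz_even (k m n : int) : m = n + 2 * k -> sgnz R m = sgnz R n.
Proof.
move=> ->; rewrite sgnzD {2}/sgnz -exprz_exp -[_ ^ 2]/((-1) ^+ 2) sqrrN expr1n.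
by rewrite exp1rz mulr1.
Qed.

Lemma sgnzK (m : int) : sgnz R m * sgnz R m = 1.
Proof. by rewrite -sgnzD -sgnz0; apply: (@sgnz_even m); ring. Qed.

End Signs.

Section RowQuiver.
Variables (R : fieldType) (Ob : Type) (k : Ob -> Ob -> int -> nat).

Definition row_quiver : graded_quiver R Ob := fun a b d => 'rV[R]_(k a b d).

(** The coordinate in dimension one and 0 in dimension zero, uniformly in the degree. *)
Definition hval a b (x : helt row_quiver a b) : R :=
  \sum_j (tagged x : 'rV_(k a b (tag x))) 0 j.

Fixpoint pval a b (p : hpath row_quiver a b) : R :=
  if p is pcons _ _ _ x p' then hval x * pval p' else 1.

Lemma hval_lin a b d (c : R) (x y : row_quiver a b d) :
  hval (hel (c *: x + y)) = c * hval (hel x) + hval (hel y).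
Proof.
rewrite /hval mulr_sumr -big_split; apply: eq_bigr => j _.
by rewrite /= !mxE.
Qed.

Lemma pval_pcat a b c (p : hpath row_quiver a b) (q : hpath row_quiver b c) :
  pval (pcat p q) = pval p * pval q.
Proof. by elim: p q => [*|a' b' c' x p IH q] /=; rewrite ?mul1r // IH mulrA. Qed.

End RowQuiver.

Section Degrees.
Variables (R : fieldType) (Ob : Type) (V : graded_quiver R Ob).

Definition sdeg a b (p : hpath V a b) : int := hdeg p - (plen p)%:Z.

(* The exponent of the sign relating suspended and unsuspended operations. *)
Fixpoint uexp a b (p : hpath V a b) : int :=
  if p is pcons _ _ _ x p' then (plen p')%:Z * (tag x - 1) + uexp p' else 0.

Lemma uexp_pcat a b c (p : hpath V a b) (q : hpath V b c) :
  uexp (pcat p q) = uexp p + (plen q)%:Z * sdeg p + uexp q.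
Proof.
elim: p q => [*|a' b' c' x p IH q] /=; rewrite /sdeg /=.
  by rewrite subr0 mulr0 add0r.
by rewrite IH plen_pcat PoszD /sdeg -[(_.+1)%:Z]/(Posz _) intS; ring.
Qed.

Lemma uexp_insert a b c d (p1 : hpath V a b) (p2 : hpath V b c) (p3 : hpath V c d)
    (x : helt V b c) : tag x = hdeg p2 + 2 - (plen p2)%:Z ->
  uexp (pcat p1 (pcat p2 p3)) =
  uexp (pcat p1 (pcons x p3)) + uexp p2 + ((plen p2)%:Z - 1) * sdeg p1 - (plen p3)%:Z.
Proof.
move=> tx; rewrite !uexp_pcat /= tx plen_pcat PoszD /sdeg.
rewrite -[(_.+1)%:Z]/(Posz _) intS; ring.
Qed.

End Degrees.

(* [Hom(a, b)] is one-dimensional, of degree [D a b], and [B a l] is the constant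
   of the suspended operation on the basis elements along [a :: l], whose total
   degree in the suspension is [sig a l]. *)
Section FromConstants.
Variables (R : fieldType) (Ob : Type) (D : Ob -> Ob -> int).
Variable B : Ob -> seq Ob -> R.

Fixpoint sig a (l : seq Ob) : int :=
  if l is b :: l' then D a b - 1 + sig b l' else 0.

Lemma sig_cat a l r : sig a (l ++ r) = sig a l + sig (last a l) r.
Proof. by elim: l a => [|b l IH] a /=; rewrite ?add0r // IH addrA. Qed.

Hypothesis B_nil : forall a, B a [::] = 0.
Hypothesis B_deg : forall a l, B a l != 0 -> sig a l + 1 = D a (last a l) - 1.
Hypothesis B_rel : forall a l,
  \sum_(u <- splitseq l) \sum_(w <- splitseq u.2)
    sgnz R (sig a u.1) * B (last a u.1) w.1 *
      B a (u.1 ++ last (last a u.1) w.1 :: w.2) = 0.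

(** The boolean is read as a dimension, 0 or 1, which avoids transport between equal degrees. *)
Definition chom : graded_quiver R Ob := row_quiver R (fun a b d => d == D a b).

Lemma hval_tag a b (x : helt chom a b) : hval x != 0 -> tag x = D a b.
Proof.
case: x => d x; rewrite /hval /=; move: x; rewrite /chom /row_quiver.
by case: eqP => // dD x; rewrite big_ord0 eqxx.
Qed.

Lemma pval_sdeg a b (p : hpath chom a b) : pval p != 0 -> sdeg p = sig a (pobj p).
Proof.
elim: p => [|a' b' c' x p IH] //=; rewrite mulf_eq0 negb_or => /andP[x0 /IH pE].
by rewrite -pE /sdeg /= (hval_tag x0) -[(_.+1)%:Z]/(Posz _) intS; ring.
Qed.

Definition cval a b (p : hpath chom a b) : R :=
  sgnz R (uexp p) * pval p * B a (pobj p).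

Definition cmult a b (p : hpath chom a b) (e : int) : chom a b e :=
  const_mx (cval p).

Lemma hval_const a b d (c : R) :
  hval (hel (const_mx c : chom a b d)) = if d == D a b then c else 0.
Proof.
rewrite /hval /hel /=; case: eqP => dD.
  by rewrite big_ord_recl big_ord0 addr0 mxE.
by rewrite big_ord0.
Qed.

Lemma const_mx0E a b d (c : R) : c = 0 -> const_mx c = 0 :> chom a b d.
Proof. by move=> ->; apply/rowP => j; rewrite !mxE. Qed.

Lemma cmult_nil a e : cmult (pnil a) e = 0.
Proof. by apply: const_mx0E; rewrite /cval /= B_nil mulr0. Qed.

Lemma cmult_multilinear a b : multilinear (@cmult a b).
Proof.
move=> c d p q i k x y e; apply/rowP => j; rewrite !mxE /cval.
rewrite !pval_pcat /= !pobj_pcat /= !uexp_pcat /= hval_lin.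
ring.
Qed.

Lemma cval_deg a b (p : hpath chom a b) :
  cval p != 0 -> hdeg p + 2 - (plen p)%:Z = D a b.
Proof.
rewrite /cval -mulrA mulf_eq0 negb_or => /andP[_]; rewrite mulf_eq0 negb_or.
move=> /andP[/pval_sdeg pE /B_deg]; rewrite -pE pobj_last /sdeg => E.
by rewrite -[RHS](subrK 1) -E; ring.
Qed.

Lemma cmult_degree a b (p : hpath chom a b) (e : int) :
  e != hdeg p + 2 - (plen p)%:Z -> cmult p e = 0.
Proof.
move=> ep; have [|/cval_deg E] := eqVneq (cval p) 0; first exact: const_mx0E.
have eD : (e == D a b) = false by rewrite -E (negbTE ep).
apply/rowP => j; exfalso; case: j => j /=.
by rewrite eD.
Qed.

Lemma hval_cmult a b (p : hpath chom a b) :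
  hval (hel (cmult p (hdeg p + 2 - (plen p)%:Z))) = cval p.
Proof.
rewrite hval_const; case: eqP => // E.
by apply/esym/eqP; apply: contraT => /cval_deg.
Qed.

(** The sign of the A-infinity relation becomes the suspended sign times a factor depending only on
    the whole path, which can be taken out of the sum. *)
Lemma cval_insert a b c d (p1 : hpath chom a b) (p2 : hpath chom b c)
    (p3 : hpath chom c d) (p := pcat p1 (pcat p2 p3)) :
  sgnz R (((plen p1)%:Z + 1) * ((plen p2)%:Z + 1) + (plen p2)%:Z * hdeg p1) *
  cval (pcat p1 (pcons (hel (cmult p2 (hdeg p2 + 2 - (plen p2)%:Z))) p3)) =
  sgnz R (uexp p + (plen p)%:Z + 1) * pval p *
    (sgnz R (sig a (pobj p1)) * B b (pobj p2) * B a (pobj p1 ++ c :: pobj p3)).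
Proof.
set x := hel _; rewrite {1}/cval pval_pcat /= pobj_pcat /=.
rewrite hval_cmult /cval /p !pval_pcat.
have [->|/pval_sdeg p10] := eqVneq (pval p1) 0; first by rewrite !(mul0r, mulr0).
set U1 := uexp (pcat p1 _); set U := uexp (pcat p1 _).
have UE : U = U1 + uexp p2 + ((plen p2)%:Z - 1) * sdeg p1 - (plen p3)%:Z.
  exact: uexp_insert.
set e0 := _ + _ * hdeg p1.
have S : sgnz R e0 * sgnz R U1 * sgnz R (uexp p2) =
    sgnz R (U + (plen (pcat p1 (pcat p2 p3)))%:Z + 1) * sgnz R (sig a (pobj p1)).
  (* By [uexp_insert] the two exponents differ by twice the product of the lengths of [p1] and
     [p2]. *)
  rewrite -!sgnzD; apply: (@sgnz_even _ ((plen p1)%:Z * (plen p2)%:Z)).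
  rewrite /e0 UE !plen_pcat !PoszD -p10 /sdeg; ring.
transitivity (sgnz R e0 * sgnz R U1 * sgnz R (uexp p2) *
  (pval p1 * (pval p2 * pval p3) * B b (pobj p2) * B a (pobj p1 ++ c :: pobj p3))).
  ring.
by rewrite S; ring.
Qed.

Lemma cmult_relation a b (p : hpath chom a b) (e : int) :
  \sum_(u <- splits p)
   \sum_(w <- splits (tagged u).2 | (0 < plen (tagged w).1)%N)
     (let p1 := (tagged u).1 in let p2 := (tagged w).1 in
      let p3 := (tagged w).2 in
      let j := (plen p1)%:Z in let l := (plen p2)%:Z in
      sgnz R ((j + 1) * (l + 1) + l * hdeg p1) *:
      cmult (pcat p1 (pcons (hel (cmult p2 (hdeg p2 + 2 - l))) p3)) e) = 0.
Proof.
apply/rowP => j; rewrite mxE summxE.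
pose K := sgnz R (uexp p + (plen p)%:Z + 1) * pval p.
pose Phi u v w := K * (sgnz R (sig a u) * B (last a u) v * B a (u ++ last (last a u) v :: w)).
transitivity (\sum_(u <- splitseq (pobj p)) \sum_(w <- splitseq u.2) Phi u.1 w.1 w.2).
  apply: (big_splits_pobj (Phi := fun u r => \sum_(w <- splitseq r) Phi u w.1 w.2)) => c q r qr.
  rewrite summxE big_mkcond /=.
  apply: (big_splits_pobj (Phi := fun v w => Phi (pobj q) v w)) => d v w vw.
  rewrite /Phi /K !pobj_last; case: posnP => [v0|_].
    have -> : pobj v = [::] by apply/size0nil; rewrite size_pobj.
    by rewrite B_nil !(mulr0, mul0r).
  by rewrite -qr -vw /= !mxE cval_insert.
have -> : \sum_(u <- splitseq (pobj p)) \sum_(w <- splitseq u.2) Phi u.1 w.1 w.2 =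
    K * (\sum_(u <- splitseq (pobj p)) \sum_(w <- splitseq u.2)
    sgnz R (sig a u.1) * B (last a u.1) w.1 *
      B a (u.1 ++ last (last a u.1) w.1 :: w.2)).
  by rewrite mulr_sumr; apply: eq_bigr => u _; rewrite mulr_sumr.
by rewrite B_rel mulr0.
Qed.

Definition C_const : ainf_category R Ob :=
  AinfCategory cmult_nil cmult_multilinear cmult_degree cmult_relation.

End FromConstants.


(** * Functors to the de Rham category from structure constants *)

Section Blocks.
Variables (W : zmodType) (Ob : Type) (E : Ob -> Ob -> Type).

(** The alternative in [blocks] where [x] joins the first block; without a first block it
    contributes nothing. *)
Definition pcons_head a b c (x : E a b) (P : path_of (path_of E) b c)
    (Phi : path_of (path_of E) a c -> W) : W :=
  match P in path_of _ b c
    return (path_of (path_of E) a c -> W) -> E a b -> W with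
  | pnil _ => fun _ _ => 0
  | pcons _ _ _ q P' => fun Phi x => Phi (pcons (pcons x q) P')
  end Phi x.

Lemma big_blocks_cons a b c (x : E a b) (p : path_of E b c)
    (Phi : path_of (path_of E) a c -> W) :
  \sum_(P <- blocks (pcons x p)) Phi P =
  \sum_(P <- blocks p) Phi (pcons (pcons x (pnil b)) P) +
  \sum_(P <- blocks p) pcons_head x P Phi.
Proof.
rewrite /= big_flatten /= big_map -big_split /=; apply: eq_bigr => P _.
rewrite big_cons; congr (_ + _).
by case: P x Phi => [d|d e g q P] x Phi; rewrite ?big_nil // big_seq1.
Qed.

Lemma eq_big_blocks a b (p : path_of E a b) (Phi Psi : path_of (path_of E) a b -> W) :
  (0 < plen p)%N -> (forall P, (0 < plen P)%N -> Phi P = Psi P) ->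
  \sum_(P <- blocks p) Phi P = \sum_(P <- blocks p) Psi P.
Proof.
case: p Phi Psi => // a' b1 c' x p Phi Psi _ H; rewrite !big_blocks_cons.
congr (_ + _); apply: eq_bigr => P _; first by rewrite H.
by case: P x Phi Psi H => [d|d e g q P] x Phi Psi H //=; rewrite H.
Qed.

Lemma big_blocks1 a b (p : path_of E a b) (Phi : path_of (path_of E) a b -> W) :
  (0 < plen p)%N -> (forall P, (1 < plen P)%N -> Phi P = 0) ->
  \sum_(P <- blocks p) Phi P = Phi (pcons p (pnil b)).
Proof.
elim: p Phi => // a' b1 c' x p IH Phi _ H; rewrite big_blocks_cons.
have [p0|p0] := posnP (plen p).
  by case: p p0 {IH} x Phi H => // d _ x Phi H; rewrite /= !big_seq1 addr0.
rewrite (eq_big_blocks (Psi := fun=> 0) p0) => [|P P0]; last by rewrite H.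
rewrite big1 // add0r IH // => P P1.
by case: P P1 x Phi H => [d|d e g q P] P1 x Phi H //=; rewrite H.
Qed.

(** The target is a DG category, so only factorisations into one or two blocks survive in the
    functor equation. *)
Lemma big_blocks2 a b (p : path_of E a b) (Phi : path_of (path_of E) a b -> W) :
  (0 < plen p)%N -> (forall P, (2 < plen P)%N -> Phi P = 0) ->
  \sum_(P <- blocks p) Phi P = Phi (pcons p (pnil b)) +
    \sum_(u <- splits p)
      if (0 < plen (tagged u).1)%N && (0 < plen (tagged u).2)%N
      then Phi (pcons (tagged u).1 (pcons (tagged u).2 (pnil b))) else 0.
Proof.
elim: p Phi => // a' b1 c' x p IH Phi _ H; rewrite big_blocks_cons big_splits_cons /= add0r.
have [p0|p0] := posnP (plen p).
  case: p p0 {IH} x Phi H => // d _ x Phi H.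
  by rewrite big_splits_nil /= !big_seq1 !addr0.
rewrite big_blocks1 // => [|P P1]; last by rewrite H.
rewrite IH // => [|P P1]; last first.
  by case: P P1 x Phi H => [d|d e g q P] P1 x Phi H //=; rewrite H.
rewrite /= addrCA; congr (_ + _).
case: p p0 {IH} x Phi H => // b2 b3 c2 y p _ x Phi H.
by rewrite !big_splits_cons /= add0r.
Qed.

End Blocks.

Section FunctorFromConstants.
Variables (R : realType) (Ob : Type) (f : Ob -> {poly R}) (D : Ob -> Ob -> int).
Variables (B : Ob -> seq Ob -> R) (G : Ob -> seq Ob -> schwartzType R * schwartzType R).

Hypothesis B_nil : forall a, B a [::] = 0.
Hypothesis B_one : forall a b, B a [:: b] = 0.
Hypothesis B_deg : forall a l, B a l != 0 -> sig D a l + 1 = D a (last a l) - 1.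
Hypothesis B_rel : forall a l,
  \sum_(u <- splitseq l) \sum_(w <- splitseq u.2)
    sgnz R (sig D a u.1) * B (last a u.1) w.1 *
      B a (u.1 ++ last (last a u.1) w.1 :: w.2) = 0.
Hypothesis G_nil : forall a, G a [::] = 0.
Hypothesis G_deg : forall a l (e : int), e != sig D a l + 1 -> form_part (G a l) e = 0.
Hypothesis G_rel : forall a l,
  dform f a (last a l) (G a l) +
  \sum_(u <- splitseq l) sgnz R (sig D a u.1) *: wedge (G a u.1) (G (last a u.1) u.2) =
  \sum_(u <- splitseq l) \sum_(w <- splitseq u.2)
    (sgnz R (sig D a u.1) * B (last a u.1) w.1) *:
      G a (u.1 ++ last (last a u.1) w.1 :: w.2).

Let C := C_const B_nil B_deg B_rel.
Let C' := C_DR f.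

(** Desuspension with its type restated through [chom], so that [pval], [sdeg] and [uexp] apply. *)
Definition dpath a b (p : hpath (shom C) a b) : hpath (chom R D) a b := desusp p.

Lemma pobj_dpath a b (p : hpath (shom C) a b) : pobj (dpath p) = pobj p.
Proof. by elim: p => //= a' b' c' x p <-. Qed.

Lemma plen_dpath a b (p : hpath (shom C) a b) : plen (dpath p) = plen p.
Proof. by rewrite -!size_pobj pobj_dpath. Qed.

Lemma dpath_pcat a b c (p : hpath (shom C) a b) (q : hpath (shom C) b c) :
  dpath (pcat p q) = pcat (dpath p) (dpath q).
Proof. by elim: p q => //= a' b' c' x p IH q; congr pcons; exact: IH. Qed.

Lemma sdeg_dpath a b (p : hpath (shom C) a b) : sdeg (dpath p) = hdeg p.
Proof.
rewrite /sdeg plen_dpath; elim: p => //= a' b' c' x p <-.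
by rewrite -[(_.+1)%:Z]/(Posz _) intS; ring.
Qed.

Lemma uexp_dpath a b (p : hpath (shom C) a b) : uexp (dpath p) = susp_exponent p.
Proof.
elim: p => //= a' b' c' x p <-; rewrite addrK; congr (_ * _ + _).
by rewrite -[plen (Defs.pmap _ _)]/(plen (dpath p)) plen_dpath.
Qed.

Definition fcomp a b (p : hpath (shom C) a b) (e : int) : shom C' a b e :=
  form_part (pval (dpath p) *: G a (pobj p)) (e + 1).

Lemma form_part_scale (c : R) w e : form_part (c *: w) e = c *: form_part w e.
Proof. by rewrite -[_ *: w]addr0 form_part_lin form_part0 addr0. Qed.

Lemma fcomp_nil a e : fcomp (pnil a) e = 0.
Proof. by rewrite /fcomp /= G_nil scaler0 form_part0. Qed.

Lemma fcomp_multilinear a b : multilinear (@fcomp a b).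
Proof.
move=> c d p q i k x y e; rewrite /fcomp.
rewrite !dpath_pcat /= !pval_pcat /= !pobj_pcat /= hval_lin.
rewrite -form_part_lin; apply: (congr1 (fun w => form_part w (e + 1))).
rewrite scalerA -scalerDl; congr (_ *: _); rewrite -[pval (Defs.pmap _ q)]/(pval (dpath q)).
ring.
Qed.

Lemma form_part_deg a b (p : hpath (shom C) a b) (e : int) :
  e != hdeg p + 1 -> form_part (pval (dpath p) *: G a (pobj p)) e = 0.
Proof.
move=> ep; rewrite form_part_scale.
have [->|p0] := eqVneq (pval (dpath p)) 0; first by rewrite scale0r.
rewrite G_deg ?scaler0 //.
by rewrite -pobj_dpath -(pval_sdeg p0) sdeg_dpath.
Qed.

Lemma fcomp_degree a b (p : hpath (shom C) a b) (e : int) :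
  e != hdeg p -> fcomp p e = 0.
Proof. by move=> ep; apply: form_part_deg; rewrite (inj_eq (addIr _)). Qed.

Lemma form_fcomp a b (p : hpath (shom C) a b) :
  Defs.form (fcomp p (hdeg p)) = pval (dpath p) *: G a (pobj p).
Proof.
have E (w : schwartzType R * schwartzType R) (d : int) :
    (forall e, e != d -> form_part w e = 0) -> Defs.form (form_part w d) = w.
  case: w => w0 w1 H; have := H 0; have := H 1.
  by case: d H => [[|[|d]]|d] H /= H1 H0; rewrite ?(H1 isT) ?(H0 isT).
by apply: E => e ep; exact: form_part_deg.
Qed.

Lemma smult_dpath a b (p : hpath (shom C) a b) e :
  smult p e = const_mx (pval (dpath p) * B a (pobj p)) :> chom R D a b (e + 1).
Proof.
rewrite /smult -uexp_dpath; apply/rowP => j.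
rewrite [LHS]mxE [in LHS]mxE [RHS]mxE /cval pobj_dpath -/(dpath p).
by rewrite !mulrA sgnzK mul1r.
Qed.

Lemma fcomp_insert a b c d (p1 : hpath (shom C) a b) (p2 : hpath (shom C) b c)
    (p3 : hpath (shom C) c d) e :
  fcomp (pcat p1 (pcons (hel (smult p2 (hdeg p2 + 1))) p3)) e =
  pval (dpath (pcat p1 (pcat p2 p3))) * B b (pobj p2) *:
    form_part (G a (pobj p1 ++ c :: pobj p3)) (e + 1).
Proof.
rewrite /fcomp pobj_pcat /= form_part_scale; congr (_ *: _).
rewrite !dpath_pcat !pval_pcat /=.
have -> : hval (hel (smult p2 (hdeg p2 + 1) : chom R D b c (hdeg p2 + 1 + 1))) =
    pval (dpath p2) * B b (pobj p2).
  (* A nonzero value has the degree prescribed by [B_deg]; in any other degree both sides are 0. *)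
  rewrite smult_dpath hval_const; case: eqP => // E; apply/esym/eqP.
  apply: contraT => H; case: E; have := @cval_deg _ _ _ _ B_deg _ _ (dpath p2).
  rewrite /cval pobj_dpath -mulrA mulf_eq0 negb_or H.
  have -> : sgnz R (uexp (dpath p2)) != 0.
    by apply/eqP => s0; have := sgnzK R (uexp (dpath p2)); rewrite s0 mul0r => /eqP; rewrite eq_sym oner_eq0.
  by move=> /(_ isT) <-; rewrite -sdeg_dpath /sdeg; ring.
rewrite -[Defs.pmap _ p3]/(dpath p3); ring.
Qed.

Lemma dform_scale a b (c : R) w : dform f a b (c *: w) = c *: dform f a b w.
Proof. by rewrite -[_ *: w]addr0 dform_lin dform0 addr0. Qed.

Lemma wedge_scale (c c' : R) w w' : wedge (c *: w) (c' *: w') = c * c' *: wedge w w'.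
Proof.
rewrite (linZ (f := fun z => wedge z _) (fun k x y => @wedge_linl R k x y _)).
by rewrite (linZ (f := wedge w) (fun k x y => @wedge_linr R k x y w)) scalerA.
Qed.

Lemma smult_map1 a b (p : hpath (shom C) a b) e :
  smult (C := C') (pcons (hel (fcomp p (hdeg p))) (pnil b)) e =
  form_part (pval (dpath p) *: dform f a b (G a (pobj p))) (e + 1).
Proof.
rewrite /smult [susp_exponent _]/= mul0r addr0 sgnz0 scale1r.
rewrite -[mult _ _]/(form_part (dform f a b (Defs.form (fcomp p (hdeg p)))) (e + 1)).
by rewrite form_fcomp dform_scale.
Qed.

Lemma smult_map2 a b c (p : hpath (shom C) a b) (q : hpath (shom C) b c) e :
  smult (C := C') (pcons (hel (fcomp p (hdeg p))) (pcons (hel (fcomp q (hdeg q))) (pnil c))) e =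
  form_part (pval (dpath (pcat p q)) *:
    (sgnz R (hdeg p) *: wedge (G a (pobj p)) (G b (pobj q)))) (e + 1).
Proof.
rewrite /smult [susp_exponent _]/= mul1r mul0r !addr0.
rewrite -[mult _ _]/(form_part (wedge (Defs.form (fcomp p (hdeg p)))
  (Defs.form (fcomp q (hdeg q)))) (e + 1)).
rewrite !form_fcomp wedge_scale !form_part_scale !scalerA dpath_pcat pval_pcat.
by congr (_ *: _); ring.
Qed.

Lemma smult_long a b (P : hpath (shom C') a b) e : (2 < plen P)%N -> smult P e = 0.
Proof.
move=> P2; rewrite /smult -[mult _ _]/(form_part (dr_form f (desusp P)) (e + 1)).
have E : plen (desusp P) = plen P by elim: P {P2} => //= a' b' c' x p <-.
by rewrite dr_form_ge3 ?E // form_part0 scaler0.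
Qed.

(** The actual degree can differ from [sig] only on paths containing a zero element, where the
    factor [pval] vanishes. *)
Lemma sgn_hdeg a b (p : hpath (shom C) a b) (x : R) :
  pval (dpath p) * (sgnz R (hdeg p) * x) = pval (dpath p) * (sgnz R (sig D a (pobj p)) * x).
Proof.
have [->|p0] := eqVneq (pval (dpath p)) 0; first by rewrite !mul0r.
by rewrite -sdeg_dpath (pval_sdeg p0) pobj_dpath.
Qed.

Lemma fcomp_relation a b (p : hpath (shom C) a b) (e : int) :
  (0 < plen p)%N ->
  \sum_(P <- blocks p)
     smult (Defs.pmap (E' := helt (shom C')) (g := id)
              (fun c d (q : hpath (shom C) c d) => hel (fcomp q (hdeg q))) P) e
  = \sum_(u <- splits p)
     \sum_(w <- splits (tagged u).2 | (0 < plen (tagged w).1)%N)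
       (let p1 := (tagged u).1 in let p2 := (tagged w).1 in
        let p3 := (tagged w).2 in
        sgnz R (hdeg p1) *:
        fcomp (pcat p1 (pcons (hel (smult p2 (hdeg p2 + 1))) p3)) e).
Proof.
move=> p0.
have fpD (w w' : schwartzType R * schwartzType R) :
    form_part (w + w') (e + 1) = form_part w (e + 1) + form_part w' (e + 1).
  exact: (linD (f := fun w => form_part w (e + 1)) (@form_part_lin R (e + 1))).
rewrite big_blocks2 //; last first.
  move=> P P2; apply: smult_long; apply: leq_trans P2 _.
  by elim: {+}P.
rewrite [Defs.pmap _ _]/= smult_map1.
set T := (X in _ + X = _).
pose F u v := form_part (pval (dpath p) *: (sgnz R (sig D a u) *: wedge (G a u) (G (last a u) v))) (e + 1).
have -> : T = \sum_(u <- splitseq (pobj p)) F u.1 u.2.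
  apply: big_splits_pobj => c q r qr /=; rewrite /F pobj_last.
  have [q0|q0] := posnP (plen q).
    have -> : pobj q = [::] by apply/size0nil; rewrite size_pobj.
    by rewrite G_nil wedge0l !scaler0 form_part0.
  have [r0|r0] := posnP (plen r).
    have -> : pobj r = [::] by apply/size0nil; rewrite size_pobj.
    by rewrite G_nil wedge0r !scaler0 form_part0.
  rewrite smult_map2 !form_part_scale !scalerA -qr; congr (_ *: _).
  by rewrite dpath_pcat pval_pcat mulrAC -[sgnz _ _]mulr1 sgn_hdeg mulr1 mulrAC.
have <- : form_part (\sum_(u <- splitseq (pobj p)) pval (dpath p) *:
    (sgnz R (sig D a u.1) *: wedge (G a u.1) (G (last a u.1) u.2))) (e + 1) =
    \sum_(u <- splitseq (pobj p)) F u.1 u.2.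
  by rewrite (big_morph _ fpD (form_part0 R (e + 1))).
have GR := G_rel a (pobj p); rewrite pobj_last in GR.
rewrite -fpD -scaler_sumr -scalerDr GR.
rewrite scaler_sumr (big_morph _ fpD (form_part0 R (e + 1))).
apply/esym.
pose H u r := form_part (pval (dpath p) *: \sum_(w <- splitseq r)
    (sgnz R (sig D a u) * B (last a u) w.1) *:
      G a (u ++ last (last a u) w.1 :: w.2)) (e + 1).
apply: (big_splits_pobj (Phi := H)) => c q r qr; rewrite /H pobj_last.
rewrite scaler_sumr (big_morph _ fpD (form_part0 R (e + 1))) big_mkcond /=.
pose H' v w := form_part (pval (dpath p) *:
    ((sgnz R (sig D a (pobj q)) * B c v) *: G a (pobj q ++ last c v :: w))) (e + 1).
apply: (big_splits_pobj (Phi := H')) => d v w vw; rewrite /H' /= pobj_last.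
have [v0|v0] := posnP (plen v).
  have -> : pobj v = [::] by apply/size0nil; rewrite size_pobj.
  by rewrite B_nil mulr0 scale0r scaler0 form_part0.
rewrite fcomp_insert !form_part_scale !scalerA vw qr; congr (_ *: _).
rewrite -qr dpath_pcat pval_pcat.
transitivity (pval (dpath q) * (sgnz R (hdeg q) * (pval (dpath r) * B c (pobj v)))).
  ring.
rewrite sgn_hdeg; ring.
Qed.

Definition functor_const : ainf_functor C C' :=
  AinfFunctor fcomp_nil fcomp_multilinear fcomp_degree fcomp_relation.

Hypothesis coh_inj : forall a b (c : R) w, c *: G a [:: b] = dform f a b w -> c = 0.
Hypothesis coh_surj : forall a b w, dform f a b w = 0 ->
  exists (c : R) z, c *: G a [:: b] = w + dform f a b z.

Lemma chom_eq0 a b d (x : chom R D a b d) : hval (hel x) = 0 -> x = 0.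
Proof.
rewrite /hval /=; move: x; rewrite /chom /row_quiver; case: eqP => _ x.
  by rewrite big_ord_recl big_ord0 addr0 => x0; apply/rowP => j; rewrite ord1 x0 mxE.
by move=> _; apply/rowP; case.
Qed.

Lemma form_partE (w w' : schwartzType R * schwartzType R) :
  (forall e, form_part w e = form_part w' e) -> w = w'.
Proof. by case: w w' => [u v] [u' v'] H; have /= -> := H 0; have /= -> := H 1. Qed.

Lemma formK d (y : Omega R d) : form_part (Defs.form y) d = y.
Proof. by case: d y => [[|[|d]]|d] y //=; apply/rowP; case. Qed.

Lemma form_part_dform a b w e : e != 1 -> form_part (dform f a b w) e = 0.
Proof. by case: e => [[|[|e]]|e]. Qed.

Lemma form_part_dform_form a b w n :
  form_part (dform f a b w) (n + 1) =
  form_part (dform f a b (Defs.form (form_part w n))) (n + 1).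
Proof.
have [->|n0] := eqVneq n 0; first by [].
by rewrite !form_part_dform // -subr_eq0 addrK.
Qed.

Lemma dform_form_deg a b d (y : Omega R d) e :
  e != d + 1 -> form_part (dform f a b (Defs.form y)) e = 0.
Proof.
have [->|e1] := eqVneq e 1; last by rewrite form_part_dform.
by case: d y => [[|[|d]]|d] y //= _; exact: (congr1 snd (dform0 f a b)).
Qed.

Lemma sdiff_const a b d (x : shom C a b d) : sdiff x = 0.
Proof.
rewrite /sdiff smult_dpath /= B_one mulr0.
by apply/rowP => j; rewrite !mxE.
Qed.

Lemma sdiff_dr a b d (y : shom C' a b d) :
  sdiff y = form_part (dform f a b (Defs.form y)) (d + 1 + 1).
Proof.
rewrite /sdiff /smult [susp_exponent _]/= mul0r addr0 sgnz0.
exact: scale1r.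
Qed.

Lemma flin_const a b d (x : shom C a b d) :
  flin functor_const x = form_part (hval (hel (x : chom R D a b (d + 1))) *: G a [:: b]) (d + 1).
Proof. by rewrite /flin /= /fcomp /= mulr1. Qed.

(** The differential of [C] is zero, so [coh_inj] and [coh_surj] are the two halves of the claim, up
    to separating forms by degree. *)
Lemma iso_const a b : iso_on_cohomology functor_const a b.
Proof.
move=> d; split=> [x _ [y]|y].
  rewrite flin_const sdiff_dr => E; exists 0; rewrite sdiff_const.
  apply: chom_eq0; apply: (@coh_inj a b _ (Defs.form y)).
  apply: form_partE => e; have [->//|ed] := eqVneq e (d + 1 + 1).
  rewrite (dform_form_deg _ _ _ ed).
  have := @form_part_deg _ _ (pcons (hel x) (pnil b)) e.
  by rewrite /= addr0 mulr1; apply.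
rewrite sdiff_dr => y0.
have /coh_surj[c [z cz]] : dform f a b (Defs.form y) = 0.
  apply: form_partE => e; rewrite form_part0.
  by have [->//|ed] := eqVneq e (d + 1 + 1 + 1); rewrite (dform_form_deg _ _ _ ed).
exists (const_mx c : chom R D a b (d + 1 + 1)), (form_part z (d + 1)).
split; first exact: sdiff_const.
rewrite flin_const sdiff_dr -form_part_dform_form.
have <- : form_part (c *: G a [:: b]) (d + 1 + 1) =
    y + form_part (dform f a b z) (d + 1 + 1).
  rewrite cz -{2}(formK y).
  exact: (linD (f := fun w => form_part w (d + 1 + 1)) (@form_part_lin R (d + 1 + 1))).
rewrite hval_const; case: eqP => // dD; rewrite !form_part_scale G_deg ?scaler0 //.
by rewrite /= addr0 subrK; apply/eqP.
Qed.

Lemma homotopy_equivalent_const : homotopy_equivalent C C'.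
Proof.
exists functor_const; split; last exact: iso_const.
by exists id.
Qed.

End FunctorFromConstants.

(** * Rapidly decreasing solutions of linear differential equations *)

Section RealCalculus.
Variable R : realType.
Implicit Types (f g F G : R -> R) (x y : R).

Definition rderiv f (f' : R -> R) := forall x, is_derive x 1 f (f' x).

Lemma rderiv_derive1 f f' : rderiv f f' -> derive1 f = f'.
Proof. by move=> H; apply/funext => x; rewrite derive1E; have := H x => ?; rewrite derive_val. Qed.

Lemma derivable_rderiv f : (forall x, derivable f x 1) -> rderiv f (derive1 f).
Proof. by move=> H x; rewrite derive1E; exact: derivableP. Qed.

Lemma rderiv_derivable f f' x : rderiv f f' -> derivable f x 1.
Proof. by move=> /(_ x) [? _]. Qed.

Lemma rderiv_continuous f f' : rderiv f f' -> continuous f.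
Proof.
move=> H x; apply/differentiable_continuous/derivable1_diffP.
exact: rderiv_derivable H.
Qed.

Lemma is_derive_pM f g x a b : is_derive x 1 f a -> is_derive x 1 g b ->
  is_derive x 1 (fun y => f y * g y) (a * g x + f x * b).
Proof.
move=> fa gb; apply: (is_derive_eq (f := f * g)).
by rewrite /GRing.scale /= addrC [g x * a]mulrC.
Qed.

Lemma is_derive_pD f g x a b : is_derive x 1 f a -> is_derive x 1 g b ->
  is_derive x 1 (fun y => f y + g y) (a + b).
Proof. by move=> fa gb; exact: (@is_deriveD _ _ _ f g). Qed.

Lemma is_derive_pB f g x a b : is_derive x 1 f a -> is_derive x 1 g b ->
  is_derive x 1 (fun y => f y - g y) (a - b).
Proof. by move=> fa gb; exact: (@is_deriveB _ _ _ f g). Qed.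

Lemma is_derive_pZ (k : R) f x a : is_derive x 1 f a ->
  is_derive x 1 (fun y => k * f y) (k * a).
Proof. by move=> fa; exact: (@is_deriveZ _ _ _ f k). Qed.

Lemma is_derive_pexp f x a : is_derive x 1 f a ->
  is_derive x 1 (fun y => expR (f y)) (a * expR (f x)).
Proof. by move=> fa; rewrite mulrC; exact: (@is_derive1_comp _ expR f). Qed.

Lemma is_derive_pshift f x (c a : R) : is_derive (x - c) 1 f a ->
  is_derive x 1 (fun y => f (y - c)) a.
Proof.
move=> fa; rewrite -[a]mulr1; apply: (@is_derive1_comp _ f (fun y => y - c)).
apply: is_derive_eq (is_derive_pB (is_derive_id _ _) (is_derive_cst _ _ _)) _.
exact: subr0.
Qed.

Lemma is_derive_preflect f x (c a : R) : is_derive (c - x) 1 f a ->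
  is_derive x 1 (fun y => f (c - y)) (- a).
Proof.
move=> fa; rewrite -[- a]mulrN1; apply: (@is_derive1_comp _ f (fun y => c - y)).
rewrite -sub0r; exact: is_derive_pB (is_derive_cst _ _ _) (is_derive_id _ _).
Qed.

Lemma MVT_itv f f' x y : x < y -> (forall z, x <= z <= y -> is_derive z 1 f (f' z)) ->
  exists2 z, x < z < y & f y - f x = f' z * (y - x).
Proof.
move=> xy H; have [||z] := @MVT _ f f' x y xy.
- by move=> z; rewrite in_itv /= => /andP[/ltW xz /ltW zy]; apply: H; rewrite xz.
- apply: derivable_within_continuous => z; rewrite in_itv /= => /H [? _] //.
- by rewrite in_itv /= => zI E; exists z.
Qed.

Lemma le0_deriv_nincr f f' (X : R) :
  (forall x, X <= x -> is_derive x 1 f (f' x)) -> (forall x, X <= x -> f' x <= 0) ->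
  forall x y, X <= x -> x <= y -> f y <= f x.
Proof.
move=> df f0 x y Xx; rewrite le_eqVlt => /orP[/eqP ->//|xy].
have [|z /andP[xz zy] E] := MVT_itv (f := f) (f' := f') xy.
  by move=> z /andP[xz _]; apply: df; exact: le_trans xz.
rewrite -subr_le0 E mulr_le0_ge0 ?subr_ge0 ?(ltW xy) // f0 //.
exact: le_trans (ltW xz).
Qed.

Lemma ge0_deriv_ndecr f f' (X : R) :
  (forall x, X <= x -> is_derive x 1 f (f' x)) -> (forall x, X <= x -> 0 <= f' x) ->
  forall x y, X <= x -> x <= y -> f x <= f y.
Proof.
move=> df f0 x y Xx xy; rewrite -lerN2.
apply: (@le0_deriv_nincr (fun x => - f x) (fun x => - f' x) X) => // z Xz.
  by have := df z Xz => ?; exact: (@is_deriveN _ _ _ f).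
by rewrite oppr_le0 f0.
Qed.

Lemma deriv0_eq f x y : x <= y -> (forall z, x <= z <= y -> is_derive z 1 f 0) -> f x = f y.
Proof.
rewrite le_eqVlt => /orP[/eqP ->//|xy] df.
have [z _] := MVT_itv (f' := fun=> 0) xy df.
by rewrite mul0r => /eqP; rewrite subr_eq0 => /eqP.
Qed.

(** The integral from [-n] is a primitive only to the right of [-n]. Normalised to vanish at 0,
    these primitives agree where several are defined and can be glued, with an index depending on
    the point. *)
Lemma continuous_primitive g : continuous g -> exists F, rderiv F g.
Proof.
move=> cg.
pose I n x := (\int[lebesgue_measure]_(t in `[- n%:R, x]) g t)%R : R.
have dI n x : - n%:R < x -> is_derive x 1 (I n) (g x).
  move=> nx; have [||||d <-] := @continuous_FTC1_closed R g (- n%:R) x (x + 1).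
  - by rewrite ltrDl.
  - apply: continuous_compact_integrable; first exact: segment_compact.
    exact: continuous_subspaceT.
  - by [].
  - exact: cg.
  by rewrite derive1E; exact: derivableP.
pose J n x := I n x - I n 0.
have dJ n x : - n%:R < x -> is_derive x 1 (J n) (g x).
  by move=> /dI ?; rewrite -[g x]subr0; apply: is_derive_pB; exact: is_derive_cst.
have JJ m n x : (0 < m)%N -> (m <= n)%N -> - m%:R < x -> J m x = J n x.
  move=> m0 mn mx; have mn' : - n%:R <= - m%:R :> R by rewrite lerN2 ler_nat.
  have d0 (z : R) : - m%:R < z -> is_derive z 1 (fun z => J m z - J n z) 0.
    move=> mz; rewrite -[0](subrr (g z)); apply: is_derive_pB; apply: dJ => //.
    exact: le_lt_trans mz.
  have E : J m 0 - J n 0 = 0 by rewrite /J !subrr.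
  apply/eqP; rewrite -subr_eq0; apply/eqP.
  have m0' : - m%:R < 0 :> R by rewrite oppr_lt0 ltr0n.
  have [x0|x0] := leP x 0.
    rewrite -E; apply: (deriv0_eq (f := fun z => J m z - J n z) x0) => z /andP[xz _].
    by apply: d0; exact: lt_le_trans xz.
  rewrite -E; apply/esym.
  apply: (deriv0_eq (f := fun z => J m z - J n z) (ltW x0)) => z /andP[z0 _].
  by apply: d0; exact: lt_le_trans z0.
pose k x := (Num.truncn `|x|).+1.
have kP x : - (k x)%:R < x.
  rewrite ltrNl; apply: le_lt_trans (ler_norm _) _; rewrite normrN.
  exact: truncnS_gt.
exists (fun x => J (k x) x) => x.
have kx : - (k x).+1%:R < x - 1 by rewrite -natr1 opprD ltrD2r kP.
apply: (near_eq_is_derive (f := J (k x).+1)); last first.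
  by apply: dJ; apply: lt_trans kx _; rewrite gtrBl.
near=> y.
have xy : - (k x).+1%:R < y.
  apply: lt_trans kx _; near: y; apply: lt_nbhsr; rewrite gtrBl //.
have [kxy|kxy] := leqP (k x).+1 (k y).
  exact: JJ.
by apply/esym/JJ => //; exact: ltnW.
Unshelve. all: by end_near. Qed.

End RealCalculus.

Section Decay.
Variable R : realType.
Implicit Types (q w phi psi : R -> R) (x X K : R).

(** Decay at plus infinity only; the other end is reached by reflection. *)
Definition rdecay phi := forall m, exists K X, forall x, X <= x -> `|x ^+ m * phi x| <= K.

Lemma is_derive_invX m x : 0 < x ->
  is_derive x 1 (fun y : R => y^-1 ^+ m) (- m%:R * x^-1 ^+ m.+1).
Proof.
move=> x0; have x0' : x != 0 by rewrite gt_eqF.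
have d1 : is_derive x 1 (fun y : R => y^-1) (- x^-1 ^+ 2).
  have := is_deriveV (f := fun y : R => y) x0' (is_derive_id x 1).
  by rewrite /GRing.scale /= mulr1 exprVn.
elim: m => [|m IH].
  by rewrite oppr0 mul0r; exact: is_derive_cst.
have -> : (fun y : R => y^-1 ^+ m.+1) = (fun y => y^-1 * y^-1 ^+ m).
  by apply/funext => y; rewrite exprS.
apply: is_derive_eq (is_derive_pM d1 IH) _.
by rewrite -natr1 !exprS; ring.
Qed.

(** Comparison with [K x^-m]: multiplied by the integrating factor [w], the difference is
    nondecreasing. Of the drift [m + 1], the part [m] pays for the derivative of [x^-m] and 1 for
    the source. *)
Lemma decay_le m q w phi psi K X : 1 <= X ->
  (forall x, X <= x -> is_derive x 1 phi (q x * phi x + psi x)) ->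
  (forall x, X <= x -> is_derive x 1 w (- q x * w x)) ->
  (forall x, 0 < w x) -> 0 <= K ->
  (forall x, X <= x -> q x <= - m.+1%:R) ->
  (forall x, X <= x -> `|x ^+ m * psi x| <= K) -> X ^+ m * phi X <= K ->
  forall x, X <= x -> x ^+ m * phi x <= K.
Proof.
move=> X1 dphi dw w0 K0 qX psiK phiX x Xx.
have pos y : X <= y -> 0 < y by move=> Xy; rewrite (lt_le_trans _ Xy) // (lt_le_trans _ X1).
have eqB y r : X <= y -> (y ^+ m * r <= K) = (r <= K * y^-1 ^+ m).
  by move=> /pos y0; rewrite mulrC exprVn ler_pdivlMr ?exprn_gt0.
rewrite eqB // -subr_ge0 -(pmulr_rge0 _ (w0 x)).
pose g y := w y * (K * y^-1 ^+ m - phi y).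
pose g' y := w y * (- q y * (K * y^-1 ^+ m) + K * (- m%:R * y^-1 ^+ m.+1) - psi y).
apply: (@le_trans _ _ (g X)).
  by rewrite /g pmulr_rge0 // subr_ge0 -eqB.
apply: (@ge0_deriv_ndecr _ g g' X) => // y Xy.
  apply: is_derive_eq (is_derive_pM (dw y Xy)
    (is_derive_pB (is_derive_pZ K (is_derive_invX m (pos y Xy))) (dphi y Xy))) _.
  by rewrite /g'; ring.
rewrite /g' pmulr_rge0 //.
have Bp : 0 <= K * y^-1 ^+ m by rewrite mulr_ge0 // exprn_ge0 // invr_ge0 ltW // pos.
have psiB : psi y <= K * y^-1 ^+ m.
  by rewrite -eqB //; apply: le_trans (psiK y Xy); exact: ler_norm.
rewrite subr_ge0; apply: le_trans psiB _.
rewrite exprS; set B := K * y^-1 ^+ m in Bp *.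
have -> : K * (- m%:R * (y^-1 * y^-1 ^+ m)) = - (m%:R * y^-1 * B) by rewrite /B; ring.
have mB : m%:R * y^-1 * B <= m%:R * B.
  rewrite ler_wpM2r // ler_piMr // invf_le1 ?pos //; exact: le_trans Xy.
have qB : m.+1%:R * B <= - q y * B by rewrite ler_wpM2r // lerNr qX.
move: qB; rewrite -natr1; lra.
Qed.

Lemma stable_decay q w phi psi :
  rderiv phi (fun x => q x * phi x + psi x) -> rderiv w (fun x => - q x * w x) ->
  (forall x, 0 < w x) -> (forall M, exists X, forall x, X <= x -> q x <= - M) ->
  rdecay psi -> rdecay phi.
Proof.
move=> dphi dw w0 qoo psid m.
have [K [X1 HK]] := psid m; have [X2 HX2] := qoo m.+1%:R.
pose X := Num.max 1 (Num.max X1 X2).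
have X_1 : 1 <= X by rewrite le_max lexx.
have X_2 x : X <= x -> X1 <= x by rewrite !ge_max => /and3P[].
have X_3 x : X <= x -> X2 <= x by rewrite !ge_max => /and3P[].
(* Large enough for the source beyond [X] and for the value of the solution at [X], with either
   sign. *)
pose L := Num.max K `|X ^+ m * phi X|.
exists L, X => x Xx.
have L0 : 0 <= L by rewrite le_max normr_ge0 orbT.
have psiL y : X <= y -> `|y ^+ m * psi y| <= L.
  by move=> Xy; rewrite le_max HK // X_2.
rewrite ler_norml; apply/andP; split; last first.
  apply: (@decay_le m q w phi psi L X) => //.
  - by move=> y Xy; apply: HX2; exact: X_3.
  - by rewrite le_max ler_norm orbT.
rewrite lerNl -mulrN.
apply: (@decay_le m q w (fun y => - phi y) (fun y => - psi y) L X) => //.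
- move=> y _; apply: is_derive_eq (is_deriveN (dphi y)) _; ring.
- by move=> y Xy; apply: HX2; exact: X_3.
- by move=> y Xy; rewrite mulrN normrN psiL.
- by rewrite mulrN le_max -normrN ler_norm orbT.
Qed.

Definition vanishing phi := forall e, 0 < e -> exists X, forall x, X <= x -> `|phi x| <= e.

(** Now the weighted difference from [K x^-(m+1)] is nonincreasing. Once negative it stays bounded
    away from 0, which contradicts the vanishing of [w * phi] at infinity. *)
Lemma unstable_le m q w phi psi K X : 1 <= X ->
  (forall x, X <= x -> is_derive x 1 phi (q x * phi x + psi x)) ->
  (forall x, X <= x -> is_derive x 1 w (- q x * w x)) ->
  (forall x, 0 < w x) -> 0 <= K ->
  (forall x, X <= x -> 0 <= q x) ->
  (forall x, X <= x -> `|x ^+ m.+2 * psi x| <= K) ->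
  vanishing (fun x => w x * phi x) ->
  forall x, X <= x -> x ^+ m.+1 * phi x <= K.
Proof.
move=> X1 dphi dw w0 K0 qX psiK van x Xx.
have pos y : X <= y -> 0 < y by move=> Xy; rewrite (lt_le_trans _ Xy) // (lt_le_trans _ X1).
have eqB n y r : X <= y -> (y ^+ n * r <= K) = (r <= K * y^-1 ^+ n).
  by move=> /pos y0; rewrite mulrC exprVn ler_pdivlMr ?exprn_gt0.
rewrite eqB // -subr_ge0 -(pmulr_rge0 _ (w0 x)).
pose g y := w y * (K * y^-1 ^+ m.+1 - phi y).
pose g' y := w y * (- q y * (K * y^-1 ^+ m.+1) + K * (- m.+1%:R * y^-1 ^+ m.+2) - psi y).
have Bp n y : X <= y -> 0 <= K * y^-1 ^+ n.
  by move=> Xy; rewrite mulr_ge0 // exprn_ge0 // invr_ge0 ltW // pos.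
have gni y z : X <= y -> y <= z -> g z <= g y.
  apply: (@le0_deriv_nincr _ g g' X) => {}y Xy.
    apply: is_derive_eq (is_derive_pM (dw y Xy)
      (is_derive_pB (is_derive_pZ K (is_derive_invX m.+1 (pos y Xy))) (dphi y Xy))) _.
    by rewrite /g'; ring.
  rewrite /g' pmulr_rle0 //.
  have psiB : - psi y <= K * y^-1 ^+ m.+2.
    by rewrite -eqB //; apply: le_trans (psiK y Xy); rewrite mulrN -normrN ler_norm.
  have q0 : 0 <= q y * (K * y^-1 ^+ m.+1) by rewrite mulr_ge0 ?qX ?Bp.
  have mB : 0 <= m%:R * (K * y^-1 ^+ m.+2) by rewrite mulr_ge0 ?Bp.
  move: q0 mB psiB; rewrite -natr1; lra.
rewrite -/(g x) leNgt; apply/negP => gx.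
have [|Y HY] := van (- g x / 2); first by lra.
pose z := Num.max x Y.
have xz : x <= z by rewrite le_max lexx.
have := HY z _; rewrite le_max lexx orbT => /(_ isT) /(le_trans (ler_norm _)).
have := gni x z Xx xz; rewrite {1}/g mulrBr.
have : 0 <= w z * (K * z^-1 ^+ m.+1) by rewrite mulr_ge0 ?(ltW (w0 z)) // Bp // (le_trans Xx).
lra.
Qed.

Lemma unstable_decay q w phi psi :
  rderiv phi (fun x => q x * phi x + psi x) -> rderiv w (fun x => - q x * w x) ->
  (forall x, 0 < w x) -> (exists X, forall x, X <= x -> 0 <= q x) ->
  vanishing (fun x => w x * phi x) -> rdecay psi -> rdecay phi.
Proof.
move=> dphi dw w0 [X2 HX2] van psid m.
have [K [X1 HK]] := psid m.+2.
pose X := Num.max 1 (Num.max X1 X2).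
have X_1 : 1 <= X by rewrite le_max lexx.
have X_2 x : X <= x -> X1 <= x by rewrite !ge_max => /and3P[].
have X_3 x : X <= x -> X2 <= x by rewrite !ge_max => /and3P[].
have K0 : 0 <= K by apply: le_trans (normr_ge0 _) (HK X (X_2 _ (lexx _))).
exists K, X => x Xx.
have x1 : 1 <= x by exact: le_trans Xx.
suff : `|x ^+ m.+1 * phi x| <= K.
  apply: le_trans; rewrite !normrM ler_wpM2r // !normrX.
  by rewrite exprS ler_peMl ?exprn_ge0 // ger0_norm // (le_trans ler01).
rewrite ler_norml; apply/andP; split; last first.
  apply: (@unstable_le m q w phi psi K X) => //.
  - by move=> y Xy; apply: HX2; exact: X_3.
  - by move=> y Xy; apply: HK; exact: X_2.
rewrite lerNl -mulrN.
apply: (@unstable_le m q w (fun y => - phi y) (fun y => - psi y) K X) => //.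
- move=> y _; apply: is_derive_eq (is_deriveN (dphi y)) _; ring.
- by move=> y Xy; apply: HX2; exact: X_3.
- by move=> y Xy; rewrite mulrN normrN HK // X_2.
- by move=> e /van[Y HY]; exists Y => y Yy; rewrite mulrN normrN HY.
Qed.

(* [F - K / x] is nondecreasing and [F + K / x] nonincreasing. *)
Lemma primitive_limit F (F' : R -> R) : rderiv F F' ->
  (exists K X, forall x, X <= x -> `|x ^+ 2 * F' x| <= K) ->
  exists L, vanishing (fun x => F x - L).
Proof.
move=> dF [K [X0 HK]].
pose X := Num.max 1 X0.
have X_1 : 1 <= X by rewrite le_max lexx.
have X_0 x : X <= x -> X0 <= x by rewrite !ge_max => /andP[].
have K0 : 0 <= K by apply: le_trans (normr_ge0 _) (HK X (X_0 _ (lexx _))).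
have pos y : X <= y -> 0 < y by move=> Xy; rewrite (lt_le_trans _ Xy) // (lt_le_trans _ X_1).
pose B (x : R) := K * x^-1 ^+ 1.
have dB x : X <= x -> is_derive x 1 B (- (K * x^-1 ^+ 2)).
  move=> Xx; apply: is_derive_eq (is_derive_pZ K (is_derive_invX 1 (pos x Xx))) _; ring.
have FB x : X <= x -> `|F' x| <= K * x^-1 ^+ 2.
  move=> Xx; rewrite exprVn ler_pdivlMr ?exprn_gt0 ?pos //.
  have := HK x (X_0 _ Xx); rewrite normrM [ `|x ^+ 2|]ger0_norm ?sqr_ge0 //.
  by rewrite mulrC.
have B0 x : X <= x -> 0 <= B x.
  by move=> Xx; rewrite mulr_ge0 // exprn_ge0 // invr_ge0 ltW // pos.
pose lo x := F x - B x; pose up x := F x + B x.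
have loN x y : X <= x -> x <= y -> lo x <= lo y.
  apply: (@ge0_deriv_ndecr _ lo (fun x => F' x - - (K * x^-1 ^+ 2)) X) => {}x Xx.
    exact: is_derive_pB (dF x) (dB x Xx).
  by have := FB x Xx; rewrite opprK ler_norml; lra.
have upN x y : X <= x -> x <= y -> up y <= up x.
  apply: (@le0_deriv_nincr _ up (fun x => F' x + - (K * x^-1 ^+ 2)) X) => {}x Xx.
    exact: is_derive_pD (dF x) (dB x Xx).
  by have := FB x Xx; rewrite ler_norml; lra.
pose A := [set lo x | x in [set x | X <= x]].
have lo_up x y : X <= x -> X <= y -> lo x <= up y.
  move=> Xx Xy; pose z := Num.max x y.
  have xz : x <= z by rewrite le_max lexx.
  have yz : y <= z by rewrite le_max lexx orbT.
  apply: le_trans (loN _ _ Xx xz) _; apply: le_trans (upN _ _ Xy yz).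
  by have := B0 z (le_trans Xx xz); rewrite /lo /up; lra.
have hsA : has_sup A.
  split; first by exists (lo X), X => //=; rewrite lexx.
  by exists (up X) => _ [x Xx <-]; exact: lo_up.
pose L := sup A.
have loL x : X <= x -> lo x <= L by move=> Xx; apply: ub_le_sup; [exact: hsA.2|exists x].
have Lup x : X <= x -> L <= up x.
  by move=> Xx; apply: ge_sup; [exact: hsA.1|move=> _ [y Xy <-]; exact: lo_up].
exists L => e e0; exists (Num.max X (K / e)) => x; rewrite ge_max => /andP[Xx Kx].
have : B x <= e by rewrite /B expr1 ler_pdivrMr ?pos // mulrC -ler_pdivrMr.
have := loL x Xx; have := Lup x Xx; rewrite /lo /up ler_norml; lra.
Qed.

End Decay.

Section SchwartzOde.
Variable R : realType.
Implicit Types (phi psi f g : R -> R) (P : {poly R}).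

Lemma continuous_bounded f (a b : R) : continuous f ->
  exists C, forall x, a <= x <= b -> `|f x| <= C.
Proof.
move=> cf; have [ab|ba] := leP a b; last first.
  by exists 0 => x /andP[ax xb]; have := le_trans ax xb; rewrite leNgt ba.
have [||c _ cP] := @EVT_max R (fun x => `|f x|) a b; first exact: ab.
  apply: continuous_subspaceT => x.
  by apply: (@continuous_comp _ _ _ f (fun y : R => `|y|)); [exact: cf|exact: norm_continuous].
by exists `|f c| => x xab; apply: cP; rewrite in_itv.
Qed.

Lemma rdecay_bounded phi m : continuous phi -> rdecay phi -> rdecay (fun x => phi (- x)) ->
  exists C, forall x, `|x ^+ m * phi x| <= C.
Proof.
move=> cphi /(_ m)[K1 [X1 H1]] /(_ m)[K2 [X2 H2]].
have [|C HC] := @continuous_bounded (fun x => x ^+ m * phi x) (- X2) X1.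
  by move=> x; apply: cvgM; [exact: exprn_continuous|exact: cphi].
exists (`|C| + `|K1| + `|K2|) => x.
have := ler_norm C; have := ler_norm K1; have := ler_norm K2.
have := normr_ge0 C; have := normr_ge0 K1; have := normr_ge0 K2.
have [x1|x1] := leP X1 x; first by have := H1 x x1; lra.
have [x2|x2] := leP x (- X2).
  have := H2 (- x); rewrite lerNr => /(_ x2).
  by rewrite opprK exprNn -mulrA normrM normrX normrN1 expr1n mul1r; lra.
by have := HC x; rewrite (ltW x1) (ltW x2) => /(_ isT); lra.
Qed.

Lemma schwartz_rdecay phi : schwartz_fun phi -> rdecay phi.
Proof. by move=> H m; have [C HC] := schwartz_bounded m H; exists C, 0 => x _. Qed.

Lemma schwartz_rdecay_opp phi : schwartz_fun phi -> rdecay (fun x => phi (- x)).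
Proof.
move=> H m; have [C HC] := schwartz_bounded m H; exists C, 0 => x _.
have := HC (- x); by rewrite exprNn -mulrA normrM normrX normrN1 expr1n mul1r.
Qed.

Lemma rdecayN phi : rdecay phi -> rdecay (fun x => - phi x).
Proof. by move=> H m; have [K [X HX]] := H m; exists K, X => x /HX; rewrite mulrN normrN. Qed.

Lemma schwartz_rderiv phi : schwartz_fun phi -> rderiv phi (derive1 phi).
Proof. by move=> H; apply: derivable_rderiv => x; exact: schwartz_derivable. Qed.

(** The functions [p * phi + chi], with [p] a polynomial and [chi] Schwartz, are stable by
    derivation because the equation replaces the derivative of [phi]. *)
Lemma ode_schwartz phi psi P :
  rderiv phi (fun x => P.[x] * phi x + psi x) -> schwartz_fun psi ->
  (forall m, exists C, forall x, `|x ^+ m * phi x| <= C) -> schwartz_fun phi.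
Proof.
move=> dphi spsi bphi.
apply: (schwartz_coind (A := fun h => exists p chi,
  schwartz_fun chi /\ h = (fun x => p.[x] * phi x + chi x))); last first.
  exists 1, 0; split; first exact: schwartz0.
  by apply/funext => x; rewrite hornerC mul1r addr0.
move=> _ [p [chi [schi ->]]].
have D : rderiv (fun x => p.[x] * phi x + chi x)
    (fun x => (p^`() + p * P).[x] * phi x + (p.[x] * psi x + derive1 chi x)).
  move=> x; apply: is_derive_eq (is_derive_pD (is_derive_pM (is_derive_poly p x) (dphi x))
    (schwartz_rderiv schi x)) _.
  by rewrite hornerD hornerM; ring.
split.
- by move=> x; exact: rderiv_derivable D.
- move=> m; have [C HC] := schwartz_bounded m schi.
  suff [K HK] : exists K, forall x, `|x ^+ m * (p.[x] * phi x)| <= K.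
    exists (K + C) => x; rewrite mulrDr; apply: le_trans (ler_normD _ _) _.
    exact: lerD.
  elim/poly_ind: p m {C HC D} => [|p c IH] m.
    by exists 0 => x; rewrite horner0 mul0r mulr0 normr0.
  have [K1 H1] := IH m.+1; have [K2 H2] := bphi m.
  exists (K1 + `|c| * K2) => x; rewrite hornerMXaddC.
  have -> : x ^+ m * ((p.[x] * x + c) * phi x) =
      x ^+ m.+1 * (p.[x] * phi x) + c * (x ^+ m * phi x) by rewrite exprS; ring.
  apply: le_trans (ler_normD _ _) _; apply: lerD => //.
  by rewrite normrM ler_wpM2l.
- exists (p^`() + p * P), (fun x => p.[x] * psi x + derive1 chi x); split.
    have := schwartzDl 1 (schwartz_mulpoly p spsi) (schwartz_derive1 schi).
    by rewrite scale1r.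
  exact: rderiv_derive1.
Qed.

(** The integrating factor of [phi' = P' phi + psi]. *)
Definition wt P (x : R) := expR (- P.[x]).

Lemma wt_gt0 P x : 0 < wt P x. Proof. exact: expR_gt0. Qed.

Lemma wtE P x : expR P.[x] * wt P x = 1.
Proof. exact: expRxMexpNx_1. Qed.

Lemma rderiv_wt P : rderiv (wt P) (fun x => - P^`().[x] * wt P x).
Proof. by move=> x; exact: is_derive_pexp (is_deriveN (is_derive_poly P x)). Qed.

Lemma rderiv_expP P : rderiv (fun x => expR P.[x]) (fun x => P^`().[x] * expR P.[x]).
Proof. by move=> x; exact: is_derive_pexp (is_derive_poly P x). Qed.

Lemma rderiv_opp f f' : rderiv f f' -> rderiv (fun x => f (- x)) (fun x => - f' (- x)).
Proof.
move=> df x; have H : is_derive (0 - x) 1 f (f' (- x)) by rewrite sub0r.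
have -> : (fun y => f (- y)) = (fun y => f (0 - y)).
  by apply/funext => y; rewrite sub0r.
exact: is_derive_preflect H.
Qed.

Section Quadratic.
Variables (P : {poly R}) (alpha beta : R).
Hypothesis dP : P^`() = alpha *: 'X + beta%:P.

Lemma hornerdP x : P^`().[x] = alpha * x + beta.
Proof. by rewrite dP !hornerE. Qed.

(** Reflection keeps [alpha] and only changes the sign of [beta], so both ends are of the same type,
    stable or unstable. *)
Lemma rderiv_ode_opp phi psi : rderiv phi (fun x => P^`().[x] * phi x + psi x) ->
  rderiv (fun x => phi (- x))
    (fun x => (alpha * x - beta) * phi (- x) + - psi (- x)).
Proof.
move=> /rderiv_opp H x; apply: is_derive_eq (H x) _; rewrite hornerdP; ring.
Qed.

Lemma rderiv_wt_opp : rderiv (fun x => wt P (- x))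
  (fun x => - (alpha * x - beta) * wt P (- x)).
Proof.
move=> x; apply: is_derive_eq (rderiv_opp (rderiv_wt P) x) _; rewrite hornerdP; ring.
Qed.

Lemma affine_oo (c : R) : alpha < 0 ->
  forall M, exists X, forall x, X <= x -> alpha * x + c <= - M.
Proof.
move=> a0 M; exists ((M + c) / - alpha) => x.
by rewrite ler_pdivrMr ?oppr_gt0 //; lra.
Qed.

Lemma ode_schwartz_stable phi psi : alpha < 0 ->
  rderiv phi (fun x => P^`().[x] * phi x + psi x) -> schwartz_fun psi ->
  schwartz_fun phi.
Proof.
move=> a0 dphi spsi; apply: (ode_schwartz dphi spsi) => m.
apply: rdecay_bounded; first exact: rderiv_continuous dphi.
  apply: (stable_decay dphi (rderiv_wt P) (wt_gt0 P)) (schwartz_rdecay spsi).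
  by move=> M; have [X HX] := affine_oo beta a0 M; exists X => x /HX; rewrite hornerdP.
apply: (stable_decay (rderiv_ode_opp dphi) rderiv_wt_opp) => [x||].
- exact: wt_gt0.
- exact: affine_oo.
- exact: rdecayN (schwartz_rdecay_opp spsi).
Qed.

Lemma schwartz_gauss : alpha < 0 -> schwartz_fun (fun x => expR P.[x]).
Proof.
move=> a0; apply: (@ode_schwartz_stable _ 0 a0); last exact: schwartz0.
by move=> x; apply: is_derive_eq (rderiv_expP P x) _; rewrite addr0.
Qed.

Lemma ode_stable_exists psi : alpha < 0 -> schwartz_fun psi ->
  exists2 phi, schwartz_fun phi & rderiv phi (fun x => P^`().[x] * phi x + psi x).
Proof.
move=> a0 spsi.
have [|F dF] := @continuous_primitive R (fun x => wt P x * psi x).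
  move=> x; apply: cvgM; first exact: rderiv_continuous (rderiv_wt P) x.
  exact: rderiv_continuous (schwartz_rderiv spsi) x.
have D : rderiv (fun x => expR P.[x] * F x)
    (fun x => P^`().[x] * (expR P.[x] * F x) + psi x).
  move=> x; apply: is_derive_eq (is_derive_pM (rderiv_expP P x) (dF x)) _.
  by rewrite !mulrA wtE mul1r.
by exists (fun x => expR P.[x] * F x) => //; exact: ode_schwartz_stable D spsi.
Qed.

(** The second alternative covers equal objects, where [P] is 0. *)
Hypothesis unst : 0 < alpha \/ (alpha = 0 /\ beta = 0).

Lemma affine_ge0 (c : R) : (alpha = 0 -> c = 0) -> exists X, forall x, X <= x -> 0 <= alpha * x + c.
Proof.
case: unst => [a0 _|[a0 _] ->//]; last by exists 0 => x _; rewrite a0; lra.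
by exists (- c / alpha) => x; rewrite ler_pdivrMr //; lra.
Qed.

Lemma beta0 : alpha = 0 -> beta = 0.
Proof. by case: unst => [|[]//]; move=> /gt_eqF + /eqP => ->. Qed.

(** Solutions of the homogeneous equation do not decay here; the vanishing of the conjugated
    solution at both ends excludes them. *)
Lemma ode_schwartz_unstable phi psi :
  vanishing (fun x => wt P x * phi x) -> vanishing (fun x => wt P (- x) * phi (- x)) ->
  rderiv phi (fun x => P^`().[x] * phi x + psi x) -> schwartz_fun psi ->
  schwartz_fun phi.
Proof.
move=> v1 v2 dphi spsi; apply: (ode_schwartz dphi spsi) => m.
apply: rdecay_bounded; first exact: rderiv_continuous dphi.
  apply: (unstable_decay dphi (rderiv_wt P) (wt_gt0 P)) (schwartz_rdecay spsi) => //.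
  by have [X HX] := affine_ge0 beta0; exists X => x /HX; rewrite hornerdP.
apply: (unstable_decay (rderiv_ode_opp dphi) rderiv_wt_opp) => // [x||].
- exact: wt_gt0.
- by apply: affine_ge0 => /beta0 ->; rewrite oppr0.
- exact: rdecayN (schwartz_rdecay_opp spsi).
Qed.

Lemma wt_bounded : exists C X, forall x, X <= x -> wt P x <= C /\ wt P (- x) <= C.
Proof.
have [X1 H1] := affine_ge0 beta0.
have [|X2 H2] := @affine_ge0 (- beta); first by move=> /beta0 ->; rewrite oppr0.
exists (Num.max (wt P X1) (wt P (- X2))), (Num.max X1 X2) => x.
rewrite ge_max => /andP[x1 x2]; rewrite !le_max; split; apply/orP; [left|right].
  apply: (@le0_deriv_nincr _ _ _ X1 (fun y _ => rderiv_wt P y)) => // y /H1.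
  by rewrite hornerdP mulNr oppr_le0 => h; rewrite mulr_ge0 // ltW // wt_gt0.
apply: (@le0_deriv_nincr _ _ _ X2 (fun y _ => rderiv_wt_opp y)) => // y /H2 h.
by rewrite mulNr oppr_le0 mulr_ge0 // ltW // wt_gt0.
Qed.

Lemma wt_schwartz_bounded psi m : schwartz_fun psi -> exists K X, forall x, X <= x ->
  `|x ^+ m * (wt P x * psi x)| <= K /\ `|x ^+ m * (wt P (- x) * psi (- x))| <= K.
Proof.
move=> spsi; have [C [X HX]] := wt_bounded.
have [K1 [X1 H1]] := schwartz_rdecay spsi m.
have [K2 [X2 H2]] := schwartz_rdecay_opp spsi m.
exists (C * Num.max K1 K2), (Num.max X (Num.max X1 X2)) => x.
rewrite !ge_max => /and3P[x0 x1 x2]; have [w1 w2] := HX x x0.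
split; rewrite mulrCA normrM; apply: ler_pM => //.
- by rewrite ger0_norm // ltW // wt_gt0.
- by rewrite le_max H1.
- by rewrite ger0_norm // ltW // wt_gt0.
- by rewrite le_max H2 ?orbT.
Qed.

Lemma bounded_vanishing f (K X : R) : (forall x, X <= x -> `|x * f x| <= K) -> vanishing f.
Proof.
move=> H e e0; exists (Num.max X (Num.max 1 (K / e))) => x; rewrite !ge_max => /and3P[x0 x1 x2].
have xp : 0 < x by lra.
have := H x x0; rewrite normrM [ `|x|]gtr0_norm // mulrC -ler_pdivlMr // => /le_trans; apply.
by rewrite ler_pdivrMr // mulrC -ler_pdivrMr.
Qed.

Lemma wt_schwartz_vanishing psi : schwartz_fun psi ->
  vanishing (fun x => wt P x * psi x) /\ vanishing (fun x => wt P (- x) * psi (- x)).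
Proof.
move=> spsi; have [K [X H]] := wt_schwartz_bounded 1 spsi.
by split; apply: (@bounded_vanishing _ K X) => x /H; rewrite expr1 => -[].
Qed.

End Quadratic.
End SchwartzOde.

(** * A smooth step *)

Section Bump.
Variable R : realType.
Implicit Types (x : R) (f g : R -> R).

(** The index [k] makes the family stable by derivation, up to linear combinations. *)
Definition flat k x : R := if 0 < x then x^-1 ^+ k * expR (- x^-1) else 0.

(** From a single term of the exponential series at [1/x]. The quadratic bound yields the derivative
    at 0, the only point near which two formulas meet. *)
Lemma flat_le k x : `|flat k x| <= k.+2`!%:R * x ^+ 2.
Proof.
rewrite /flat; case: ifP => x0; last by rewrite normr0 mulr_ge0 // sqr_ge0.
have y0 : 0 < x^-1 by rewrite invr_gt0.
rewrite ger0_norm; last by rewrite mulr_ge0 ?exprn_ge0 ?expR_ge0 // ltW.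
rewrite expRN ler_pdivrMr ?expR_gt0 //.
have H := expR_ge1Dxn k.+1 (ltW y0).
have : x^-1 ^+ k.+2 <= k.+2`!%:R * expR x^-1.
  rewrite mulrC -ler_pdivrMr ?ltr0n ?fact_gt0 //; apply: le_trans H.
  by rewrite lerDr.
rewrite -(ler_pM2r (exprn_gt0 2 x0)) => H2.
have <- : x^-1 ^+ k.+2 * x ^+ 2 = x^-1 ^+ k.
  by rewrite -addn2 exprD -mulrA -exprMn mulVf ?gt_eqF // expr1n mulr1.
by rewrite [leRHS]mulrAC.
Qed.

Lemma is_derive_quadratic f (C : R) : (forall x, `|f x| <= C * x ^+ 2) -> is_derive (0 : R) (1 : R) f (0 : R).
Proof.
move=> H; have f0 : f 0 = 0.
  by apply/normr0_eq0/eqP; rewrite eq_le normr_ge0 (le_trans (H 0)) // expr0n mulr0.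
have L : h^-1 *: ((f \o shift 0) (h *: 1) - f 0) @[h --> 0^'] --> (0 : R).
  apply/cvgrPdist_le => e e0; near=> h.
  have h0 : h != 0 by near: h; exact: nbhs_dnbhs_neq.
  rewrite sub0r normrN f0 subr0 /= addr0 [h *: 1]mulr1 normrM normfV.
  rewrite mulrC ler_pdivrMr ?normr_gt0 //; apply: le_trans (H h) _.
  rewrite -real_normK ?num_real // expr2 mulrA ler_wpM2r //.
  have : `|h| <= e / (`|C| + 1).
    near: h; apply: dnbhs0_le; rewrite divr_gt0 // ltr_wpDl //.
  rewrite ler_pdivlMr ?ltr_wpDl // => hC; apply: le_trans hC.
  by rewrite mulrC ler_wpM2l // (le_trans (ler_norm _)) // lerDl.
apply: DeriveDef; first by apply/cvg_ex; exists 0.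
exact: cvg_lim L.
Unshelve. all: by end_near. Qed.

Lemma rderiv_flat k : rderiv (flat k) (fun x => flat k.+2 x - k%:R * flat k.+1 x).
Proof.
move=> x; have [x0|[x0|->]] : x < 0 \/ (0 < x \/ x = 0).
  by case: (ltgtP x 0); auto.
- have -> : flat k.+2 x - k%:R * flat k.+1 x = 0.
    by rewrite /flat ltNge (ltW x0) /= mulr0 subrr.
  apply: (near_eq_is_derive (f := fun=> 0)).
  near=> y; have y0 : y < 0 by near: y; exact: lt_nbhsl.
  by rewrite /flat ltNge (ltW y0).
- apply: (near_eq_is_derive (f := fun y : R => y^-1 ^+ k * expR (- y^-1))).
    near=> y; have y0 : 0 < y by near: y; exact: lt_nbhsr.
    by rewrite /flat y0.
  rewrite /flat x0.
  have d1 : is_derive x 1 (fun y : R => - y^-1) (- (- 1 * x^-1 ^+ 2)).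
    have := is_derive_invX 1 x0; under [X in is_derive _ _ X]funext do rewrite expr1.
    by move=> H; exact: is_deriveN H.
  apply: is_derive_eq (is_derive_pM (is_derive_invX k x0) (is_derive_pexp d1)) _.
  by rewrite !exprS; ring.
- have -> : flat k.+2 0 - k%:R * flat k.+1 0 = 0.
    by rewrite /flat ltxx mulr0 subrr.
  exact: is_derive_quadratic (flat_le k).
Unshelve. all: by end_near. Qed.

Section Class.
Variables (q : {poly R}) (c d : R).

(** Sums of such terms are stable by derivation and have support in [[c, d]], hence [schwartz_coind]
    applies. *)
Definition bump_term (p : {poly R}) i j x : R :=
  p.[x] * expR q.[x] * (flat i (x - c) * flat j (d - x)).

Inductive bumps : (R -> R) -> Prop :=
| bumps_term p i j : bumps (bump_term p i j)
| bumps_add f g : bumps f -> bumps g -> bumps (fun x => f x + g x).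

Lemma rderiv_bump_term p i j : rderiv (bump_term p i j) (fun x =>
  bump_term (p^`() + p * q^`()) i j x +
  (bump_term p i.+2 j x + (bump_term (- i%:R *: p) i.+1 j x +
  (bump_term (- p) i j.+2 x + bump_term (j%:R *: p) i j.+1 x)))).
Proof.
move=> x; have H := is_derive_pM
  (is_derive_pM (is_derive_poly p x) (rderiv_expP q x))
  (is_derive_pM (is_derive_pshift (x := x) (c := c) (rderiv_flat i (x - c)))
    (is_derive_preflect (x := x) (c := d) (rderiv_flat j (d - x)))).
apply: is_derive_eq H _.
by rewrite /bump_term !(hornerD, hornerM, hornerN, hornerZ); ring.
Qed.

Lemma schwartz_bumps f : bumps f -> schwartz_fun f.
Proof.
apply: schwartz_coind => {}f; elim=> [p i j|{}f g _ [df bf Af] _ [dg bg Ag]].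
  split.
  - by move=> x; exact: rderiv_derivable (rderiv_bump_term p i j).
  - move=> m; have [|C HC] := @continuous_bounded R (fun x => x ^+ m * bump_term p i j x) c d.
      move=> x; apply: cvgM; first exact: exprn_continuous.
      exact: (rderiv_continuous (rderiv_bump_term p i j)).
    exists `|C| => x; have [xc|xc] := leP c x; last first.
      by rewrite /bump_term /flat subr_gt0 ltNge (ltW xc) /= mul0r !mulr0 normr0.
    have [xd|xd] := leP x d; last first.
      by rewrite /bump_term /flat [0 < d - x]ltNge subr_le0 (ltW xd) /= !mulr0 normr0.
    by apply: le_trans (ler_norm C); apply: HC; rewrite xc.
  - rewrite (rderiv_derive1 (rderiv_bump_term p i j)).
    by do !apply: bumps_add; exact: bumps_term.
split.
- by move=> x; apply: derivableD.
- move=> m; have [C HC] := bf m; have [K HK] := bg m; exists (C + K) => x.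
  by rewrite mulrDr (le_trans (ler_normD _ _)) // lerD.
- have D := derivable_rderiv df; have D' := derivable_rderiv dg.
  have -> : derive1 (fun x => f x + g x) = (fun x => derive1 f x + derive1 g x).
    by apply: rderiv_derive1 => x; exact: is_derive_pD.
  exact: bumps_add.
Qed.

End Class.

(** [theta] is the normalised primitive of a bump on [-1/3, 1/3]. With this radius, a step placed at
    an integer is constant on the intervals of radius 1/3 around all other integers. The last clause
    allows an arbitrary exponential factor, as the representatives in degree one carry
    [expR (f a - f b)]. *)
Lemma step_exists : exists theta rho : R -> R,
  [/\ rderiv theta rho, forall x, x <= - 3^-1 -> theta x = 0,
      forall x, 3^-1 <= x -> theta x = 1,
      forall x, 3^-1 <= `|x| -> rho x = 0 &
      forall (q : {poly R}) (m : R), schwartz_fun (fun x => expR q.[x] * rho (x - m))].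
Proof.
pose r : R := 3^-1; have r0 : 0 < r by rewrite invr_gt0.
pose b x := flat 0 (x + r) * flat 0 (r - x).
have b0 x : (x <= - r) \/ (r <= x) -> b x = 0.
  case=> xr; rewrite /b /flat.
    by rewrite ltNge (_ : x + r <= 0) ?mul0r // -lerBrDr sub0r.
  by rewrite [0 < r - x]ltNge subr_le0 xr mulr0.
have cb : continuous b.
  have D := rderiv_bump_term 0 (- r) r 1 0 0.
  suff <- : bump_term 0 (- r) r 1 0 0 = b by exact: rderiv_continuous D.
  by apply/funext => y; rewrite /bump_term /b hornerC horner0 expR0 !mul1r opprK.
have [F dF] := continuous_primitive cb.
have rr : - r < r by lra.
(* The integral of the bump, positive by the mean value theorem. *)
pose k := F r - F (- r).
have k0 : 0 < k.
  have [z /andP[z1 z2] E] := MVT_itv rr (fun z _ => dF z).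
  rewrite /k E mulr_gt0 ?subr_gt0 // /b /flat -ltrBlDr sub0r z1 subr_gt0 z2.
  by rewrite !mulr_gt0 // ?expR_gt0 // expr0.
exists (fun x => k^-1 * (F x - F (- r))), (fun x => k^-1 * b x); split.
- move=> x; apply: is_derive_pZ; apply: is_derive_eq (is_derive_pB (dF x) (is_derive_cst _ _ _)) _.
  exact: subr0.
- move=> x xr; have -> : F x = F (- r).
    apply: deriv0_eq => // z /andP[_ zr].
    by apply: is_derive_eq (dF z) _; apply: b0; left.
  by rewrite subrr mulr0.
- move=> x xr; have <- : F r = F x.
    apply: deriv0_eq => // z /andP[zr _].
    by apply: is_derive_eq (dF z) _; apply: b0; right.
  by rewrite mulVf ?gt_eqF.
- move=> x; rewrite ler_normr => /orP xr; rewrite b0 ?mulr0 //.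
  by case: xr => xr; [right|left; rewrite lerNr].
- move=> q m; apply: (@schwartz_bumps q (m - r) (m + r)).
  suff <- : bump_term q (m - r) (m + r) (k^-1)%:P 0 0 =
      (fun x => expR q.[x] * (k^-1 * b (x - m))) by exact: bumps_term.
  apply/funext => x; rewrite /bump_term /b hornerC opprB addrA [x + r - m]addrAC.
  by rewrite (_ : m + r - x = r - (x - m)); ring.
Qed.

End Bump.

(** * Transfer from the de Rham category *)

Section Hodge.
Variables (R : realType) (Ob : eqType) (f : Ob -> {poly R}) (t s : Ob -> R).
Hypothesis hts : forall a, (f a)^`() = t a *: 'X + (s a)%:P.
Hypothesis t_inj : forall a b, a != b -> t a != t b.
Variables (pos : Ob -> Ob -> R) (theta rho : R -> R).
Hypothesis dtheta : rderiv theta rho.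
Hypothesis theta0 : forall x, x <= - 3^-1 -> theta x = 0.
Hypothesis theta1 : forall x, 3^-1 <= x -> theta x = 1.
Hypothesis schwartz_rho : forall (q : {poly R}) (m : R),
  schwartz_fun (fun x => expR q.[x] * rho (x - m)).
Local Notation S := (schwartzType R).
Implicit Types (a b : Ob) (psi phi : S) (c k : R).

Local Notation P a b := (f a - f b).
Local Notation lt_slope a b := (t a < t b).

Lemma deriv_diff a b : (P a b)^`() = (t a - t b) *: 'X + (s a - s b)%:P.
Proof. by rewrite derivB !hts scalerBl polyCB opprD addrACA. Qed.

Lemma slope_cases a b : ~~ (lt_slope a b) ->
  0 < t a - t b \/ (t a - t b = 0 /\ s a - s b = 0).
Proof.
have [->|/t_inj tab] := eqVneq a b; first by right; rewrite !subrr.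
by rewrite -leNgt le_eqVlt eq_sym (negbTE tab) /= => ?; left; rewrite subr_gt0.
Qed.

Definition rep1 a b : S := mk_schwartz (schwartz_rho (P a b) (pos a b)).

(** The Gaussian is a Schwartz function only when the slope increases; a default makes the choice
    total. *)
Lemma rep0_subproof a b : exists g : S, lt_slope a b -> forall x, g x = expR (P a b).[x].
Proof.
case: ltP => tab; last by exists 0.
have a0 : t a - t b < 0 by rewrite subr_lt0.
by exists (mk_schwartz (schwartz_gauss (deriv_diff a b) a0)).
Qed.

Definition rep0 a b : S := projT1 (cid (rep0_subproof a b)).

Lemma rep0E a b x : lt_slope a b -> rep0 a b x = expR (P a b).[x].
Proof. by rewrite /rep0; case: cid => g /= H /H. Qed.

Definition incl a b : S * S := if lt_slope a b then (rep0 a b, 0) else (0, rep1 a b).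

(** Writes [psi] as [c] times the bump plus the differential of [phi], which gives projection and
    homotopy in degree one at once. If [t a < t b], degree one has no cohomology and [phi] is unique
    up to the Gaussian, a freedom removed by its value at [pos a b]. *)
Definition hsol a b psi c phi :=
  sderive phi - smulpoly (P a b)^`() phi = psi - c *: rep1 a b /\
  (lt_slope a b -> c = 0 /\ phi (pos a b) = 0).

Lemma rderiv_schwartz phi : rderiv phi (sderive phi).
Proof. by move=> x; rewrite sderiveE; apply: schwartz_rderiv; exact: schwartzP. Qed.

(* In the coordinate [exp (- (f a - f b)) * phi] the differential of [C_DR]
   becomes the plain derivative. *)
Lemma rderiv_coord (a b : Ob) (phi psi : S) :
  sderive phi - smulpoly (P a b)^`() phi = psi ->
  rderiv (fun x => wt (P a b) x * phi x) (fun x => wt (P a b) x * psi x).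
Proof.
move=> <- x; apply: is_derive_eq (is_derive_pM (rderiv_wt (P a b) x) (rderiv_schwartz phi x)) _.
by rewrite svalD svalN smulpolyE; ring.
Qed.

Lemma wt_rep1 a b x : wt (P a b) x * rep1 a b x = rho (x - pos a b).
Proof. by rewrite mulrA [wt _ _ * _]mulrC wtE mul1r. Qed.

Lemma cst_of_rderiv0 (g : R -> R) : rderiv g (fun=> 0) -> forall x y, g x = g y.
Proof. by move=> H x y; apply: is_derive_0_is_cst => z; exact: H. Qed.

Lemma vanishing_cst (c : R) : vanishing (fun=> c) -> c = 0.
Proof.
move=> H; apply/eqP/negPn/negP => c0.
have [|X /(_ X (lexx _))] := H (`|c| / 2); first by rewrite divr_gt0 // normr_gt0.
have : 0 < `|c| by rewrite normr_gt0.
lra.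
Qed.

(** If the slope increases, the conjugated [phi] is constant and vanishes at [pos a b]. Otherwise
    its sum with [c] times the step is constant; the limit on the left makes the constant 0, and
    then the limit on the right gives [c = 0]. *)
Lemma hsol_unique0 a b c phi : hsol a b 0 c phi -> c = 0 /\ phi = 0.
Proof.
case=> [E N].
have D := rderiv_coord E.
have phi0 : (forall x, wt (P a b) x * phi x = 0) -> phi = 0.
  move=> H; apply: schwartz_ext => x; apply/eqP; have /eqP := H x.
  by rewrite mulf_eq0 gt_eqF ?wt_gt0.
have [tab|tab] := boolP (lt_slope a b).
  have [c0 phip] := N tab; rewrite c0 phi0 // => x.
  have D0 : rderiv (fun x => wt (P a b) x * phi x) (fun=> 0).
    by move=> y; apply: is_derive_eq (D y) _; rewrite c0 scale0r subr0 mulr0.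
  by rewrite (cst_of_rderiv0 D0 x (pos a b)) phip mulr0.
have U := slope_cases tab.
have [V1 V2] := wt_schwartz_vanishing (deriv_diff a b) U (schwartzP phi).
pose g x := wt (P a b) x * phi x + c * theta (x - pos a b).
have Dg : rderiv g (fun=> 0).
  move=> x; apply: is_derive_eq (is_derive_pD (D x) (is_derive_pZ c
    (is_derive_pshift (dtheta (x - pos a b))))) _.
  by rewrite sub0r svalN svalZ -wt_rep1; ring.
have g0 x : g x = 0.
  rewrite (cst_of_rderiv0 Dg x 0); apply: vanishing_cst => e e0.
  have [X HX] := V2 e e0; exists (Num.max X (3^-1 - pos a b)) => y.
  rewrite ge_max => /andP[Xy py].
  rewrite (cst_of_rderiv0 Dg 0 (- y)) /g theta0; last by lra.
  by rewrite mulr0 addr0 HX.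
have c0 : c = 0.
  apply: vanishing_cst => e e0.
  have [X HX] := V1 e e0; exists (Num.max X (3^-1 + pos a b)) => y.
  rewrite ge_max => /andP[Xy py].
  have := g0 y; rewrite /g theta1; last by lra.
  by rewrite mulr1 => /eqP; rewrite addr_eq0 eq_sym eqr_oppLR => /eqP ->; rewrite normrN HX.
by rewrite c0 phi0 // => x; have := g0 x; rewrite /g c0 mul0r addr0.
Qed.

Lemma hsol_lin a b k psi psi' c c' phi phi' :
  hsol a b psi c phi -> hsol a b psi' c' phi' ->
  hsol a b (k *: psi + psi') (k * c + c') (k *: phi + phi').
Proof.
move=> [E N] [E' N']; split; last first.
  move=> tab; have [-> p0] := N tab; have [-> p0'] := N' tab.
  by rewrite svalD svalZ p0 p0' mulr0 !addr0.
rewrite sderive_lin; apply: schwartz_ext => x.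
have := congr1 (fun u : S => u x) E; have := congr1 (fun u : S => u x) E'.
rewrite !(svalD, svalN, svalZ, smulpolyE) => E1 E2.
transitivity (k * (sderive phi x - (P a b)^`().[x] * phi x) +
   (sderive phi' x - (P a b)^`().[x] * phi' x)); first by ring.
by rewrite E1 E2; ring.
Qed.

Lemma hsol_unique a b psi c c' phi phi' :
  hsol a b psi c phi -> hsol a b psi c' phi' -> c = c' /\ phi = phi'.
Proof.
move=> H H'.
have := hsol_lin (-1) H H'; rewrite scaleN1r addNr => /hsol_unique0 [].
rewrite mulN1r scaleN1r => /eqP; rewrite addrC subr_eq0 => /eqP -> /eqP.
by rewrite addrC subr_eq0 => /eqP ->.
Qed.

Lemma hsol_exists a b psi : exists c phi, hsol a b psi c phi.
Proof.
have [tab|tab] := boolP (lt_slope a b).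
  have a0 : t a - t b < 0 by rewrite subr_lt0.
  have [phi sphi D] := ode_stable_exists (deriv_diff a b) a0 (schwartzP psi).
  have E : sderive (mk_schwartz sphi) - smulpoly (P a b)^`() (mk_schwartz sphi) = psi.
    apply: schwartz_ext => x; rewrite svalD svalN smulpolyE sderiveE /=.
    by rewrite (rderiv_derive1 D) addrC addKr.
  have E0 : sderive (rep0 a b) - smulpoly (P a b)^`() (rep0 a b) = 0.
    apply: schwartz_ext => x; rewrite svalD svalN smulpolyE sderiveE sval0.
    have -> : (rep0 a b : R -> R) = (fun x => expR (P a b).[x]).
      by apply/funext => y; rewrite rep0E.
    by rewrite (rderiv_derive1 (rderiv_expP (P a b))) subrr.
  (* Adding this multiple of the Gaussian makes the solution vanish at [pos a b]. *)
  pose k := - (phi (pos a b) * wt (P a b) (pos a b)).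
  exists 0, (k *: rep0 a b + mk_schwartz sphi); split => [|_]; last first.
    split=> //; rewrite svalD svalZ -[mk_schwartz sphi _]/(phi _).
    by rewrite rep0E // /k mulNr mulrAC -mulrA wtE mulr1 addNr.
  rewrite sderive_lin scale0r subr0 -[RHS]E -[RHS]add0r -[in RHS](scaler0 _ k) -E0.
  apply: schwartz_ext => x; rewrite !(svalD, svalN, svalZ, smulpolyE); ring.
have U := slope_cases tab.
have [|F dF] := @continuous_primitive R (fun x => wt (P a b) x * psi x).
  move=> x; apply: cvgM; first exact: rderiv_continuous (rderiv_wt (P a b)) x.
  exact: rderiv_continuous (rderiv_schwartz psi) x.
(* The derivative of [F] decays like [x^-2], so [F] has limits [L1] and [L2] at the two ends. Their
   difference, the total integral, is the class [c]; subtracting [L2] and [c] times the step makes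
   both limits zero. *)
have [K [X HX]] := wt_schwartz_bounded (deriv_diff a b) U 2 (schwartzP psi).
have [|L1 HL1] := primitive_limit dF; first by exists K, X => x /HX[].
have [|L2 HL2] := primitive_limit (rderiv_opp dF).
  by exists K, X => x /HX[_]; rewrite mulrN normrN.
pose c := L1 - L2.
pose u x := F x - L2 - c * theta (x - pos a b).
have du : rderiv u (fun x => wt (P a b) x * psi x - c * rho (x - pos a b)).
  move=> x; apply: is_derive_eq (is_derive_pB (is_derive_pB (dF x) (is_derive_cst _ _ _))
    (is_derive_pZ c (is_derive_pshift (dtheta (x - pos a b))))) _.
  by rewrite subr0.
have aux (e w p r k P' v : R) : e * w = 1 ->
    P' * e * v + e * (w * p - k * r) = P' * (e * v) + (p - k * (e * r)).
  by move=> ew; rewrite mulrBr !mulrA ew; ring.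
pose phi x := expR (P a b).[x] * u x.
have wphi x : wt (P a b) x * phi x = u x.
  by rewrite /phi mulrA [wt _ _ * _]mulrC wtE mul1r.
have D : rderiv phi (fun x => (P a b)^`().[x] * phi x + (psi - c *: rep1 a b) x).
  move=> x; apply: is_derive_eq (is_derive_pM (rderiv_expP (P a b) x) (du x)) _.
  exact: aux (wtE _ _).
have sphi : schwartz_fun phi.
  apply: (ode_schwartz_unstable (deriv_diff a b) U _ _ D (schwartzP _)) => e e0.
    have [Y HY] := HL1 e e0; exists (Num.max Y (3^-1 + pos a b)) => y.
    rewrite ge_max => /andP[Yy py]; rewrite wphi /u theta1; last by lra.
    by rewrite (_ : _ - c * 1 = F y - L1) ?HY // /c; ring.
  have [Y HY] := HL2 e e0; exists (Num.max Y (3^-1 - pos a b)) => y.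
  rewrite ge_max => /andP[Yy py]; rewrite wphi /u theta0; last by lra.
  by rewrite mulr0 subr0 HY.
exists c, (mk_schwartz sphi); split => [|tab']; last by rewrite tab' in tab.
apply: schwartz_ext => x; rewrite svalD svalN smulpolyE sderiveE /=.
by rewrite (rderiv_derive1 D) addrC addKr.
Qed.

Definition hsol_c a b psi : R := projT1 (cid (hsol_exists a b psi)).

Definition hsol_phi a b psi : S := projT1 (cid (projT2 (cid (hsol_exists a b psi)))).

Lemma hsol_pairP a b psi : hsol a b psi (hsol_c a b psi) (hsol_phi a b psi).
Proof. exact: projT2 (cid (projT2 (cid (hsol_exists a b psi)))). Qed.

Definition dtau (w : S * S) : S * S := (w.1, - w.2).

Definition hodge_h a b (w : S * S) : S * S := (hsol_phi a b w.2, 0).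

(** On functions, the conjugated value at [pos a b], where the homotopy vanishes. *)
Definition hodge_proj a b (w : S * S) : R :=
  if lt_slope a b then w.1 (pos a b) * wt (P a b) (pos a b) else hsol_c a b w.2.

Lemma hsol_pair_lin a b k psi psi' :
  hsol_c a b (k *: psi + psi') = k * hsol_c a b psi + hsol_c a b psi' /\
  hsol_phi a b (k *: psi + psi') = k *: hsol_phi a b psi + hsol_phi a b psi'.
Proof.
apply: hsol_unique (hsol_pairP a b _) _.
exact: hsol_lin (hsol_pairP a b psi) (hsol_pairP a b psi').
Qed.

Lemma pair_ext (w w' : S * S) : w.1 = w'.1 -> w.2 = w'.2 -> w = w'.
Proof. by case: w w' => [? ?] [? ?] /= -> ->. Qed.

Lemma dtau_lin k w w' : dtau (k *: w + w') = k *: dtau w + dtau w'.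
Proof. by apply: pair_ext => //=; rewrite opprD scalerN. Qed.

Lemma dtauK : involutive dtau.
Proof. by move=> w; apply: pair_ext => //=; rewrite opprK. Qed.

Lemma wedge_assoc : associative (@wedge R).
Proof. by move=> x y z; rewrite wedgeA. Qed.

Lemma dtauM w w' : dtau (wedge w w') = wedge (dtau w) (dtau w').
Proof.
apply: pair_ext; first by [].
by rewrite /=; apply: schwartz_ext => x; rewrite !(svalN, svalD, smulE); ring.
Qed.

Lemma hodge_h_lin a b k w w' : hodge_h a b (k *: w + w') = k *: hodge_h a b w + hodge_h a b w'.
Proof.
apply: pair_ext; last by rewrite /= scaler0 addr0.
exact: (hsol_pair_lin a b k w.2 w'.2).2.
Qed.

Lemma hodge_proj_lin a b k w w' :
  hodge_proj a b (k *: w + w') = k *: (hodge_proj a b w : R^o) + hodge_proj a b w'.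
Proof.
rewrite /hodge_proj; case: ifP => _; last exact: (hsol_pair_lin a b k w.2 w'.2).1.
by rewrite sval_lin mulrDl -mulrA.
Qed.

Lemma dform_dtau a b w : dform f a b (dtau w) = - dtau (dform f a b w).
Proof. by apply: pair_ext; rewrite /= ?oppr0 ?opprK. Qed.

Lemma hodge_h_dtau a b w : hodge_h a b (dtau w) = - dtau (hodge_h a b w).
Proof.
apply: pair_ext; last by rewrite /= !oppr0.
have E0 := (hsol_pair_lin a b (-1) 0 0).2.
rewrite scaler0 addr0 scaleN1r addNr in E0.
have E := (hsol_pair_lin a b (-1) w.2 0).2.
by rewrite E0 !addr0 !scaleN1r in E.
Qed.

Lemma dform_leibniz a b (e : Ob) w w' :
  dform f a e (wedge w w') = wedge (dform f a b w) w' + wedge (dtau w) (dform f b e w').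
Proof.
have fP (u v : S) : sderive (smul u v) = smul (sderive u) v + smul u (sderive v).
  exact: sderiveM.
apply: pair_ext.
  by rewrite /=; apply: schwartz_ext => x; rewrite !(svalD, smulE, sval0); ring.
rewrite /= fP; apply: schwartz_ext => x.
rewrite !(svalD, svalN, smulE, smulpolyE, sval0) !derivB !hornerD !hornerN; ring.
Qed.

Lemma dform_incl a b : dform f a b (incl a b) = 0.
Proof.
rewrite /incl; case: ifP => tab; last by exact: (congr1 (pair 0) (congr1 snd (dform0 f a b))).
apply: pair_ext => //; apply: schwartz_ext => x.
rewrite [_.2]/= svalD svalN smulpolyE sderiveE sval0.
have -> : (rep0 a b : R -> R) = (fun x => expR (P a b).[x]).
  by apply/funext => y; rewrite rep0E.
by rewrite (rderiv_derive1 (rderiv_expP (P a b))) subrr.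
Qed.

Lemma hodge_proj_d a b w : hodge_proj a b (dform f a b w) = 0.
Proof.
rewrite /hodge_proj; case: ifP => tab; first exact: mul0r.
have [<- _] : 0 = hsol_c a b (dform f a b w).2 /\ w.1 = hsol_phi a b (dform f a b w).2.
  by apply: hsol_unique (hsol_pairP a b _); split; rewrite ?tab // scale0r subr0.
by [].
Qed.

(** The one-form part is the equation of [hsol]. For the function part, [w.1] minus its projection
    solves the problem posed by the differential of [w.1], so uniqueness identifies it with the
    homotopy. *)
Lemma hodge_decomposition a b w :
  w = dform f a b (hodge_h a b w) + hodge_h a b (dform f a b w) +
      hodge_proj a b w *: incl a b.
Proof.
have [E1 N1] := hsol_pairP a b w.2.
apply: pair_ext; last first.
  rewrite [RHS]/= E1 addr0 /hodge_proj /incl; case: ifP => tab /=.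
    by have [-> _] := N1 tab; rewrite scale0r scaler0 subr0 addr0.
  by rewrite subrK.
rewrite [RHS]/= add0r /hodge_proj /incl; case: ifP => tab; last first.
  rewrite /= scaler0 addr0.
  by apply: (proj2 (hsol_unique (c := 0) _ (hsol_pairP a b _))); split; rewrite ?tab // scale0r subr0.
set k := _ * _.
have H : hsol a b (sderive w.1 - smulpoly (P a b)^`() w.1) 0 (w.1 - k *: rep0 a b).
  split=> [|_]; last first.
    split=> //; rewrite svalD svalN svalZ rep0E // /k -mulrA [wt _ _ * _]mulrC wtE.
    by rewrite mulr1 subrr.
  have /(congr1 snd) := dform_incl a b; rewrite /incl tab => /= E0.
  have -> : w.1 - k *: rep0 a b = - k *: rep0 a b + w.1 by rewrite scaleNr addrC.
  rewrite scale0r subr0 sderive_lin.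
  apply: schwartz_ext => x; rewrite !(svalD, svalN, svalZ, smulpolyE).
  have /subr0_eq -> : sderive (rep0 a b) x - (P a b)^`().[x] * rep0 a b x = 0.
    exact: (congr1 (fun u : S => u x) E0).
  ring.
by have [_ <-] := hsol_unique H (hsol_pairP a b _); rewrite /= subrK.
Qed.

Lemma hodge_proj_incl a b : hodge_proj a b (incl a b) = 1.
Proof.
rewrite /hodge_proj; case: ifP => tab; rewrite /incl tab; first by rewrite rep0E // wtE.
have [<- _] : 1 = hsol_c a b (rep1 a b) /\ 0 = hsol_phi a b (rep1 a b).
  apply: hsol_unique (hsol_pairP a b _); split; rewrite ?tab // scale1r subrr.
  exact: (congr1 snd (dform0 f a b)).
by [].
Qed.

(** The sign of the suspended degree and also the change of direction of the walk; this double role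
    ties degrees to geometry. *)
Definition slope_sign a b : R := if lt_slope a b then -1 else 1.

Definition lines_tree : Ob -> seq Ob -> S * S := tree (@wedge R) dtau hodge_h incl.

Definition lines_tree2 : Ob -> seq Ob -> S * S := tree2 (@wedge R) dtau hodge_h incl.

Definition lines_const : Ob -> seq Ob -> R :=
  tree_const (@wedge R) dtau hodge_h hodge_proj incl.

Lemma slope_sign2 a b : slope_sign a b * slope_sign a b = 1.
Proof. by rewrite /slope_sign; case: ifP; rewrite ?mulrNN mulr1. Qed.

Lemma dtau_incl a b : dtau (incl a b) = - slope_sign a b *: incl a b.
Proof.
rewrite /slope_sign /incl; case: ifP => _; apply: pair_ext;
  by rewrite /= ?opprK ?scale1r ?scaleN1r ?oppr0.
Qed.

Local Notation D := (vdeg t).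

Lemma sgl_sig a l : sgl slope_sign a l = sgnz R (sig D a l).
Proof.
elim: l a => [|b l IH] a //=; rewrite IH sgnzD; congr (_ * _).
by rewrite /slope_sign /vdeg; case: ifP => _; rewrite ?subrr // /sgnz sub0r exprN1 invrN1.
Qed.

Local Notation wedgeDl := (fun z k x y => wedge_linl k x y z).
Local Notation wedgeDr := (fun z k x y => wedge_linr k x y z).

Lemma wedgeZl k w w' : wedge (k *: w) w' = k *: wedge w w'.
Proof. exact: (linZ (wedgeDl w') k w). Qed.

Lemma lines_dtau a l : dtau (lines_tree a l) = - sgl slope_sign a l *: lines_tree a l.
Proof.
exact: (tau_tree wedgeDl wedgeDr dtau_lin dtauM dtauK hodge_h_lin hodge_h_dtau
  slope_sign2 dtau_incl).
Qed.

Lemma lines_treeE a l : (1 < size l)%N ->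
  lines_tree a l = - hodge_h a (last a l) (lines_tree2 a l).
Proof. exact: treeE wedgeDl wedgeDr dtau_lin a l. Qed.

Lemma lines_const_small a l : (size l <= 1)%N -> lines_const a l = 0.
Proof. exact: tree_const_small wedgeDl wedgeDr dtau_lin hodge_proj_lin a l. Qed.

Lemma lines_functor_rel a l :
  dform f a (last a l) (lines_tree a l) +
  \sum_(u <- splitseq l)
    sgnz R (sig D a u.1) *: wedge (lines_tree a u.1) (lines_tree (last a u.1) u.2) =
  \sum_(u <- splitseq l) \sum_(w <- splitseq u.2)
    (sgnz R (sig D a u.1) * lines_const (last a u.1) w.1) *:
      lines_tree a (u.1 ++ last (last a u.1) w.1 :: w.2).
Proof.
have := functor_relP wedge_assoc wedgeDl wedgeDr dtau_lin dtauM dtauK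
  (fun a b k x y => dform_lin f a b k x y) hodge_h_lin hodge_proj_lin dform_dtau
  hodge_h_dtau dform_leibniz dform_incl hodge_decomposition
  slope_sign2 dtau_incl a l.
rewrite /functor_rel /ainf_lhs => E.
rewrite -/lines_tree -/lines_const in E.
transitivity (dform f a (last a l) (lines_tree a l) + lines_tree2 a l); last first.
  rewrite [LHS]E; apply: eq_bigr => u _; apply: eq_bigr => w _.
  by rewrite sgl_sig.
congr (_ + _); apply: eq_bigr => u _; rewrite -sgl_sig.
by rewrite -/lines_tree lines_dtau wedgeZl -scaleNr opprK.
Qed.

Lemma lines_const_rel a l :
  \sum_(u <- splitseq l) \sum_(w <- splitseq u.2)
    sgnz R (sig D a u.1) * lines_const (last a u.1) w.1 *
      lines_const a (u.1 ++ last (last a u.1) w.1 :: w.2) = 0.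
Proof.
have := tree_const_rel wedge_assoc wedgeDl wedgeDr dtau_lin dtauM dtauK
  (fun a b k x y => dform_lin f a b k x y) hodge_h_lin hodge_proj_lin dform_dtau
  hodge_h_dtau dform_leibniz dform_incl hodge_proj_d hodge_decomposition
  slope_sign2 dtau_incl a l.
rewrite /ainf_lhs => E; rewrite -[RHS]E; apply: eq_bigr => u _; apply: eq_bigr => w _.
by rewrite sgl_sig.
Qed.

(* The value of a tree of [n] leaves is a form of degree [sig + 1], and the
   operations of degree one in the suspension shift this by one. *)
Lemma lines_tree2_deg a l :
  (forall b u, (size u < size l)%N ->
    (sig D b u + 1 != 0 -> (lines_tree b u).1 = 0) /\
    (sig D b u + 1 != 1 -> (lines_tree b u).2 = 0)) ->
  (sig D a l + 2 != 0 -> (lines_tree2 a l).1 = 0) /\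
  (sig D a l + 2 != 1 -> (lines_tree2 a l).2 = 0).
Proof.
move=> IH.
pose Phi u v : S * S := - wedge (dtau (lines_tree a u)) (lines_tree (last a u) v).
apply: (big_splitseq_closed (Phi := Phi) (K := fun w : S * S =>
  (sig D a l + 2 != 0 -> w.1 = 0) /\ (sig D a l + 2 != 1 -> w.2 = 0))).
- by [].
- move=> [x1 x2] [y1 y2] [/= H1 H2] [/= H3 H4].
  by split=> h; rewrite ?(H1 h) ?(H3 h) ?(H2 h) ?(H4 h) addr0.
move=> u v uv; rewrite /Phi {Phi}.
have W0 w : wedge w (0 : S * S) = 0 by exact: wedge0r.
have W1 w : wedge (0 : S * S) w = 0 by exact: wedge0l.
case: u uv => [|x u] uv; first by rewrite lines_dtau scaler0 W1 oppr0.
case: v uv => [|y v] uv; first by rewrite W0 oppr0.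
have su : (size (x :: u) < size l)%N by rewrite -uv size_cat -[ltnLHS]addn0 ltn_add2l.
have sv : (size (y :: v) < size l)%N by rewrite -uv size_cat -[ltnLHS]add0n ltn_add2r.
have [u1 u2] := IH a _ su; have [v1 v2] := IH (last a (x :: u)) _ sv.
rewrite -uv sig_cat; move: u1 u2 v1 v2.
set U := lines_tree a _; set V := lines_tree _ _; set m := sig D a _; set n := sig D _ _.
have M0 (z : S) : smul z 0 = 0 by apply: schwartz_ext => p; rewrite smulE mulr0.
have M1 (z : S) : smul 0 z = 0 by apply: schwartz_ext => p; rewrite smulE mul0r.
have MN (z : S) : smul (- 0) z = 0 by rewrite oppr0 M1.
move=> u1 u2 v1 v2; split=> h /=.
  have [m0|m0] := eqVneq (m + 1) 0; last by rewrite (u1 m0) M1 oppr0.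
  by rewrite v1 ?M0 ?oppr0 //; apply: contra h => /eqP n0; apply/eqP; lia.
have [m0|m0] := eqVneq (m + 1) 0.
  rewrite (u2 _) ?MN; last by rewrite m0.
  by rewrite v2 ?M0 ?addr0 ?oppr0 //; apply: contra h => /eqP n0; apply/eqP; lia.
rewrite (u1 m0) M1 add0r; have [m1|m1] := eqVneq (m + 1) 1; last by rewrite (u2 m1) MN oppr0.
by rewrite v1 ?M0 ?oppr0 //; apply: contra h => /eqP n0; apply/eqP; lia.
Qed.

Lemma lines_tree_deg a l :
  (sig D a l + 1 != 0 -> (lines_tree a l).1 = 0) /\
  (sig D a l + 1 != 1 -> (lines_tree a l).2 = 0).
Proof.
have [n] := ubnP (size l); elim: n a l => // n IH a [|b [|c l]] ln; first by split.
  rewrite /= addr0 subrK /vdeg /lines_tree tree1 /incl.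
  by case: ifP => _; split.
have [_] := @lines_tree2_deg a [:: b, c & l] (fun e u ul => IH e u (leq_trans ul ln)).
set m := sig _ _ _ => H2.
rewrite lines_treeE //; split=> [h|_]; last by rewrite /= oppr0.
rewrite [LHS]/= H2; last by apply: contra h => /eqP n0; apply/eqP; lia.
have E0 := (hsol_pair_lin a (last a [:: b, c & l]) (-1) 0 0).2.
by rewrite scaler0 addr0 scaleN1r addNr in E0; rewrite E0 oppr0.
Qed.

Lemma form_part_lines_tree a l e : e != sig D a l + 1 -> form_part (lines_tree a l) e = 0.
Proof.
have [H1 H2] := lines_tree_deg a l.
by case: e => [[|[|e]]|e] //= h; rewrite ?H1 ?H2 // eq_sym.
Qed.

Lemma lines_const_deg a l : lines_const a l != 0 -> sig D a l + 1 = D a (last a l) - 1.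
Proof.
have [H1 H2] := @lines_tree2_deg a l (fun e u _ => lines_tree_deg e u).
rewrite /lines_const /tree_const -/lines_tree2 /hodge_proj [D a _]/vdeg.
case: ifP => tab h; rewrite ?tab; apply/eqP; apply: contraNT h => h; apply/eqP.
  by rewrite H1 ?mul0r //; apply: contra h => /eqP n0; apply/eqP; lia.
rewrite H2; last by apply: contra h => /eqP n0; apply/eqP; lia.
have := (hsol_pair_lin a (last a l) (-1) 0 0).1.
by rewrite scaler0 addr0 mulN1r addNr.
Qed.

Lemma lines_coh_inj a b k w : k *: lines_tree a [:: b] = dform f a b w -> k = 0.
Proof.
rewrite /lines_tree tree1 => /(congr1 (hodge_proj a b)); rewrite hodge_proj_d.
have := linZ (f := hodge_proj a b : _ -> R^o) (hodge_proj_lin a b) k (incl a b).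
by move=> ->; rewrite hodge_proj_incl /GRing.scale /= mulr1.
Qed.

Lemma lines_coh_surj a b w : dform f a b w = 0 ->
  exists k z, k *: lines_tree a [:: b] = w + dform f a b z.
Proof.
move=> dw; have := hodge_decomposition a b w; rewrite dw.
have -> : hodge_h a b 0 = 0 by exact: lin0 (hodge_h_lin a b).
rewrite addr0 => E; exists (hodge_proj a b w), (- hodge_h a b w).
rewrite /lines_tree tree1 (linN (fun k x y => dform_lin f a b k x y)).
by rewrite {2}E addrC addKr.
Qed.

Lemma lines_tree1 a b : lines_tree a [:: b] = incl a b.
Proof. by []. Qed.

Definition coord0 a l (x : R) : R := wt (P a (last a l)) x * (lines_tree a l).1 x.

Definition coord1 a l (x : R) : R := wt (P a (last a l)) x * (lines_tree a l).2 x.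

(** Conjugation is multiplicative along composable morphisms, so in the coordinates [coord0] and
    [coord1] the wedge product is pointwise multiplication. *)
Lemma wt_diff a b (e : Ob) x : wt (P a e) x = wt (P a b) x * wt (P b e) x.
Proof. by rewrite /wt -expRD; congr expR; rewrite !hornerD !hornerN; ring. Qed.

Lemma coord0_one a b x : coord0 a [:: b] x = (lt_slope a b)%:R.
Proof.
rewrite /coord0 lines_tree1 /incl /=; case: ifP => tab; last exact: mulr0.
by rewrite rep0E // mulrC wtE.
Qed.

Lemma coord1_one a b x : coord1 a [:: b] x = if lt_slope a b then 0 else rho (x - pos a b).
Proof.
rewrite /coord1 lines_tree1 /incl /=; case: ifP => tab; first exact: mulr0.
exact: wt_rep1.
Qed.

(** Homotopies produce functions, so only single leaves have a one-form part. *)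
Lemma coord1_long a l x : size l != 1%N -> coord1 a l x = 0.
Proof.
case: l => [|b [|c l]] //= _; first exact: mulr0.
rewrite /coord1; have -> : (lines_tree a [:: b, c & l]).2 = 0.
  by rewrite lines_treeE //= oppr0.
exact: mulr0.
Qed.

Lemma coord0_nil a x : coord0 a [::] x = 0.
Proof. exact: mulr0. Qed.

Lemma coord0_deg a l x : sig D a l != -1 -> coord0 a l x = 0.
Proof.
move=> h; have H : (lines_tree a l).1 = 0.
  by apply: (lines_tree_deg a l).1; apply: contra h => /eqP h; apply/eqP; lia.
by rewrite /coord0 H; exact: mulr0.
Qed.

Lemma lines_tree2_coord a l x :
  wt (P a (last a l)) x * (lines_tree2 a l).1 x =
    - (\sum_(u <- splitseq l) coord0 a u.1 x * coord0 (last a u.1) u.2 x) /\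
  wt (P a (last a l)) x * (lines_tree2 a l).2 x =
    \sum_(u <- splitseq l) coord1 a u.1 x * coord0 (last a u.1) u.2 x -
    \sum_(u <- splitseq l) coord0 a u.1 x * coord1 (last a u.1) u.2 x.
Proof.
pose Phi u v : S * S := - wedge (dtau (lines_tree a u)) (lines_tree (last a u) v).
pose ev0 (w : S * S) : R^o := wt (P a (last a l)) x * w.1 x.
pose ev1 (w : S * S) : R^o := wt (P a (last a l)) x * w.2 x.
have ev0L k w w' : ev0 (k *: w + w') = k *: ev0 w + ev0 w'.
  by rewrite /ev0 sval_lin /GRing.scale /= mulrDr mulrCA.
have ev1L k w w' : ev1 (k *: w + w') = k *: ev1 w + ev1 w'.
  by rewrite /ev1 sval_lin /GRing.scale /= mulrDr mulrCA.
split.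
  rewrite -sumrN -[LHS]/(ev0 (\sum_(u <- splitseq l) Phi u.1 u.2)) (lin_sum ev0L).
  apply: (eq_big_splitseq (Phi := fun u v => ev0 (Phi u v))
    (Psi := fun u v => - (coord0 a u x * coord0 (last a u) v x))) => u v uv.
  rewrite (linN ev0L); congr (- _); rewrite /ev0 /coord0 -uv last_cat.
  by rewrite (wt_diff a (last a u)) -[(wedge _ _).1 x]/((lines_tree a u).1 x * (lines_tree (last a u) v).1 x); ring.
rewrite -sumrB -[LHS]/(ev1 (\sum_(u <- splitseq l) Phi u.1 u.2)) (lin_sum ev1L).
apply: (eq_big_splitseq (Phi := fun u v => ev1 (Phi u v))
  (Psi := fun u v => coord1 a u x * coord0 (last a u) v x -
                     coord0 a u x * coord1 (last a u) v x)) => u v uv.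
rewrite (linN ev1L) /ev1 /coord0 /coord1 -uv last_cat.
rewrite (wt_diff a (last a u)) -[(wedge _ _).2 x]/((lines_tree a u).1 x * (lines_tree (last a u) v).2 x
   + (- (lines_tree a u).2 x) * (lines_tree (last a u) v).1 x); ring.
Qed.

Lemma lines_const_lt a l : lt_slope a (last a l) -> lines_const a l =
  - \sum_(u <- splitseq l)
      coord0 a u.1 (pos a (last a l)) * coord0 (last a u.1) u.2 (pos a (last a l)).
Proof.
move=> tal; rewrite -(lines_tree2_coord a l _).1 mulrC.
by rewrite /lines_const /tree_const /hodge_proj tal.
Qed.

(** As [tree = - h tree2], the derivative of a conjugated tree is [c] times its own bump minus the
    one-form part of [tree2]. The second and third clauses fix the integration constant. *)
Lemma coord0_ode a l : (1 < size l)%N -> exists c,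
  [/\ rderiv (coord0 a l) (fun x => c * rho (x - pos a (last a l)) -
        (\sum_(u <- splitseq l) coord1 a u.1 x * coord0 (last a u.1) u.2 x -
         \sum_(u <- splitseq l) coord0 a u.1 x * coord1 (last a u.1) u.2 x)),
      lt_slope a (last a l) -> c = 0 /\ coord0 a l (pos a (last a l)) = 0 &
      ~~ lt_slope a (last a l) ->
        [/\ lines_const a l = c, vanishing (coord0 a l) &
            vanishing (fun x => coord0 a l (- x))]].
Proof.
move=> l1; set e := last a l; set psi := (lines_tree2 a l).2.
have [E N] := hsol_pairP a e psi.
have K0 x : coord0 a l x = - (wt (P a e) x * hsol_phi a e psi x).
  by rewrite /coord0 lines_treeE // -mulrN.
exists (hsol_c a e psi); split.
- move=> x; rewrite (_ : coord0 a l = (fun x => - (wt (P a e) x * hsol_phi a e psi x))).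
    apply: is_derive_eq (is_deriveN (rderiv_coord E x)) _.
    rewrite -(lines_tree2_coord a l x).2 svalD svalN svalZ -wt_rep1 -/e; ring.
  exact/funext.
- by move=> tae; have [c0 p0] := N tae; split=> //; rewrite K0 p0 mulr0 oppr0.
- move=> tae; have [V1 V2] := wt_schwartz_vanishing (deriv_diff a e) (slope_cases tae)
    (schwartzP (hsol_phi a e psi)).
  split.
  + by rewrite /lines_const /tree_const /hodge_proj (negbTE tae).
  + by move=> z /V1[X HX]; exists X => x /HX; rewrite K0 normrN.
  + by move=> z /V2[X HX]; exists X => x /HX; rewrite K0 normrN.
Qed.

End Hodge.

(** * Values of the structure constants *)

Section Chains.
Variables (R : realType) (Ob : eqType) (t : Ob -> R) (p : Ob -> Ob -> R).
Implicit Types (a b c e : Ob) (l u v : seq Ob) (eta x y z m : R).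
Local Notation D := (vdeg t).
Local Notation sg := (sgl (slope_sign t)).

(* The walk along the lines of [a :: l], turning at their consecutive
   intersection points and reversing its direction exactly where the slope
   increases, starts at abscissa [z] in direction [eta] and reaches [y]. *)
Fixpoint chain eta a z l y : bool :=
  if l is b :: l' then
    (0 < eta * (p a b - z)) && chain (eta * slope_sign t a b) b (p a b) l' y
  else 0 < eta * (y - z).

Lemma slope_signE a b : slope_sign t a b = if t a < t b then -1 else 1.
Proof. by []. Qed.

(** Thus [sig] is minus the number of ascents of the slope. *)
Lemma sig_cons a b l : sig D a (b :: l) = sig D b l - (t a < t b)%R%:Z.
Proof. by rewrite /= /vdeg; case: ifP => _ /=; lia. Qed.

Lemma sig_le0 a l : sig D a l <= 0.
Proof. by elim: l a => [|b l IH] a //; rewrite sig_cons; have := IH b; case: (t a < t b) => /=; lia. Qed.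

Lemma sig_rcons a l e : sig D a (rcons l e) = sig D a l - (t (last a l) < t e)%R%:Z.
Proof. by rewrite -cats1 sig_cat sig_cons /= sub0r. Qed.

Lemma sig_ends a b l e : sig D a (b :: rcons l e) = -1 ->
  [/\ t a < t b -> sig D b l = 0,
      ~~ (t a < t b) -> sig D b (rcons l e) = -1,
      t (last b l) < t e -> sig D b l = 0 /\ (t a < t b) = false &
      ~~ (t (last b l) < t e) -> sig D a (b :: l) = -1].
Proof.
rewrite !sig_cons sig_rcons; have := sig_le0 b l.
case: (t a < t b); case: (t _ < t e) => /= h1 h2; split=> // _; try split; lia.
Qed.

Lemma sgl_sig0 a l : sig D a l = 0 -> sg a l = 1.
Proof.
elim: l a => [|b l IH] a //; rewrite sig_cons /= slope_signE.
by have := sig_le0 b l; case: ifP => /= _ h1 h2; [lia|rewrite IH ?mulr1 //; lia].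
Qed.

Lemma sgl_sig1 a l : sig D a l = -1 -> sg a l = -1.
Proof.
elim: l a => [|b l IH] a //; rewrite sig_cons /= slope_signE.
case: ifP => /= _ h; first by rewrite sgl_sig0 ?mulr1 //; lia.
by rewrite IH ?mul1r //; lia.
Qed.

Lemma chain_rcons eta a z l e y : chain eta a z (rcons l e) y =
  chain eta a z l (p (last a l) e) && (0 < eta * sg a (rcons l e) * (y - p (last a l) e)).
Proof.
elim: l eta a z => [|b l IH] eta a z /=; first by rewrite mulr1.
by rewrite IH andbA mulrA.
Qed.

Lemma chain_cat eta a z u v x y : chain eta a z u x ->
  chain (eta * sg a u) (last a u) x v y -> chain eta a z (u ++ v) y.
Proof.
elim: u eta a z => [|b u IH] eta a z /=.
  rewrite mulr1; case: v => [|b v] /=.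
    by move=> h1 h2; have := addr_gt0 h1 h2; rewrite -mulrDr addrC subrKA.
  move=> h1 /andP[h2 ->]; rewrite andbT.
  by have := addr_gt0 h1 h2; rewrite -mulrDr addrC subrKA.
by move=> /andP[-> /IH h]; rewrite mulrA.
Qed.

Lemma chain_prefix eta a z u e v y : chain eta a z (rcons u e ++ v) y ->
  chain eta a z u (p (last a u) e).
Proof.
elim: u eta a z => [|b u IH] eta a z /=; first by move=> /andP[].
by move=> /andP[-> /IH].
Qed.

Lemma chain_mono eta a z l y : sig D a l = 0 -> chain eta a z l y -> 0 < eta * (y - z).
Proof.
elim: l a z => [|b l IH] a z //; rewrite sig_cons /= slope_signE.
have := sig_le0 b l; case: ifP => /= _ h0 h1; first by lia.
move=> /andP[h2]; rewrite mulr1 => /IH h3.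
have := addr_gt0 h2 (h3 _); rewrite -mulrDr addrC subrKA; apply; lia.
Qed.

Lemma chain_opp eta a z l y : chain eta a z l y -> chain (- eta) a z l y -> False.
Proof.
by case: l => [|b l] /= => [h|/andP[h _] /andP[+ _]];
  rewrite mulNr oppr_gt0 ltNge ltW.
Qed.

(* From beyond [x], in a part of the walk with a single reversal, one edge
   crosses [x]. *)
Lemma chain_cross1 delta c z l x : 0 < delta * (x - z) -> sig D c l = -1 ->
  (forall u b v, u ++ b :: v = l -> p (last c u) b != x) ->
  (delta = 1 \/ delta = -1) ->
  chain delta c z l x ->
  exists u v, [/\ u ++ v = l, (0 < size v)%N, sig D c u = 0, chain delta c z u x &
    chain delta (last c u) x v x].
Proof.
elim: l c z => [|b l IH] c z // xz sl np dd.
have pcb : p c b != x by exact: (np [::] b l (erefl _)).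
rewrite /=; set w := p c b in pcb *; move=> /andP[wz ch].
have [wx|wx] := ltP 0 (delta * (w - x)).
  by exists [::], (b :: l); split => //=; rewrite wx ch.
have {}wx : 0 < delta * (x - w).
  rewrite lt_neqAle -(opprB w) mulrN oppr_ge0 wx andbT eq_sym oppr_eq0 mulf_neq0 ?subr_eq0 //.
  by case: dd => ->; rewrite ?oppr_eq0 oner_eq0.
move: sl ch; rewrite sig_cons slope_signE; case: ifP => tcb /= sl ch.
  have s0 : sig D b l = 0 by lia.
  by have := chain_mono s0 ch; rewrite mulrN1 mulNr oppr_gt0 => /ltW; rewrite leNgt wx.
rewrite mulr1 in ch.
have s1 : sig D b l = -1 by lia.
have np' u' b' v' : u' ++ b' :: v' = l -> p (last b u') b' != x.
  by move=> uv; apply: (np (b :: u') b' v'); rewrite /= uv.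
have [u [v [uv v0 su c1 c2]]] := IH b w wx s1 np' dd ch.
exists (b :: u), v; split=> //; first by rewrite /= uv.
- by rewrite sig_cons tcb; lia.
- by rewrite /= -/w wz slope_signE tcb mulr1.
Qed.

(** The walk leads away from [x] up to its first reversal; after that [chain_cross1] finds the edge
    on which it comes back. *)
Lemma chain_cross0 eta a z l x : 0 <= eta * (z - x) -> sig D a l = -2 ->
  (forall u b v, u ++ b :: v = l -> p (last a u) b != x) ->
  (eta = 1 \/ eta = -1) ->
  chain eta a z l x ->
  exists u v, [/\ u ++ v = l, (0 < size v)%N, sig D a u = -1, chain eta a z u x &
    chain (- eta) (last a u) x v x].
Proof.
elim: l a z => [|b l IH] a z // xz sl np dd; rewrite /=; set w := p a b; move=> /andP[wz ch].
have wx : 0 < eta * (w - x).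
  by have := ltr_wpDl xz wz; rewrite -mulrDr addrC subrKA.
have np' u' b' v' : u' ++ b' :: v' = l -> p (last b u') b' != x.
  by move=> uv; apply: (np (b :: u') b' v'); rewrite /= uv.
move: sl ch; rewrite sig_cons slope_signE; case: ifP => tab /= sl ch.
  have s1 : sig D b l = -1 by lia.
  have wx' : 0 < eta * -1 * (x - w) by rewrite mulrN1 mulNr -mulrN opprB.
  have dd' : eta * -1 = 1 \/ eta * -1 = -1.
    by case: dd => ->; rewrite mulrN1 ?opprK; auto.
  have [u [v [uv v0 su c1 c2]]] := chain_cross1 wx' s1 np' dd' ch.
  exists (b :: u), v; split=> //; first by rewrite /= uv.
  - by rewrite sig_cons tab; lia.
  - by rewrite /= -/w wz slope_signE tab.
  - by rewrite -mulrN1.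
rewrite mulr1 in ch.
have s1 : sig D b l = -2 by lia.
have [u [v [uv v0 su c1 c2]]] := IH b w (ltW wx) s1 np' dd ch.
exists (b :: u), v; split=> //; first by rewrite /= uv.
- by rewrite sig_cons tab; lia.
- by rewrite /= -/w wz slope_signE tab mulr1.
Qed.

(* The ends of a walk on the lines of [a] and [e] are joined by the vertical
   segment at [y], which closes it up to a polygon turning to the right. *)
Definition closes eta a e y : bool := 0 < eta * ((t a - t e) * (y - p a e)).

End Chains.

Section UniqueSplit.
Variables (T : Type) (W : zmodType).

Lemma big_splitseq_eq0 (l : seq T) (Phi : seq T -> seq T -> W) :
  (forall u v, u ++ v = l -> Phi u v = 0) -> \sum_(u <- splitseq l) Phi u.1 u.2 = 0.
Proof.
by move=> H; rewrite (eq_big_splitseq (Psi := fun _ _ => 0)) ?big1.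
Qed.

Lemma big_splitseq_unique (u v : seq T) (Phi : seq T -> seq T -> W) :
  (forall u' v', u' ++ v' = u ++ v -> size u' <> size u -> Phi u' v' = 0) ->
  \sum_(w <- splitseq (u ++ v)) Phi w.1 w.2 = Phi u v.
Proof.
elim: u Phi => [|x u IH] Phi H.
  case: v H => [|y v] H; first exact: big_seq1.
  rewrite big_splitseq_cons (big_splitseq_eq0 (Phi := fun u v => Phi (y :: u) v)) ?addr0 //.
  by move=> u' v' uv; apply: H; rewrite //= uv.
rewrite cat_cons big_splitseq_cons H ?add0r // (IH (fun u v => Phi (x :: u) v)) // => u' v' uv su.
by apply: H; rewrite /= ?uv // => -[].
Qed.

End UniqueSplit.

Section Values.
Variables (R : realType) (Ob : eqType) (t : Ob -> R) (rk : Ob -> Ob -> nat).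
Variables (p : Ob -> Ob -> R) (theta rho : R -> R) (K0 K1 : Ob -> seq Ob -> R -> R) (B : Ob -> seq Ob -> R).
Implicit Types (a b c e : Ob) (l u v : seq Ob) (eta x y z k : R) (m : nat).
Local Notation D := (vdeg t).
Local Notation sg := (sgl (slope_sign t)).

Hypothesis pE : forall a b, p a b = (rk a b)%:R.
Hypothesis dtheta : rderiv theta rho.
Hypothesis theta0 : forall x, x <= - 3^-1 -> theta x = 0.
Hypothesis theta1 : forall x, 3^-1 <= x -> theta x = 1.
Hypothesis rho0 : forall x, 3^-1 <= `|x| -> rho x = 0.
Hypothesis t_inj : forall a b, a != b -> t a != t b.
Hypothesis rkC : forall a b, rk a b = rk b a.
Hypothesis rk_inj : forall a b c e, a != b -> c != e -> rk a b = rk c e ->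
  (a == c) && (b == e) || (a == e) && (b == c).
Hypothesis rk_tri : forall a b e, a != b -> b != e -> a != e ->
  Num.sg ((t b - t e) * (p a b - p b e)) = Num.sg ((t a - t e) * (p a b - p a e)).
Hypothesis K0_nil : forall a x, K0 a [::] x = 0.
Hypothesis K0_one : forall a b x, K0 a [:: b] x = (t a < t b)%R%:R.
Hypothesis K0_deg : forall a l x, sig D a l != -1 -> K0 a l x = 0.
Hypothesis K1_one : forall a b x, K1 a [:: b] x = if t a < t b then 0 else rho (x - p a b).
Hypothesis K1_long : forall a l x, size l != 1%N -> K1 a l x = 0.
Hypothesis K0_ode : forall a l, (1 < size l)%N -> exists k,
  [/\ rderiv (K0 a l) (fun x => k * rho (x - p a (last a l)) -
        (\sum_(u <- splitseq l) K1 a u.1 x * K0 (last a u.1) u.2 x -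
         \sum_(u <- splitseq l) K0 a u.1 x * K1 (last a u.1) u.2 x)),
      t a < t (last a l) -> k = 0 /\ K0 a l (p a (last a l)) = 0 &
      ~~ (t a < t (last a l)) ->
        [/\ B a l = k, vanishing (K0 a l) & vanishing (fun x => K0 a l (- x))]].
Hypothesis B_lt : forall a l, t a < t (last a l) -> B a l =
  - \sum_(u <- splitseq l)
      K0 a u.1 (p a (last a l)) * K0 (last a u.1) u.2 (p a (last a l)).

Definition is_sign (k : R) := k = 1 \/ k = -1.

Definition walks eta a l m := chain t p eta a m%:R l m%:R.

Definition off m (s : seq Ob) := forall c e, c \in s -> e \in s -> c != e -> rk c e != m.

(* Trees with one ascent are functions, constant between the bumps. *)
Definition step_values a l := uniq (a :: l) -> (0 < size l)%N -> sig D a l = -1 ->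
  forall m, off m (a :: l) -> exists k,
    [/\ forall x, `|x - m%:R| <= 3^-1 -> K0 a l x = k, k = 0 \/ is_sign k &
      k <> 0 <-> exists2 eta, is_sign eta & walks eta a l m /\ closes t p eta a (last a l) m%:R].

Lemma closes_sg eta eta' a b c e y z : is_sign eta ->
  eta' = eta ->
  Num.sg ((t a - t e) * (y - p a e)) = Num.sg ((t b - t c) * (z - p b c)) ->
  closes t p eta a e y = closes t p eta' b c z.
Proof.
by move=> _ -> H; rewrite /closes -[LHS]sgr_gt0 -[RHS]sgr_gt0 !sgrM -!(sgrM (_ - _)) H.
Qed.

Lemma sign_cases x y eta : is_sign eta -> x != y -> (0 < eta * (x - y)) || (0 < eta * (y - x)).
Proof. by move=> [] -> /lt_total /orP[]; rewrite ?mul1r ?mulN1r ?opprB ?subr_gt0 => -> //; rewrite orbT. Qed.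

Lemma theta_step m n x : m <> n -> `|x - m%:R| <= 3^-1 -> theta (x - n%:R) = (n < m)%N%:R.
Proof.
move=> mn; rewrite ler_norml => /andP[h1 h2].
case: (ltngtP n m) => [nm|nm|nm].
- have : n.+1%:R <= m%:R :> R by rewrite ler_nat.
  by rewrite -natr1 => h; apply: theta1; move: h1 h2 h; lra.
- have : m.+1%:R <= n%:R :> R by rewrite ler_nat.
  by rewrite -natr1 => h; apply: theta0; move: h1 h2 h; lra.
- by case: mn.
Qed.

(* Here [a :: b :: rcons l e] has exactly one ascent. The two products
   containing a bump are localised at the first and at the last vertex. *)
Section Step.
Variables (a b e : Ob) (l : seq Ob).
Local Notation L := (b :: rcons l e).
Local Notation pen := (last b l).
Hypothesis L_uniq : uniq (a :: L).
Hypothesis L_sig : sig D a L = -1.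
Hypothesis IH1 : step_values b (rcons l e).
Hypothesis IH2 : step_values a (b :: l).

(** The part between the first and the last vertex, common to the walks of the two shorter trees in
    the induction. *)
Definition inner eta := chain t p (eta * slope_sign t a b) b (p a b) l (p pen e).

Let ab : a != b. Proof. by move: L_uniq; rewrite /= inE negb_or => /andP[/andP[]]. Qed.
Let ae : a != e.
Proof. by move: L_uniq; rewrite /= inE mem_rcons inE !negb_or => /andP[/and3P[]]. Qed.
Let al : a \notin b :: l.
Proof.
by move: L_uniq; rewrite /= !inE mem_rcons inE !negb_or => /andP[/and3P[-> _ ->]].
Qed.
Let el : e \notin b :: l.
Proof.
move: L_uniq; rewrite -[a :: L]/(rcons (a :: b :: l) e) rcons_uniq => /andP[+ _].
by rewrite inE negb_or => /andP[].
Qed.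
Let pen_in : pen \in b :: l. Proof. exact: mem_last. Qed.
Let pene : pen != e. Proof. by apply: contraNneq el => <-. Qed.
Let apen : a != pen. Proof. by apply: contraNneq al => ->. Qed.
Let be : b != e. Proof. by apply: contraNneq el => <-; rewrite mem_head. Qed.

(** Supplies the condition [off] under which a shorter tree is evaluated at the bump of a longer
    one. *)
Lemma rk_notin a' b' s : a' != b' -> a' \notin s -> off (rk a' b') s.
Proof.
move=> ab' as' c d cs ds cd; apply/eqP => /(rk_inj cd ab').
by case/orP => /andP[/eqP c1 /eqP d1]; move: as'; rewrite -?c1 -?d1 ?cs ?ds.
Qed.

(** If the only ascent were at the first vertex, the inner walk would be monotone in the direction
    opposite to [eta]. *)
Lemma inner_up eta : inner eta -> 0 < eta * (p pen e - p a b) -> ~~ (t a < t b).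
Proof.
move=> I h; apply/negP => tab; have [/(_ tab) s0 _ _ _] := sig_ends L_sig.
have := chain_mono s0 I.
by rewrite slope_signE tab mulrN1 mulNr oppr_gt0 ltNge ltW.
Qed.

Lemma inner_down eta : inner eta -> 0 < eta * (p a b - p pen e) -> ~~ (t pen < t e).
Proof.
move=> I h; apply/negP => tab; have [_ _ /(_ tab) s0 _] := sig_ends L_sig.
have := chain_mono s0.1 I.
by rewrite slope_signE s0.2 mulr1 -opprB mulrN oppr_gt0 ltNge ltW.
Qed.

Lemma closes_first eta : is_sign eta ->
  closes t p eta b e (p a b) = closes t p eta a e (p a b).
Proof. by move=> seta; exact: closes_sg (rk_tri ab be ae). Qed.

Lemma closes_last eta : is_sign eta ->
  closes t p eta a pen (p pen e) = closes t p eta a e (p pen e).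
Proof.
move=> seta; apply: closes_sg => //.
have ea : e != a by rewrite eq_sym.
have pa : pen != a by rewrite eq_sym.
have := rk_tri pene ea pa.
rewrite -[t e - t a]opprB -[t pen - t a]opprB !mulNr !sgrN => /oppr_inj.
by rewrite [p e a]pE [p pen a]pE [rk e a]rkC [rk pen a]rkC -[_%:R]pE -[X in _ = Num.sg (_ * (_ - X))]pE.
Qed.

(** The bump at [p a b] localises the product, and the other factor is constant around it by the
    induction hypothesis [IH1]. *)
Lemma inner_alpha : exists k, [/\ forall x, K1 a [:: b] x * K0 b (rcons l e) x = k * rho (x - p a b),
  k = 0 \/ is_sign k & k <> 0 <-> exists2 eta, is_sign eta &
    [/\ inner eta, 0 < eta * (p pen e - p a b) & closes t p eta a e (p a b)]].
Proof.
have [tab|tab] := boolP (t a < t b).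
  exists 0; split=> [x||]; [by rewrite K1_one tab !mul0r|by left|].
  by split=> // -[eta seta [I h _]]; have := inner_up I h; rewrite tab.
have [_ /(_ tab) s1 _ _] := sig_ends L_sig.
have u1 : uniq (b :: rcons l e) by case/andP: L_uniq.
have off1 : off (rk a b) (b :: rcons l e).
  apply: rk_notin => //.
  by rewrite inE mem_rcons inE !negb_or ab ae; move: al; rewrite inE negb_or => /andP[].
have [|k [Kk kk kP]] := IH1 u1 _ s1 off1; first by rewrite size_rcons.
exists k; split=> // [x|].
  rewrite K1_one (negbTE tab); have [xp|xp] := leP `|x - p a b| 3^-1.
    by rewrite pE in xp; rewrite (Kk x xp) mulrC.
  by rewrite rho0 ?mul0r ?mulr0 // ltW.
have E eta : is_sign eta -> (walks eta b (rcons l e) (rk a b) /\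
    closes t p eta b (last b (rcons l e)) (rk a b)%:R) <->
    [/\ inner eta, 0 < eta * (p pen e - p a b) & closes t p eta a e (p a b)].
  move=> seta; rewrite /walks chain_rcons (sgl_sig1 s1) /inner slope_signE (negbTE tab).
  rewrite mulr1 last_rcons -pE mulrN1 mulNr -mulrN opprB.
  rewrite closes_first //.
  by split=> [[/andP[]]|[-> -> ->]].
split=> [/kP[eta seta /(E _ seta)]|[eta seta /(E _ seta)]]; first by exists eta.
by move=> h; apply/kP; exists eta.
Qed.

Lemma inner_beta : exists k, [/\ forall x, K0 a (b :: l) x * K1 pen [:: e] x = k * rho (x - p pen e),
  k = 0 \/ is_sign k & k <> 0 <-> exists2 eta, is_sign eta &
    [/\ inner eta, 0 < eta * (p a b - p pen e) & closes t p eta a e (p pen e)]].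
Proof.
have [tab|tab] := boolP (t pen < t e).
  exists 0; split=> [x||]; [by rewrite K1_one tab mulr0 mul0r|by left|].
  by split=> // -[eta seta [I h _]]; have := inner_down I h; rewrite tab.
have [_ _ _ /(_ tab) s1] := sig_ends L_sig.
have u1 : uniq (a :: b :: l).
  by move: L_uniq; rewrite -[a :: L]/(rcons (a :: b :: l) e) rcons_uniq => /andP[].
have off1 : off (rk pen e) (a :: b :: l).
  rewrite rkC; apply: rk_notin; first by rewrite eq_sym.
  by rewrite inE negb_or eq_sym ae.
have [|k [Kk kk kP]] := IH2 u1 _ s1 off1; first by [].
exists k; split=> // [x|].
  rewrite K1_one (negbTE tab); have [xp|xp] := leP `|x - p pen e| 3^-1.
    by rewrite pE in xp; rewrite (Kk x xp).
  by rewrite rho0 ?mulr0 // ltW.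
have E eta : is_sign eta -> (walks eta a (b :: l) (rk pen e) /\
    closes t p eta a (last a (b :: l)) (rk pen e)%:R) <->
    [/\ inner eta, 0 < eta * (p a b - p pen e) & closes t p eta a e (p pen e)].
  move=> seta; rewrite /walks /= /inner -!pE.
  rewrite closes_last //.
  by split=> [[/andP[]]|[-> -> ->]].
split=> [/kP[eta seta /(E _ seta)]|[eta seta /(E _ seta)]]; first by exists eta.
by move=> h; apply/kP; exists eta.
Qed.

Lemma walk_split eta y : chain t p eta a y L y =
  [&& 0 < eta * (p a b - y), inner eta & 0 < eta * (p pen e - y)].
Proof.
have := sgl_sig1 L_sig => /= E.
by rewrite /= chain_rcons -[eta * _ * sg b _]mulrA E mulrN1 mulNr -mulrN opprB.
Qed.

Lemma vertices_neq : p a b != p pen e.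
Proof.
rewrite !pE eqr_nat; apply/eqP => /(rk_inj ab pene).
case/orP => /andP[a1 _]; first by move: apen; rewrite a1.
by move: ae; rewrite a1.
Qed.

(* If the slope of [a] is below that of [e], the walk is automatically closed by
   a vertical segment: the part between the lines of [a] and [e] is convex. *)
Hypothesis tae : t a < t e.
Hypothesis close1 : forall eta, is_sign eta -> t b < t e -> sig D b (rcons l e) = -1 ->
  chain t p eta b (p a b) (rcons l e) (p a b) -> closes t p eta b e (p a b).
Hypothesis close2 : forall eta, is_sign eta -> t a < t pen -> sig D a (b :: l) = -1 ->
  chain t p eta a (p pen e) (b :: l) (p pen e) -> closes t p eta a pen (p pen e).

Lemma inner_close1 eta : is_sign eta -> inner eta -> 0 < eta * (p pen e - p a b) ->
  closes t p eta a e (p a b).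
Proof.
move=> seta I h; have tab := inner_up I h.
have [_ /(_ tab) s1 _ _] := sig_ends L_sig.
rewrite -closes_first //; apply: close1 => //.
  by apply: le_lt_trans tae; rewrite leNgt.
rewrite chain_rcons (sgl_sig1 s1) mulrN1 mulNr -mulrN opprB h andbT.
by move: I; rewrite /inner slope_signE (negbTE tab) mulr1.
Qed.

Lemma inner_close2 eta : is_sign eta -> inner eta -> 0 < eta * (p a b - p pen e) ->
  closes t p eta a e (p pen e).
Proof.
move=> seta I h; have tab := inner_down I h.
have [_ _ _ /(_ tab) s1] := sig_ends L_sig.
rewrite -closes_last //; apply: close2 => //.
  by apply: lt_le_trans tae _; rewrite leNgt.
by rewrite /= h.
Qed.

Lemma closes_back eta y z : 0 < eta * (z - y) -> closes t p eta a e z -> closes t p eta a e y.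
Proof.
rewrite /closes !(mulrCA eta) => zy.
have t0 : t a - t e < 0 by rewrite subr_lt0.
rewrite !nmulr_rgt0 //; move: zy; lra.
Qed.

Lemma walk_closes eta y : is_sign eta -> chain t p eta a y L y -> closes t p eta a e y.
Proof.
move=> seta; rewrite walk_split => /and3P[h1 I h2].
have [h|h] := orP (sign_cases seta vertices_neq).
  exact: closes_back h2 (inner_close2 seta I h).
exact: closes_back h1 (inner_close1 seta I h).
Qed.

End Step.

Lemma closes_auto a l eta y : uniq (a :: l) -> (0 < size l)%N -> sig D a l = -1 ->
  t a < t (last a l) -> is_sign eta -> chain t p eta a y l y -> closes t p eta a (last a l) y.
Proof.
have [n] := ubnP (size l); elim: n a l eta y => // n IH a [//|b l] eta y.
case/lastP: l => [|l e] ln ul _ sl tal seta.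
  move: tal; rewrite /= => tal /andP[h _]; rewrite /closes mulrCA nmulr_rgt0 ?subr_lt0 //.
  by rewrite -(opprB (p a b)) mulrN oppr_lt0.
rewrite /= last_rcons in tal *; apply: walk_closes => // eta' seta' t1 s1 ch.
  have := IH b (rcons l e) eta' (p a b); rewrite last_rcons; apply=> //.
  - by case/andP: ul.
  - by rewrite size_rcons.
apply: IH ch => //.
- by move: ln; rewrite /= size_rcons.
- by move: ul; rewrite -[a :: _]/(rcons (a :: b :: l) e) rcons_uniq => /andP[].
Qed.

Lemma is_sign_cases eta eta' : is_sign eta -> is_sign eta' -> eta = eta' \/ eta' = - eta.
Proof. by move=> [] -> [] ->; rewrite ?opprK; auto. Qed.

(** The derivative of the tree is a combination of three bumps, at the first vertex, at the last
    vertex and at [p a e]. Adding the corresponding steps gives a constant function. *)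
Lemma jump_equation a b l e : uniq (a :: b :: rcons l e) -> sig D a (b :: rcons l e) = -1 ->
  step_values b (rcons l e) -> step_values a (b :: l) -> exists k1 k2 k3,
  [/\ k1 = 0 \/ is_sign k1, k2 = 0 \/ is_sign k2,
      k1 <> 0 <-> exists2 eta, is_sign eta & [/\ inner a b e l eta,
        0 < eta * (p (last b l) e - p a b) & closes t p eta a e (p a b)],
      k2 <> 0 <-> exists2 eta, is_sign eta & [/\ inner a b e l eta,
        0 < eta * (p a b - p (last b l) e) & closes t p eta a e (p (last b l) e)] &
      (forall x y,
        K0 a (b :: rcons l e) x + k1 * theta (x - p a b) - k2 * theta (x - p (last b l) e)
           - k3 * theta (x - p a e) =
        K0 a (b :: rcons l e) y + k1 * theta (y - p a b) - k2 * theta (y - p (last b l) e)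
           - k3 * theta (y - p a e)) /\
      (if t a < t e then k3 = 0 /\ K0 a (b :: rcons l e) (p a e) = 0 else
       [/\ B a (b :: rcons l e) = k3, vanishing (K0 a (b :: rcons l e)) &
           vanishing (fun x => K0 a (b :: rcons l e) (- x))])].
Proof.
move=> ul sl v1 v2.
have [k1 [E1 k1s k1P]] := inner_alpha ul sl v1.
have [k2 [E2 k2s k2P]] := inner_beta ul sl v2.
have [|k3 [dK lt3 ge3]] := @K0_ode a (b :: rcons l e); first by rewrite /= size_rcons.
rewrite /= last_rcons in dK lt3 ge3.
exists k1, k2, k3; split=> //; split; last first.
  by case: ifP => tae; [exact: lt3|apply: ge3; rewrite tae].
move=> x y.
apply: (cst_of_rderiv0 (g := fun x => K0 a (b :: rcons l e) x + k1 * theta (x - p a b)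
  - k2 * theta (x - p (last b l) e) - k3 * theta (x - p a e))) => {x y}.
move=> x.
have dth k z : is_derive x 1 (fun x => k * theta (x - z)) (k * rho (x - z)).
  exact: is_derive_pZ (is_derive_pshift (dtheta (x - z))).
apply: is_derive_eq (is_derive_pB (is_derive_pB (is_derive_pD (dK x) (dth k1 (p a b)))
  (dth k2 (p (last b l) e))) (dth k3 (p a e))) _.
have -> : \sum_(u <- splitseq (b :: rcons l e)) K1 a u.1 x * K0 (last a u.1) u.2 x =
    k1 * rho (x - p a b).
  rewrite (big_splitseq_unique (u := [:: b]) (v := rcons l e)
    (Phi := fun u v => K1 a u x * K0 (last a u) v x)) ?E1 // => u v _ /eqP su.
  by rewrite K1_long ?mul0r.
have -> : \sum_(u <- splitseq (b :: rcons l e)) K0 a u.1 x * K1 (last a u.1) u.2 x =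
    k2 * rho (x - p (last b l) e).
  have -> : b :: rcons l e = (b :: l) ++ [:: e] by rewrite cats1.
  rewrite (big_splitseq_unique (Phi := fun u v => K0 a u x * K1 (last a u) v x)) ?E2 //.
  move=> u v uv su; rewrite K1_long ?mulr0 //; apply/eqP => v1'; apply: su.
  by have := congr1 size uv; rewrite !size_cat v1' /= => /eqP; rewrite eqn_add2r => /eqP.
by ring.
Qed.

(* The value at [M] of minus a step at [P], normalised to vanish at [p a e] if
   [t a < t e], and otherwise at infinity, by means of a step at [p a e]. *)
Definition chi a e (P M : R) : R :=
  if t a < t e then (P < p a e)%R%:R - (P < M)%R%:R else (p a e < M)%R%:R - (P < M)%R%:R.

Lemma closes_lt a e eta y : t a < t e -> closes t p eta a e y = (0 < eta * (p a e - y)).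
Proof.
move=> tae; rewrite /closes mulrCA nmulr_rgt0 ?subr_lt0 //.
by rewrite -(opprB (p a e)) mulrN oppr_lt0.
Qed.

Lemma closes_gt a e eta y : t e < t a -> closes t p eta a e y = (0 < eta * (y - p a e)).
Proof. by move=> tae; rewrite /closes mulrCA pmulr_rgt0 // subr_gt0. Qed.

Lemma window_lt P Q M eta : P != M -> Q != M -> is_sign eta -> 0 < eta * (Q - P) ->
  let c := (P < Q)%R%:R - (P < M)%R%:R : R in
  (c = 0 \/ is_sign c) /\ (c <> 0 <-> 0 < eta * (P - M) /\ 0 < eta * (Q - M)).
Proof.
move=> PM QM seta QP /=; have N1 : (-1 : R) <> 0 by apply/eqP; rewrite oppr_eq0 oner_eq0.
have N2 : (1 : R) <> 0 by apply/eqP; rewrite oner_eq0.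
case: seta QP => ->; rewrite ?mul1r ?mulN1r ?oppr_gt0 ?subr_gt0 ?subr_lt0 => QP.
  rewrite QP; case: ltgtP PM => // PM _; rewrite ?subrr ?subr0 /is_sign; split; auto.
    by split=> // -[MP]; rewrite ltNge ltW // in PM.
  by split=> // _; split=> //; exact: lt_trans QP.
rewrite [P < Q]ltNge ltW //=; case: ltgtP PM => // PM _; rewrite ?sub0r ?oppr0 /is_sign; split; auto.
  by split=> // _; split=> //; exact: lt_trans PM.
by split=> // -[MP]; rewrite ltNge ltW // in PM.
Qed.

Lemma window_gt P Q M eta : P != M -> Q != M -> is_sign eta -> 0 < eta * (P - Q) ->
  let c := (Q < M)%R%:R - (P < M)%R%:R : R in
  (c = 0 \/ is_sign c) /\ (c <> 0 <-> 0 < eta * (P - M) /\ 0 < eta * (M - Q)).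
Proof.
move=> PM QM seta QP /=; have N1 : (-1 : R) <> 0 by apply/eqP; rewrite oppr_eq0 oner_eq0.
have N2 : (1 : R) <> 0 by apply/eqP; rewrite oner_eq0.
case: seta QP => ->; rewrite ?mul1r ?mulN1r ?oppr_gt0 ?subr_gt0 ?subr_lt0 => QP.
  case: (ltgtP P M) PM => // PM _; case: (ltgtP Q M) QM => // QM _;
    rewrite ?subrr ?subr0 ?sub0r /is_sign; split; auto; split=> // -[] //.
  by move: (lt_trans QM QP) => /lt_trans/(_ PM); rewrite ltxx.
case: (ltgtP P M) PM => // PM _; case: (ltgtP Q M) QM => // QM _;
  rewrite ?subrr ?subr0 ?sub0r /is_sign; split; auto; split=> // -[] //.
by move: (lt_trans PM QP) => /lt_trans/(_ QM); rewrite ltxx.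
Qed.

(** Translates a nonzero step value into the conditions at [M] that occur in [step_values]; [closes]
    at [P] orders [P] and [p a e] along [eta]. *)
Lemma chiP a e (P M : R) eta : a != e -> P != M -> p a e != M -> is_sign eta ->
  closes t p eta a e P ->
  (chi a e P M = 0 \/ is_sign (chi a e P M)) /\
  (chi a e P M <> 0 <-> 0 < eta * (P - M) /\ closes t p eta a e M).
Proof.
move=> ae PM QM seta; rewrite /chi; set Q := p a e in QM *.
have [tae|tae|tae] := ltgtP (t a) (t e); last by have := t_inj ae; rewrite tae eqxx.
- by rewrite !(closes_lt _ _ tae) -/Q; apply: window_lt.
- by rewrite !(closes_gt _ _ tae) -/Q; apply: window_gt.
Qed.

Lemma vanishing_eventually (g : R -> R) k X : vanishing g -> (forall x, X <= x -> g x = k) -> k = 0.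
Proof.
move=> vg gk; apply: vanishing_cst => z z0; have [Y HY] := vg z z0.
exists (Num.max X Y) => x; rewrite ge_max => /andP[Xx Yx].
by rewrite -(gk x Xx) HY.
Qed.

Lemma jump_values a b l e : uniq (a :: b :: rcons l e) -> sig D a (b :: rcons l e) = -1 ->
  step_values b (rcons l e) -> step_values a (b :: l) -> exists k1 k2,
  [/\ k1 = 0 \/ is_sign k1, k2 = 0 \/ is_sign k2,
      k1 <> 0 <-> exists2 eta, is_sign eta & [/\ inner a b e l eta,
        0 < eta * (p (last b l) e - p a b) & closes t p eta a e (p a b)],
      k2 <> 0 <-> exists2 eta, is_sign eta & [/\ inner a b e l eta,
        0 < eta * (p a b - p (last b l) e) & closes t p eta a e (p (last b l) e)] &
      (forall m, off m (a :: b :: rcons l e) -> forall x, `|x - m%:R| <= 3^-1 ->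
        K0 a (b :: rcons l e) x =
          k1 * chi a e (p a b) m%:R - k2 * chi a e (p (last b l) e) m%:R) /\
      (~~ (t a < t e) -> B a (b :: rcons l e) = k1 - k2)].
Proof.
move=> ul sl v1 v2.
have [k1 [k2 [k3 [k1s k2s k1P k2P [C V]]]]] := jump_equation ul sl v1 v2.
exists k1, k2; split=> //.
have [p_in [ab_in [ae_in [e_in [a_in b_in]]]]] : last b l \in b :: l /\ (a != b /\ (a != e /\
    (e \notin a :: b :: l /\ (a \notin b :: rcons l e /\ last b l != e)))).
  split; first exact: mem_last.
  have := ul; rewrite -[a :: _]/(rcons (a :: b :: l) e) rcons_uniq => /andP[e_in _].
  have /= /andP[a_in _] := ul.
  have pe : last b l != e.
    by apply: contraNneq e_in => <-; rewrite inE mem_last orbT.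
  split; first by move: a_in; rewrite inE negb_or => /andP[].
  split; last by [].
  by move: a_in; rewrite inE mem_rcons inE !negb_or => /and3P[].
have pb : last b l \in b :: rcons l e by rewrite -rcons_cons mem_rcons inE p_in orbT.
have eb : e \in b :: rcons l e by rewrite -rcons_cons mem_rcons mem_head.
have n1 : rk a b != rk a e.
  rewrite [rk a e]rkC; apply: (rk_notin _ e_in) => //; first by rewrite eq_sym.
    exact: mem_head.
  by rewrite !inE eqxx orbT.
have n2 : rk (last b l) e != rk a e by apply: (rk_notin _ a_in).
have thm m c d x : rk c d != m -> `|x - m%:R| <= 3^-1 ->
    theta (x - p c d) = (p c d < m%:R)%R%:R.
  by rewrite eq_sym !pE => /eqP h1 h2; rewrite (theta_step h1 h2) ltr_nat.
have offm m : off m (a :: b :: rcons l e) ->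
    [/\ rk a b != m, rk (last b l) e != m & rk a e != m].
  move=> o; split; apply: o => //; rewrite ?inE ?eqxx ?orbT //.
  - by move: pb; rewrite inE => ->; rewrite orbT.
  - by move: eb; rewrite inE => ->; rewrite orbT.
  - by move: eb; rewrite inE => ->; rewrite orbT.
have [tae|tae] := boolP (t a < t e).
  move: V; rewrite tae => -[k30 K0p]; split=> // m om x xm.
  have [nm1 nm2 nm3] := offm m om.
  have xp : `|p a e - (rk a e)%:R| <= 3^-1 by rewrite pE subrr normr0 invr_ge0.
  have := C x (p a e); rewrite k30 !mul0r K0p.
  rewrite !(thm m _ _ x nm1 xm, thm m _ _ x nm2 xm, thm _ _ _ _ n1 xp, thm _ _ _ _ n2 xp).
  by rewrite -[(rk a e)%:R]pE /chi tae; lra.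
move: V; rewrite (negbTE tae) => -[BE V1 V2].
pose X := 3^-1 + `|p a b| + `|p (last b l) e| + `|p a e|.
have thi x c d : `|p c d| <= X - 3^-1 -> X <= x -> theta (x - p c d) = 1.
  by rewrite ler_norml => /andP[_ h1] h2; apply: theta1; lra.
have tlo x c d : `|p c d| <= X - 3^-1 -> X <= x -> theta (- x - p c d) = 0.
  by rewrite ler_norml => /andP[h1 _] h2; apply: theta0; lra.
have h0 := normr_ge0 (p a b); have h0' := normr_ge0 (p (last b l) e).
have h0'' := normr_ge0 (p a e).
have b1 : `|p a b| <= X - 3^-1 by rewrite /X; lra.
have b2 : `|p (last b l) e| <= X - 3^-1 by rewrite /X; lra.
have b3 : `|p a e| <= X - 3^-1 by rewrite /X; lra.
(* Far to the left all three steps are 0 and the tree vanishes, so the constant is 0. *)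
have C0 y : K0 a (b :: rcons l e) y + k1 * theta (y - p a b) -
    k2 * theta (y - p (last b l) e) - k3 * theta (y - p a e) = 0.
  apply: (vanishing_eventually (X := X) V2) => x Xx; rewrite -(C (- x)).
  by rewrite (tlo _ _ _ b1 Xx) (tlo _ _ _ b2 Xx) (tlo _ _ _ b3 Xx); lra.
(* Far to the right all steps are 1, which determines the coefficient of the third. *)
have k3E : - k1 + k2 + k3 = 0.
  apply: (vanishing_eventually (X := X) V1) => x Xx; have := C0 x.
  by rewrite (thi _ _ _ b1 Xx) (thi _ _ _ b2 Xx) (thi _ _ _ b3 Xx); lra.
split=> [m om x xm|_]; last by rewrite BE; lra.
have [nm1 nm2 nm3] := offm m om; have := C0 x.
rewrite !(thm m _ _ x nm1 xm, thm m _ _ x nm2 xm, thm m _ _ x nm3 xm) /chi (negbTE tae).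
have -> : k3 = k1 - k2 by lra.
set u := (_%:R : R); set v := (_%:R : R); set w := (_%:R : R).
by move=> h; rewrite [RHS](_ : _ = - (k1 * u - k2 * v - (k1 - k2) * w)); [lra|ring].
Qed.

(** The two jumps require opposite orders of the end vertices along the direction of the inner walk,
    and [chain_opp] makes that direction unique. *)
Lemma one_jump a b l e k1 k2 : uniq (a :: b :: rcons l e) ->
  (k1 <> 0 -> exists2 eta, is_sign eta & [/\ inner a b e l eta,
     0 < eta * (p (last b l) e - p a b) & closes t p eta a e (p a b)]) ->
  (k2 <> 0 -> exists2 eta, is_sign eta & [/\ inner a b e l eta,
     0 < eta * (p a b - p (last b l) e) & closes t p eta a e (p (last b l) e)]) ->
  k1 = 0 \/ k2 = 0.
Proof.
move=> ul H1 H2; have [->|/eqP k10] := eqVneq k1 0; first by left.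
have [->|/eqP k20] := eqVneq k2 0; first by right.
have [eta s1 [I1 h1 _]] := H1 k10; have [eta' s2 [I2 h2 _]] := H2 k20.
case: (is_sign_cases s1 s2) => E.
  by move: h2; rewrite -E -opprB mulrN oppr_gt0 ltNge ltW.
rewrite E in I2 h2; by have := chain_opp I1; rewrite -mulNr => /(_ I2).
Qed.

Lemma inner_inj a b e l eta eta' : is_sign eta -> is_sign eta' ->
  inner a b e l eta -> inner a b e l eta' -> eta = eta'.
Proof.
move=> s1 s2 I1 I2; case: (is_sign_cases s1 s2) => // E; rewrite E in I2.
by have := chain_opp I1; rewrite -mulNr => /(_ I2).
Qed.

Lemma walk_ends_neq a b l e : uniq (a :: b :: rcons l e) ->
  [/\ a != e, forall m, off m (a :: b :: rcons l e) ->
     [/\ p a b != m%:R, p (last b l) e != m%:R & p a e != m%:R] &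
     t a != t e].
Proof.
move=> ul.
have p_in : last b l \in b :: l := mem_last b l.
have := ul; rewrite -[a :: _]/(rcons (a :: b :: l) e) rcons_uniq => /andP[e_in _].
have /= /andP[a_in _] := ul.
have pe : last b l != e by apply: contraNneq e_in => <-; rewrite inE mem_last orbT.
have ab : a != b by move: a_in; rewrite inE negb_or => /andP[].
have ae : a != e by move: a_in; rewrite inE mem_rcons inE !negb_or => /and3P[].
have pb : last b l \in b :: rcons l e by rewrite -rcons_cons mem_rcons inE p_in orbT.
have eb : e \in b :: rcons l e by rewrite -rcons_cons mem_rcons mem_head.
split=> // [m om|]; last exact: t_inj.
split; rewrite pE eqr_nat; apply: om => //; rewrite ?mem_head //;
  by rewrite inE ?pb ?eb ?mem_head orbT.
Qed.

Lemma sign_mul k k' : is_sign k -> k' = 0 \/ is_sign k' -> k * k' = 0 \/ is_sign (k * k').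
Proof. by rewrite /is_sign => -[] -> [->|[]->]; rewrite ?mulr0 ?mul1r ?mulN1r ?opprK; auto. Qed.

Lemma step_values_rcons a b l e : step_values b (rcons l e) -> step_values a (b :: l) -> step_values a (b :: rcons l e).
Proof.
move=> v1 v2 ul _ sl m om.
have [k1 [k2 [k1s k2s k1P k2P [KE _]]]] := jump_values ul sl v1 v2.
have [ae /(_ m om)[PM PM' QM] tae] := walk_ends_neq ul.
have W eta : walks eta a (b :: rcons l e) m <->
    [/\ 0 < eta * (p a b - m%:R), inner a b e l eta & 0 < eta * (p (last b l) e - m%:R)].
  by rewrite /walks (walk_split sl); split=> [/and3P[]|[-> -> ->]].
have le : last a (b :: rcons l e) = e by rewrite /= last_rcons.
have add x y z eta : 0 < eta * (x - y) -> 0 < eta * (y - z) -> 0 < eta * (x - z).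
  by move=> h1 h2; have := addr_gt0 h1 h2; rewrite -mulrDr subrKA.
exists (k1 * chi a e (p a b) m%:R - k2 * chi a e (p (last b l) e) m%:R).
have [k10|/eqP k10] := eqVneq k1 0; last first.
  have [//|k20] := one_jump ul k1P.1 k2P.1.
  have [eta seta [I h c]] := k1P.1 k10.
  have [chis chiP'] := chiP ae PM QM seta c.
  have k1s' : is_sign k1 by case: k1s.
  split; [by move=> x; exact: KE| |]; rewrite k20 mul0r subr0.
    exact: sign_mul.
  have -> : k1 * chi a e (p a b) m%:R <> 0 <-> chi a e (p a b) m%:R <> 0.
    split=> H; first by move=> E; apply: H; rewrite E mulr0.
    by move/eqP; rewrite mulf_eq0 => /orP[/eqP //|/eqP].
  rewrite chiP'; split=> [[h1 h2]|[eta' seta' [/W[h1 I' h2]]]].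
    by exists eta => //; rewrite le; split=> //; apply/W; split=> //; exact: add h h1.
  by rewrite le -(inner_inj seta seta' I I') in h1 *.
have [k20|/eqP k20] := eqVneq k2 0; last first.
  have [eta seta [I h c]] := k2P.1 k20.
  have [chis chiP'] := chiP ae PM' QM seta c.
  have k2s' : is_sign k2 by case: k2s.
  split; [by move=> x; exact: KE| |]; rewrite k10 mul0r sub0r -mulNr.
    by apply: sign_mul => //; case: k2s' => ->; rewrite /is_sign ?opprK; auto.
  have -> : - k2 * chi a e (p (last b l) e) m%:R <> 0 <-> chi a e (p (last b l) e) m%:R <> 0.
    split=> H; first by move=> E; apply: H; rewrite E mulr0.
    by move/eqP; rewrite mulf_eq0 oppr_eq0 => /orP[/eqP //|/eqP].
  rewrite chiP'; split=> [[h1 h2]|[eta' seta' [/W[h1 I' h2]]]].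
    by exists eta => //; rewrite le; split=> //; apply/W; split=> //; exact: add h h1.
  by rewrite le -(inner_inj seta seta' I I') in h2 *.
split; [by move=> x; exact: KE| |]; rewrite k10 k20 !mul0r subr0; first by left.
(* A walk closed over [m] would make one of the two jumps nonzero: which one depends on the order of
   the first and last vertices along [eta]. *)
split=> // -[eta seta [/W[h1 I h2]]]; rewrite le => c.
have ab12 := vertices_neq ul.
have [h|h] := orP (sign_cases seta ab12).
  case: (k2P.2 _) => //; exists eta => //; split=> //.
  have [tae'|tae'|E] := ltgtP (t a) (t e); last by rewrite E eqxx in tae.
    apply: (inner_close2 ul sl) => // eta' seta' tap s1.
    by apply: closes_auto => //; move: ul; rewrite -[a :: _]/(rcons (a :: b :: l) e) rcons_uniq => /andP[].
  by move: c; rewrite !(closes_gt _ _ tae'); exact: add.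
case: (k1P.2 _) => //; exists eta => //; split=> //.
have [tae'|tae'|E] := ltgtP (t a) (t e); last by rewrite E eqxx in tae.
  apply: (inner_close1 ul sl) => // eta' seta' tap s1 ch.
  have := closes_auto _ _ s1 _ seta' ch; rewrite last_rcons size_rcons; apply=> //.
  by case/andP: ul.
by move: c; rewrite !(closes_gt _ _ tae'); exact: add.
Qed.

Lemma step_values_all a l : step_values a l.
Proof.
have [n] := ubnP (size l); elim: n a l => // n IH a [|b l] ln; first by move=> ? [].
case/lastP: l ln => [_|l e ln]; last first.
  apply: step_values_rcons; apply: IH; move: ln; rewrite /= ?size_rcons //.
move=> ul _ sl m om; exists 1.
have tab : t a < t b by move: sl; rewrite sig_cons /=; case: (t a < t b).
have ab : a != b by move: ul; rewrite /= inE => /andP[].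
have pm : p a b != m%:R by rewrite pE eqr_nat; apply: om; rewrite ?inE ?eqxx ?orbT.
split=> [x _||]; first by rewrite K0_one tab.
  by right; left.
split=> [_|_]; last by apply/eqP; rewrite oner_eq0.
(* For a single edge, the direction of the walk is given by the side of [m] on which [p a b]
   lies. *)
have [h|h] : 0 < 1 * (p a b - m%:R) \/ 0 < -1 * (p a b - m%:R).
  have /orP[] := sign_cases (or_introl (erefl 1)) pm; first by left.
  by right; rewrite mulN1r opprB -[_ - _]mul1r.
exists 1; first by left.
  rewrite /walks /= slope_signE tab h /=; split; first by rewrite mulrN1 mulNr -mulrN opprB.
  by rewrite /= (closes_lt _ _ tab).
exists (-1); first by right.
rewrite /walks /= slope_signE tab h /=; split.
  by rewrite mulrNN mulr1 mul1r; move: h; rewrite mulN1r opprB.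
by rewrite /= (closes_lt _ _ tab).
Qed.

(** Here the closing vertical segment has shrunk to the vertex of [a] and [last a l]. *)
Definition closed_walk eta a l :=
  chain t p eta a (p a (last a l)) l (p a (last a l)).

Lemma const_gt a l : uniq (a :: l) -> (1 < size l)%N -> sig D a l = -1 ->
  ~~ (t a < t (last a l)) ->
  (B a l = 0 \/ is_sign (B a l)) /\
  (B a l <> 0 <-> exists2 eta, is_sign eta & closed_walk eta a l).
Proof.
case: l => // b l; case/lastP: l => // l e ul _ sl; rewrite /closed_walk /= last_rcons => tae.
have [k1 [k2 [k1s k2s k1P k2P [_ /(_ tae) BE]]]] :=
  jump_values ul sl (@step_values_all b _) (@step_values_all a _).
have [ae _ tne] := walk_ends_neq ul.
have tea : t e < t a by rewrite lt_neqAle eq_sym tne leNgt.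
have W eta : chain t p eta a (p a e) (b :: rcons l e) (p a e) <->
    [/\ 0 < eta * (p a b - p a e), inner a b e l eta & 0 < eta * (p (last b l) e - p a e)].
  by rewrite (walk_split sl); split=> [/and3P[]|[-> -> ->]].
have add x y z eta : 0 < eta * (x - y) -> 0 < eta * (y - z) -> 0 < eta * (x - z).
  by move=> h1 h2; have := addr_gt0 h1 h2; rewrite -mulrDr subrKA.
have [k10|/eqP k10] := eqVneq k1 0; last first.
  have [//|k20] := one_jump ul k1P.1 k2P.1.
  rewrite BE k20 subr0; split=> //; split=> // _.
  have [eta seta [I h]] := k1P.1 k10; rewrite (closes_gt _ _ tea) => c.
  by exists eta => //; apply/W; split=> //; exact: add h c.
have [k20|/eqP k20] := eqVneq k2 0; last first.
  rewrite BE k10 sub0r; split.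
    by right; case: k2s => // -[] ->; rewrite /is_sign ?opprK; auto.
  split=> [_|_]; last by apply/eqP; rewrite oppr_eq0; exact/eqP.
  have [eta seta [I h]] := k2P.1 k20; rewrite (closes_gt _ _ tea) => c.
  by exists eta => //; apply/W; split=> //; exact: add h c.
rewrite BE k10 k20 subrr; split; first by left.
split=> // -[eta seta /W[h1 I h2]].
have [h|h] := orP (sign_cases seta (vertices_neq ul)).
  by case: (k2P.2 _) => //; exists eta => //; split=> //; rewrite (closes_gt _ _ tea).
by case: (k1P.2 _) => //; exists eta => //; split=> //; rewrite (closes_gt _ _ tea).
Qed.

Section Crossing.
Variables (a : Ob) (l : seq Ob).
Local Notation e := (last a l).
Local Notation P := (p a (last a l)).
Hypothesis l_uniq : uniq (a :: l).
Hypothesis l_sig : sig D a l = -2.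

Let term u v : R := K0 a u P * K0 (last a u) v P.

(** The edge on the line of [last a u] passes the abscissa [P] of the starting vertex; it cuts the
    walk into two walks with one ascent each, both closed by the vertical segment at [P]. *)
Definition crosses u v eta := [/\ is_sign eta, (0 < size u)%N, (0 < size v)%N &
  [/\ sig D a u = -1, chain t p eta a P u P, chain t p (- eta) (last a u) P v P &
      closes t p eta a (last a u) P]].

Lemma term_cases u v : u ++ v = l ->
  (term u v = 0 \/ is_sign (term u v)) /\ (term u v <> 0 <-> exists eta, crosses u v eta).
Proof.
move=> uv; rewrite /term.
have [u0|u0] := posnP (size u).
  rewrite (size0nil u0) K0_nil mul0r; split; first by left.
  by split=> // -[eta []].
have [v0|v0] := posnP (size v).
  rewrite (size0nil v0) K0_nil mulr0; split; first by left.
  by split=> // -[eta []].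
have [su|su] := eqVneq (sig D a u) (-1); last first.
  rewrite K0_deg // mul0r; split; first by left.
  by split=> // -[eta [_ _ _ []]] /eqP; rewrite (negbTE su).
have sv : sig D (last a u) v = -1.
  by move: l_sig; rewrite -uv sig_cat su => /(canRL (addKr _)) ->.
have ue : uniq (a :: u) by move: l_uniq; rewrite -uv -cat_cons cat_uniq => /and3P[].
have ve : uniq (last a u :: v).
  have := l_uniq; rewrite -uv -cat_cons cat_uniq => /and3P[_ + vu].
  rewrite /= vu andbT; apply: contra => lv; apply/hasP; exists (last a u) => //.
  exact: mem_last.
have le : last (last a u) v = e by rewrite -uv last_cat.
have ev : e \in v.
  by rewrite -le; case: (v) v0 => //= x v' _; exact: mem_last.
have eu : e \notin a :: u.
  have := l_uniq; rewrite -{1}uv -cat_cons cat_uniq => /and3P[_ /hasPn/(_ _ ev) + _] //.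
have anl : a \notin l by case/andP: l_uniq.
have acv : a \notin last a u :: v.
  apply: contra anl; rewrite inE => /orP[/eqP ->|av]; rewrite -uv mem_cat.
    by case: (u) u0 => //= x u' _; rewrite mem_last.
  by rewrite av orbT.
have ae : a != e by apply: contraNneq eu => <-; exact: mem_head.
have ac : a != last a u by apply: contraNneq acv => {1}->; exact: mem_head.
have ec : e != last a u by apply: contraNneq eu => ->; exact: mem_last.
have ou : off (rk a e) (a :: u) by rewrite rkC; apply: rk_notin => //; rewrite eq_sym.
have ov : off (rk a e) (last a u :: v) by exact: rk_notin.
have [k [Kk ks kP]] := step_values_all ue u0 su ou.
have [k' [Kk' ks' kP']] := step_values_all ve v0 sv ov.
have near : `|P - (rk a e)%:R| <= 3^-1 by rewrite pE subrr normr0 invr_ge0.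
rewrite (Kk _ near) (Kk' _ near).
(* By the triangle of the lines of [a], [last a u] and [e], both halves are closed by the same
   condition with opposite directions, so the directions obtained for the two factors must be
   opposite. *)
have flip eta : is_sign eta -> closes t p eta (last a u) e P = closes t p (- eta) a (last a u) P.
  move=> seta; rewrite /closes; have := rk_tri ae ec ac.
  rewrite [p e _]pE [rk e _]rkC -pE -[t e - _]opprB mulNr sgrN => E.
  rewrite -sgr_gt0 -[RHS]sgr_gt0 !sgrM sgrN mulNr -mulrN -[Num.sg (t a - _) * _]sgrM -E opprK.
  by rewrite sgrM.
split.
  case: ks => [->|ks]; first by rewrite mul0r; left.
  exact: sign_mul.
have -> : k * k' <> 0 <-> k <> 0 /\ k' <> 0.
  split=> [H|[/eqP h1 /eqP h2]]; last by apply/eqP; rewrite mulf_neq0.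
  by split=> E; apply: H; rewrite E ?mul0r ?mulr0.
rewrite kP kP' le /walks -pE; split.
  move=> [[eta seta [w1 c1]] [eta' seta' [w2 c2]]]; exists eta; split=> //; split=> //.
  case: (is_sign_cases seta seta') => E; last by rewrite -E.
  move: c2; rewrite -E flip // /closes mulNr oppr_gt0 ltNge ltW //.
move=> [eta [seta _ _ [_ w1 w2 c1]]]; split; first by exists eta.
exists (- eta); last by rewrite flip ?opprK //; case: seta => ->; rewrite /is_sign ?opprK; auto.
by case: seta => ->; rewrite /is_sign ?opprK; auto.
Qed.

(** Between two such cuts there is no ascent, and a monotone walk passes an abscissa only once. *)
Lemma crosses_unique u v u' v' eta eta' : u ++ v = l -> u' ++ v' = l ->
  crosses u v eta -> crosses u' v' eta' -> (size u < size u')%N -> False.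
Proof.
move=> uv uv' [seta u0 v0 [su w1 w2 _]] [seta' u0' v0' [su' w1' _ _]] uu'.
have [r uE vE] : exists2 r, u' = u ++ r & v = r ++ v'.
  exists (take (size u' - size u) v).
    have := congr1 (take (size u')) uv; rewrite -uv' take_cat ltnNge (ltnW uu') /=.
    by rewrite take_size_cat.
  have := congr1 (drop (size u')) uv; rewrite -uv' drop_cat ltnNge (ltnW uu') /=.
  by rewrite drop_size_cat // => <-; rewrite cat_take_drop.
have r0 : (0 < size r)%N by move: uu'; rewrite uE size_cat -[ltnLHS]addn0 ltn_add2l.
have sr : sig D (last a u) r = 0 by move: su'; rewrite uE sig_cat su => /(canRL (addKr _)).
have EE : eta' = eta.
  case: (is_sign_cases seta seta') => // E.
  move: w1 w1'; rewrite uE E; case: (u) u0 => //= b u1 _ /andP[h _] /andP[].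
  by rewrite mulNr oppr_gt0 ltNge ltW.
case/lastP: r r0 uE vE sr => // r c _ uE vE sr.
have sr' : sig D (last a u) r = 0.
  move: sr; rewrite sig_rcons; have := sig_le0 t (last a u) r.
  by case: (_ < t c) => /=; lia.
rewrite vE in w2; have := chain_mono sr' (chain_prefix w2).
move: w1'; rewrite uE -rcons_cat chain_rcons rcons_cat -uE (sgl_sig1 su') EE last_cat.
move=> /andP[_]; rewrite mulrN1 !mulNr !oppr_gt0 -[P - _]opprB mulrN oppr_lt0 => h1 h2.
by have := lt_trans h1 h2; rewrite ltxx.
Qed.

(** [chain_cross0] finds an edge of the closed walk passing the abscissa [P]. It contributes only if
    it passes on the proper side of the starting vertex; the convexity condition in the last clause
    ensures this. *)
Lemma const_lt : t a < t e ->
  [/\ B a l = 0 \/ is_sign (B a l),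
      B a l <> 0 -> exists2 eta, is_sign eta & closed_walk eta a l &
      forall eta, is_sign eta -> closed_walk eta a l ->
        (forall u v, u ++ v = l -> (0 < size u)%N -> (0 < size v)%N ->
           0 < - (eta * sg a u) * ((t a - t (last a u)) * (P - p a (last a u)))) ->
        B a l <> 0].
Proof.
move=> tae; have BE := B_lt tae.
have uniqB u v eta : u ++ v = l -> crosses u v eta -> B a l = - term u v.
  move=> uv cr; rewrite BE; congr (- _).
  have := big_splitseq_unique (u := u) (v := v) (Phi := term); rewrite uv; apply.
  move=> u' v' uv' su.
  have [_ H] := term_cases uv'.
  have [//|/eqP/H[eta' cr']] := eqVneq (term u' v') 0.
  have [h|h|h] := ltngtP (size u') (size u); last by [].
    by case: (crosses_unique uv' uv cr' cr h).
  by case: (crosses_unique uv uv' cr cr' h).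
have signN k : is_sign k -> is_sign (- k) by move=> [] ->; rewrite /is_sign ?opprK; auto.
have [[u [v [eta [uv cr]]]]|none] :=
  pselect (exists u v eta, u ++ v = l /\ crosses u v eta); last first.
  have B0 : B a l = 0.
    rewrite BE (big_splitseq_eq0 (Phi := term)) ?oppr0 // => u v uv.
    have [_ H] := term_cases uv; have [//|/eqP/H[eta cr]] := eqVneq (term u v) 0.
    by case: none; exists u, v, eta.
  split; [by left|by rewrite B0|move=> eta seta cw cvx _].
  (* Equal ranks would force [u] and [v] to be empty, but a single edge cannot have two ascents. *)
  have np u b v : u ++ b :: v = l -> p (last a u) b != P.
    move=> uv; rewrite !pE eqr_nat; apply/eqP => E.
    have ul := l_uniq; rewrite -uv -cat_cons cat_uniq in ul.
    have /and3P[ua bu vu] := ul.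
    have bl : b \in l by rewrite -uv mem_cat mem_head orbT.
    have cb : last a u != b.
      apply: contraNneq bu => <-; apply/hasP; exists (last a u); rewrite ?mem_head //.
      exact: mem_last.
    have anl : a \notin l by case/andP: l_uniq.
    have ae : a != e.
      by apply: contraNneq anl => ->; rewrite -uv last_cat /= mem_cat mem_last orbT.
    case/orP: (rk_inj cb ae E) => /andP[/eqP c1 /eqP b1]; last by rewrite -b1 bl in anl.
    have u0 : u = [::].
      case: (lastP u) c1 uv => // u1 c; rewrite last_rcons => -> uv.
      by move: anl; rewrite -uv mem_cat mem_rcons mem_head.
    have v0 : v = [::].
      have bv : b = last b v by rewrite {1}b1 -uv last_cat.
      case: (lastP v) bv vu => // v1 c; rewrite last_rcons => ->.
      by rewrite cons_uniq mem_rcons mem_head.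
    by move: l_sig; rewrite -uv u0 v0 sig_cons /=; case: (t a < t b).
  have [|u [v [uv v0 su c1 c2]]] := chain_cross0 _ l_sig np seta cw.
    by rewrite subrr mulr0.
  have u0 : (0 < size u)%N by case: (u) su.
  have := cvx u v uv u0 v0; rewrite (sgl_sig1 su) mulrN1 opprK => cl.
  by case: none; exists u, v, eta.
have [ts tP] := term_cases uv; have BU := uniqB u v eta uv cr.
have tn0 : term u v <> 0 by apply/tP; exists eta.
split.
- by right; rewrite BU; apply: signN; case: ts.
- move=> _; exists eta; first by case: cr.
  case: cr => seta _ _ [su w1 w2 _]; rewrite /closed_walk -{2}uv.
  by apply: chain_cat w1 _; rewrite (sgl_sig1 su) mulrN1.
- by move=> *; rewrite BU => /eqP; rewrite oppr_eq0 => /eqP.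
Qed.

End Crossing.

End Values.

(** * Convex polygons and their area *)

Section Cyclic.

Lemma count2 (P : pred nat) m n : count P (iota m n) = 2 ->
  exists p q, [/\ (m <= p < q)%N, (q < m + n)%N, P p /\ P q &
    forall j, (m <= j < m + n)%N -> P j -> j = p \/ j = q].
Proof.
rewrite -size_filter; case E : (seq.filter P (iota m n)) => [|p [|q [|]]] // _.
have H j : (j \in [:: p; q]) = P j && (m <= j < m + n)%N by rewrite -E mem_filter mem_iota.
have := sorted_filter ltn_trans P (iota_ltn_sorted m n); rewrite E /= andbT => pq.
have := H p; have := H q; rewrite !inE !eqxx orbT => /esym/andP[Pq /andP[mq qn]] /esym/andP[Pp /andP[mp pn]].
exists p, q; split=> //; first by rewrite mp.
by move=> j jn Pj; have := H j; rewrite Pj jn !inE => /orP[/eqP|/eqP]; auto.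
Qed.

Lemma count_shift (P : pred nat) n i : (forall j, P (j + n)%N = P j) ->
  count P (iota i n) = count P (iota 0 n).
Proof.
move=> H; elim: i => // i <-; case: n H => // n H.
by rewrite -[n.+1 in LHS]addn1 iotaD count_cat /= addn0 addSnnS H addnC.
Qed.

Variable R : realType.
Implicit Types E : nat -> R.

Lemma steps_le E a b : (a <= b)%N -> (forall k, (a <= k < b)%N -> E k <= E k.+1) -> E a <= E b.
Proof.
move=> /subnKC <-; elim: (b - a)%N => [|m IH] H; first by rewrite addn0.
rewrite addnS; apply: le_trans (IH _) (H _ _).
  by move=> k /andP[ak km]; apply: H; rewrite ak addnS ltnS ltnW.
by rewrite leq_addr addnS ltnS leqnn.
Qed.

Lemma steps_ge E a b : (a <= b)%N -> (forall k, (a <= k < b)%N -> E k.+1 <= E k) -> E b <= E a.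
Proof.
move=> ab H; rewrite -lerN2; apply: (@steps_le (fun k => - E k)) => // k /H.
by rewrite lerN2.
Qed.

Variables (n : nat) (X Y T : nat -> R).
Hypothesis n0 : (0 < n)%N.
Hypothesis X_per : forall i, X (i + n)%N = X i.
Hypothesis Y_per : forall i, Y (i + n)%N = Y i.
Hypothesis T_per : forall i, T (i + n)%N = T i.
Hypothesis edge : forall i, Y i.+1 - Y i = T i * (X i.+1 - X i).
Local Notation dx i := (X i.+1 - X i).

(* The product is minus the cross product of the edges [i] and [i.+1]. *)
Definition right_turns := forall i, 0 < dx i * dx i.+1 * (T i - T i.+1).
Hypothesis RT : right_turns.

Lemma dx_neq0 i : dx i != 0.
Proof. by have := RT i; apply: contraTneq => ->; rewrite !mul0r ltxx. Qed.

(** With [asc_flip]: at a right turn the horizontal direction is reversed exactly where the slope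
    increases. *)
Lemma no_asc i : ~~ (T i < T i.+1) -> T i.+1 < T i /\ 0 < dx i * dx i.+1.
Proof.
have := RT i; rewrite -leNgt le_eqVlt => h /orP[/eqP E|E].
  by rewrite E subrr mulr0 ltxx in h.
by split=> //; move: h; rewrite pmulr_lgt0 // subr_gt0.
Qed.

Lemma asc_flip i : T i < T i.+1 -> dx i * dx i.+1 < 0.
Proof. by move=> h; have := RT i; rewrite nmulr_lgt0 // subr_lt0. Qed.

Lemma sign_trans (x y z : R) : 0 < x * y -> 0 < y * z -> 0 < x * z.
Proof.
move=> xy yz; have y0 : y != 0 by apply: contraTneq xy => ->; rewrite mulr0 ltxx.
have : 0 < (x * y) * (y * z) by rewrite mulr_gt0.
have -> : x * y * (y * z) = y ^+ 2 * (x * z) by ring.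
by rewrite pmulr_rgt0 // exprn_even_gt0.
Qed.

Lemma sign_transN (x y z : R) : 0 < x * y -> y * z < 0 -> x * z < 0.
Proof.
move=> xy yz; have : 0 < x * - z by apply: sign_trans xy _; rewrite mulrN oppr_gt0.
by rewrite mulrN oppr_gt0.
Qed.

(* A stretch without ascents is traversed in one direction, with decreasing
   slopes. *)
Lemma stretch i m : (forall j, (i <= j < i + m)%N -> ~~ (T j < T j.+1)) ->
  T (i + m)%N <= T i /\ 0 < dx i * dx (i + m)%N.
Proof.
elim: m => [|m IH] H.
  by rewrite addn0 lexx -expr2 exprn_even_gt0 //= dx_neq0.
have [|h1 h2] := IH; first by move=> j /andP[ij jm]; apply: H; rewrite ij addnS ltnS ltnW.
have [|h3 h4] := @no_asc (i + m)%N; first by apply: H; rewrite leq_addr addnS ltnS leqnn.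
by rewrite addnS; split; [exact: le_trans (ltW h3) h1|exact: sign_trans h2 h4].
Qed.

Lemma stretchW i j k : (i <= j <= k)%N -> (forall j, (i <= j < k)%N -> ~~ (T j < T j.+1)) ->
  T k <= T j /\ 0 < dx j * dx k.
Proof.
move=> /andP[ij jk] H; have := @stretch j (k - j); rewrite subnKC //; apply.
by move=> l /andP[jl lk]; apply: H; rewrite lk (leq_trans ij jl).
Qed.

Hypothesis two_asc : count (fun i => T i < T i.+1) (iota 0 n) = 2.

Lemma asc_window i : exists p q, [/\ (i <= p < q)%N, (q < i + n)%N, T p < T p.+1 /\ T q < T q.+1 &
    forall j, (i <= j < i + n)%N -> T j < T j.+1 -> j = p \/ j = q].
Proof.
apply: (count2 (P := fun i => T i < T i.+1)); rewrite -{}two_asc; apply: count_shift => j.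
by rewrite -addSn !T_per.
Qed.

(** [E k] is the signed height of vertex [k] over the line of edge [i]. The two ascents divide the
    period into three stretches: [E] descends from 0 on the first and climbs back to 0 on the last.
    On the middle one, traversed backwards with decreasing slopes, it descends and then climbs, so
    it is bounded by its values at the ends. *)
Lemma globally_convex i j : (i <= j <= i + n)%N -> dx i * (Y j - Y i - T i * (X j - X i)) <= 0.
Proof.
move=> /andP[ij jn].
have [p [q [/andP[ip pq] qn [Tp Tq] only]]] := asc_window i.
pose E k := dx i * (Y k - Y i - T i * (X k - X i)).
rewrite -/(E j).
have Ei : E i = 0 by rewrite /E !subrr mulr0 subrr mulr0.
have En : E (i + n)%N = 0 by rewrite /E X_per Y_per !subrr mulr0 subrr mulr0.
have dE k : E k.+1 - E k = (T k - T i) * (dx i * dx k).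
  have ek : Y k.+1 = Y k + T k * dx k by rewrite -edge addrC subrK.
  by rewrite /E ek; ring.
have up k : T k <= T i -> 0 < dx i * dx k -> E k.+1 <= E k.
  by move=> h1 h2; rewrite -subr_le0 dE mulr_le0_ge0 //; [rewrite subr_le0|exact: ltW].
have up' k : T i <= T k -> 0 < dx i * dx k -> E k <= E k.+1.
  by move=> h1 h2; rewrite -subr_ge0 dE mulr_ge0 //; [rewrite subr_ge0|exact: ltW].
have dn k : T i <= T k -> dx i * dx k < 0 -> E k.+1 <= E k.
  by move=> h1 h2; rewrite -subr_le0 dE mulr_ge0_le0 //; [rewrite subr_ge0|exact: ltW].
have dn' k : T k <= T i -> dx i * dx k < 0 -> E k <= E k.+1.
  by move=> h1 h2; rewrite -subr_ge0 dE mulr_le0 //; [rewrite subr_le0|exact: ltW].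
have na k : (i <= k < i + n)%N -> k != p -> k != q -> ~~ (T k < T k.+1).
  by move=> ki kp kq; apply/negP => /(only _ ki)[] E'; [rewrite E' eqxx in kp|rewrite E' eqxx in kq].
have ph1 k : (i <= k <= p)%N -> T k <= T i /\ 0 < dx i * dx k.
  move=> /andP[ik kp]; apply: (@stretchW i i k); first by rewrite leqnn.
  by move=> l /andP[il lk]; apply: na; rewrite ?il /=; lia.
have ph3 k : (q < k <= i + n)%N -> T i <= T k /\ 0 < dx i * dx k.
  move=> /andP[qk kn]; have := @stretchW q.+1 k (i + n)%N.
  rewrite qk kn -addSn X_per X_per T_per mulrC; apply=> //.
  by move=> l /andP[ql ln]; apply: na; lia.
have dxpq : dx i * dx p.+1 < 0.
  have [|_ h] := ph1 p; first by rewrite ip leqnn.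
  exact: sign_transN h (asc_flip Tp).
have ph2 k : (p < k <= q)%N -> dx i * dx k < 0.
  move=> /andP[pk kq]; have [||_ h] := @stretchW p.+1 p.+1 k.
  - by rewrite leqnn.
  - by move=> l /andP[pl lk]; apply: na; lia.
  - by rewrite mulrC; apply: (@sign_transN _ (dx p.+1)); rewrite 1?mulrC // [dx k * _]mulrC.
have Tph2 k l : (p < k <= l)%N -> (l <= q)%N -> T l <= T k.
  move=> /andP[pk kl] lq; have [||//] := @stretchW p.+1 k l.
  - by rewrite pk.
  - by move=> r /andP[pr rl]; apply: na; lia.
have EP k : (i <= k <= p.+1)%N -> E k <= 0.
  move=> /andP[ik kp]; rewrite -Ei; apply: steps_ge => // l /andP[il lk].
  by have [|h1 h2] := ph1 l; [lia|exact: up].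
have EQ k : (q < k <= i + n)%N -> E k <= 0.
  move=> /andP[qk kn]; rewrite -En; apply: steps_le => // l /andP[kl ln].
  by have [|h1 h2] := ph3 l; [lia|exact: up'].
have [jp|pj] := leqP j p.+1; first by apply: EP; rewrite ij.
have [jq|qj] := leqP j q; last by apply: EQ; rewrite qj.
(* The slope before [j] decides whether [j] lies in the descending or the climbing part of the
   middle stretch. *)
have [h|h] := leP (T i) (T j.-1).
  apply: le_trans (EP p.+1 _); last by lia.
  apply: steps_ge; first exact: ltnW.
  move=> k /andP[pk kj]; apply: dn; last by apply: ph2; lia.
  by apply: le_trans h _; apply: Tph2; lia.
apply: le_trans (EQ q.+1 _); last by lia.
apply: steps_le; first exact: ltnW.
move=> k /andP[jk kq]; apply: dn'; last by apply: ph2; lia.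
by apply: le_trans (ltW h); apply: Tph2; lia.
Qed.

(* The boundary consists of an upper part traversed to the right and a lower
   part traversed to the left. *)
Lemma two_parts : exists i p, [/\ (i <= p)%N, (p.+1 < i + n)%N,
  forall j, (i <= j <= p)%N -> 0 < dx j & forall j, (p < j < i + n)%N -> dx j < 0].
Proof.
have [p0 [q0 [_ _ [Tp0 _] _]]] := asc_window 0.
have key i : T i < T i.+1 -> 0 < dx i.+1 -> exists p, [/\ (i.+1 <= p)%N, (p.+1 < i.+1 + n)%N,
  forall j, (i.+1 <= j <= p)%N -> 0 < dx j & forall j, (p < j < i.+1 + n)%N -> dx j < 0].
  move=> Ti dxi; have [p [q [/andP[ip pq] qn [Tp Tq] only]]] := asc_window i.+1.
  (* [i] is itself an ascent, so its translate by the period is the last ascent of the window. *)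
  have qE : q = (i + n)%N.
    have [||E|//] := only (i + n)%N; first lia.
      by rewrite -addSn !T_per.
    by move: ip pq qn; rewrite -E; lia.
  have na k : (i.+1 <= k < i.+1 + n)%N -> k != p -> k != q -> ~~ (T k < T k.+1).
    by move=> ki kp kq; apply/negP => /(only _ ki)[] E'; [rewrite E' eqxx in kp|rewrite E' eqxx in kq].
  have ph1 k : (i.+1 <= k <= p)%N -> 0 < dx k.
    move=> /andP[ik kp]; have [||_] := @stretchW i.+1 i.+1 k.
    - by rewrite leqnn.
    - by move=> l /andP[il lk]; apply: na; lia.
    - by rewrite pmulr_rgt0.
  have dp : 0 < dx p by apply: ph1; lia.
  have dp1 : dx p.+1 < 0 by have := asc_flip Tp; rewrite pmulr_rlt0.
  exists p; split=> //; first by lia.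
  move=> k /andP[pk kn]; have [||_] := @stretchW p.+1 p.+1 k.
  - by rewrite leqnn.
  - by move=> l /andP[il lk]; apply: na; lia.
  - by rewrite nmulr_rgt0.
have [d|d|d] := ltgtP 0 (dx p0.+1); last by have := dx_neq0 p0.+1; rewrite -d eqxx.
  by have [p Hp] := key p0 Tp0 d; exists p0.+1, p.
(* Otherwise the edges after [p0] lead to the left, and those after the next ascent to the right. *)
have [p [q [/andP[ip pq] qn [Tp Tq] only]]] := asc_window p0.+1.
have na k : (p0.+1 <= k < p)%N -> ~~ (T k < T k.+1).
  by move=> ki; apply/negP => Tk; have [||] := only k _ Tk; lia.
have dp : dx p < 0.
  have [||_] := @stretchW p0.+1 p0.+1 p.
  - by rewrite leqnn.
  - exact: na.
  by rewrite nmulr_rgt0.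
have dp1 : 0 < dx p.+1 by have := asc_flip Tp; rewrite nmulr_rlt0.
by have [p' Hp] := key p Tp dp1; exists p.+1, p'.
Qed.

End Cyclic.

(** * Integrals of piecewise polynomial functions *)

Section Pieces.
Variable R : realType.
Implicit Types (p q : {poly R}) (a b x : R).
Local Notation mu := (@lebesgue_measure R).

(** Half-open, so that consecutive pieces do not overlap and each abscissa lies in one of them. *)
Definition piece p a b x : R := if a <= x < b then p.[x] else 0.

Lemma piece_patch p a b :
  EFin \o piece p a b = (EFin \o (fun x => p.[x])) \_ `[a, b[.
Proof.
apply/funext => x; rewrite /piece/= patchE.
by rewrite mem_setE in_itv /=; case: ifP.
Qed.

Lemma itv_integrable_poly p a b : mu.-integrable `[a, b[ (EFin \o (fun x => p.[x])).
Proof.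
have : mu.-integrable `[a, b] (EFin \o (fun x => p.[x])).
  apply: continuous_compact_integrable; first exact: segment_compact.
  by apply: continuous_subspaceT => x; exact: continuous_horner.
by apply: integrableS => //; apply: subset_itvl; rewrite bnd_simp.
Qed.

Lemma piece_integrable p a b : mu.-integrable setT (EFin \o piece p a b).
Proof. by rewrite piece_patch -integrable_mkcond //; exact: itv_integrable_poly. Qed.

Lemma integral_piece p q a b : q^`()%R = p ->
  (\int[mu]_x (piece p a b x)%:E = (if a < b then q.[b] - q.[a] else 0)%:E)%E.
Proof.
move=> qp.
transitivity (\int[mu]_(x in `[a, b[) (p.[x])%:E)%E.
  rewrite [RHS]integral_mkcond; apply: eq_integral => x _.
  by rewrite -[LHS]/((EFin \o piece p a b) x) piece_patch.
case: ltP => ab; last first.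
  by rewrite set_itv_ge ?integral_set0 // bnd_simp -leNgt.
rewrite integral_itv_bndo_bndc; last exact: measurable_int (itv_integrable_poly p a b).
rewrite (@continuous_FTC2 _ _ (fun x => q.[x])) //.
- by apply: continuous_subspaceT => x; exact: continuous_horner.
- split.
  + by move=> x _; have [] := is_derive_poly q x.
  + by apply: cvg_at_right_filter; exact: continuous_horner.
  + by apply: cvg_at_left_filter; exact: continuous_horner.
- by move=> x _; rewrite derive1E; have [_ ->] := is_derive_poly q x; rewrite qp.
Qed.

(* The integrand of [\int_a^b p] for [a] and [b] in any order. *)
Definition oriented_piece p a b x : R := piece p a b x - piece p b a x.

Lemma oriented_piece_integrable p a b : mu.-integrable setT (EFin \o oriented_piece p a b).
Proof.
by have := @integrableB _ _ _ _ _ measurableT _ _ (piece_integrable p a b) (piece_integrable p b a).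
Qed.

Lemma integral_oriented_piece p q a b : q^`()%R = p ->
  (\int[mu]_x (oriented_piece p a b x)%:E = (q.[b] - q.[a])%:E)%E.
Proof.
move=> qp; rewrite integralB_EFin //; try exact: piece_integrable.
rewrite !(@integral_piece p q) // -EFinB; congr EFin.
case: (ltgtP a b) => [_|_|->]; rewrite ?subrr //; ring.
Qed.

Lemma piece_cover (E : nat -> R) m n x : E m <= x < E n -> (m <= n)%N ->
  exists2 k, (m <= k < n)%N & E k <= x < E k.+1.
Proof.
move=> H /subnKC mn; move: H; rewrite -{}mn; elim: (n - m)%N => [|d IH].
  by rewrite addn0 => /andP[h1 h2]; have := le_lt_trans h1 h2; rewrite ltxx.
move=> /andP[h1 h2]; have [h|h] := leP (E (m + d)%N) x.
  by exists (m + d)%N; [rewrite leq_addr addnS ltnS leqnn|rewrite h -addnS].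
have [|k /andP[mk kd] Hk] := IH; first by rewrite h1.
by exists k => //; rewrite mk addnS ltnS ltnW.
Qed.

Lemma piece_cover_rev (E : nat -> R) m n x : E n <= x < E m -> (m <= n)%N ->
  exists2 k, (m <= k < n)%N & E k.+1 <= x < E k.
Proof.
move=> H /subnKC mn; move: H; rewrite -{}mn; elim: (n - m)%N => [|d IH].
  by rewrite addn0 => /andP[h1 h2]; have := le_lt_trans h1 h2; rewrite ltxx.
move=> /andP[h1 h2]; have [h|h] := leP (E (m + d)%N) x.
  have [|k /andP[mk kd] Hk] := IH; first by rewrite h.
  by exists k => //; rewrite mk addnS ltnS ltnW.
by exists (m + d)%N; [rewrite leq_addr addnS ltnS leqnn|rewrite -addnS h1].
Qed.

Lemma sum_pieces (E : nat -> R) (p : nat -> {poly R}) m n k x :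
  (forall j, (m <= j < n)%N -> E j < E j.+1) -> (m <= k < n)%N -> E k <= x < E k.+1 ->
  \sum_(m <= j < n) oriented_piece (p j) (E j) (E j.+1) x = (p k).[x].
Proof.
move=> mono /andP[mk kn] /andP[h1 h2].
have le i j : (m <= i <= j)%N -> (j <= n)%N -> E i <= E j.
  move=> /andP[mi ij] jn; apply: steps_le => // l /andP[il lj]; apply/ltW/mono; lia.
rewrite (bigD1_seq k) ?mem_index_iota ?mk ?iota_uniq //= big1_seq ?addr0.
  rewrite /oriented_piece /piece h1 h2 /= ifF ?subr0 //.
  by apply/negP => /andP[h3 h4]; have := le_lt_trans h1 h4; rewrite ltxx.
move=> j /andP[jk]; rewrite mem_index_iota => /andP[mj jn].
rewrite /oriented_piece /piece !ifF ?subr0 //; apply/negP => /andP[h3 h4].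
  have h5 : E j < E j.+1 by apply: mono; rewrite mj.
  have := lt_trans (lt_le_trans h5 h3) h4; by rewrite ltxx.
have [lt|ge] := ltnP j k.
  have h : E j.+1 <= E k by apply: le; lia.
  by have := lt_le_trans h4 (le_trans h h1); rewrite ltxx.
have h : E k.+1 <= E j by apply: le; lia.
by have := lt_le_trans h2 (le_trans h h3); rewrite ltxx.
Qed.

Lemma sum_pieces_rev (E : nat -> R) (p : nat -> {poly R}) m n k x :
  (forall j, (m <= j < n)%N -> E j.+1 < E j) -> (m <= k < n)%N -> E k.+1 <= x < E k ->
  \sum_(m <= j < n) oriented_piece (p j) (E j) (E j.+1) x = - (p k).[x].
Proof.
move=> mono /andP[mk kn] /andP[h1 h2].
have le i j : (m <= i <= j)%N -> (j <= n)%N -> E j <= E i.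
  move=> /andP[mi ij] jn; apply: steps_ge => // l /andP[il lj]; apply/ltW/mono; lia.
rewrite (bigD1_seq k) ?mem_index_iota ?mk ?iota_uniq //= big1_seq ?addr0.
  rewrite /oriented_piece /piece h1 h2 /= ifF ?sub0r //.
  by apply/negP => /andP[h3 h4]; have := le_lt_trans h1 h4; rewrite ltxx.
move=> j /andP[jk]; rewrite mem_index_iota => /andP[mj jn].
rewrite /oriented_piece /piece !ifF ?subr0 //; apply/negP => /andP[h3 h4].
  have [lt|ge] := ltnP j k.
    have h : E k <= E j.+1 by apply: le; lia.
    by have := lt_le_trans h2 (le_trans h h3); rewrite ltxx.
  have h : E j <= E k.+1 by apply: le; lia.
  by have := lt_le_trans h4 (le_trans h h1); rewrite ltxx.
have h5 : E j.+1 < E j by apply: mono; rewrite mj.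
have := lt_trans (lt_le_trans h5 h3) h4; by rewrite ltxx.
Qed.

Lemma sum_pieces_out (E : nat -> R) (p : nat -> {poly R}) m n x :
  (forall j, (m <= j < n)%N -> (x < E j /\ x < E j.+1) \/ (E j <= x /\ E j.+1 <= x)) ->
  \sum_(m <= j < n) oriented_piece (p j) (E j) (E j.+1) x = 0.
Proof.
move=> H; rewrite big_nat big1 // => j /H[[h1 h2]|[h1 h2]];
  rewrite /oriented_piece /piece; first by rewrite !leNgt h1 h2 subr0.
by rewrite !ltNge h1 h2 !andbF subr0.
Qed.

End Pieces.

Section ConvexHull.
Variable R : realType.
Implicit Types (ps : seq (R * R)) (z : R * R).

Lemma convex_hull_vertex ps i : (0 < size ps)%N -> convex_hull ps (vertex ps i).
Proof.
move=> n0; have Hi : (i %% size ps < size ps)%N by rewrite ltn_mod.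
pose k := Ordinal Hi.
have vk : vertex ps k = vertex ps i by rewrite /vertex modn_mod.
have S (g : nat -> R) : \sum_(j < size ps) (nat_of_ord j == i %% size ps)%N%:R * g j = g k.
  rewrite (bigD1 k) //= eqxx mul1r big1 ?addr0 // => j /negPf jk.
  by rewrite -[(nat_of_ord j == _)]/(j == k) jk mul0r.
exists (fun j => (j == i %% size ps)%N%:R); split=> [j||//|//].
- exact: ler0n.
- by have := S (fun=> 1); under eq_bigr do rewrite mulr1.
- by rewrite (S (fun j => (vertex ps j).1)) vk.
- by rewrite (S (fun j => (vertex ps j).2)) vk.
Qed.

Lemma convex_hull_convex ps z1 z2 z (la : R) : 0 <= la <= 1 ->
  convex_hull ps z1 -> convex_hull ps z2 ->
  z = ((1 - la) * z1.1 + la * z2.1, (1 - la) * z1.2 + la * z2.2) -> convex_hull ps z.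
Proof.
move=> /andP[l0 l1] [w1 [w1p w1s w11 w12]] [w2 [w2p w2s w21 w22]] ->.
exists (fun i => (1 - la) * w1 i + la * w2 i); split=> /=.
- by move=> i; rewrite addr_ge0 // mulr_ge0 // subr_ge0.
- by rewrite big_split /= -!mulr_sumr w1s w2s !mulr1 subrK.
- rewrite w11 w21 !mulr_sumr -big_split; apply: eq_bigr => i _ /=; ring.
- rewrite w12 w22 !mulr_sumr -big_split; apply: eq_bigr => i _ /=; ring.
Qed.

Lemma convex_hull_halfplane ps (a b c : R) z :
  (forall i, a * (vertex ps i).1 + b * (vertex ps i).2 + c <= 0) ->
  convex_hull ps z -> a * z.1 + b * z.2 + c <= 0.
Proof.
move=> H [w [wp ws -> ->]].
rewrite -[c]mulr1 -ws !mulr_sumr -!big_split /= sumr_le0 // => i _.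
have -> : a * (w i * (vertex ps i).1) + b * (w i * (vertex ps i).2) + c * w i =
  w i * (a * (vertex ps i).1 + b * (vertex ps i).2 + c) by ring.
by rewrite mulr_ge0_le0.
Qed.

End ConvexHull.

Section Area.
Variables (R : realType) (n : nat) (X Y T S : nat -> R) (F : nat -> {poly R}).
Hypothesis n0 : (0 < n)%N.
Hypothesis X_per : forall i, X (i + n)%N = X i.
Hypothesis Y_per : forall i, Y (i + n)%N = Y i.
Hypothesis T_per : forall i, T (i + n)%N = T i.
Hypothesis F_per : forall i, F (i + n)%N = F i.
Hypothesis Y_lo : forall i, Y i = T i * X i + S i.
Hypothesis Y_hi : forall i, Y i.+1 = T i * X i.+1 + S i.
Hypothesis F_deriv : forall i, (F i)^`()%R = T i *: 'X + (S i)%:P.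
Hypothesis RT : right_turns X T.
Hypothesis two_asc : count (fun i => T i < T i.+1) (iota 0 n) = 2.
Variable ps : seq (R * R).
Hypothesis ps_size : size ps = n.
Hypothesis ps_vertex : forall i, vertex ps i = (X i, Y i).
Local Notation dx i := (X i.+1 - X i).
Local Notation mu := (@lebesgue_measure R).

Lemma boundary_edge i : Y i.+1 - Y i = T i * (X i.+1 - X i).
Proof. by rewrite Y_hi Y_lo; ring. Qed.

Lemma window_representative i j :
  exists2 j', (i <= j' <= i + n)%N & X j = X j' /\ Y j = Y j'.
Proof.
(* Adding [i * n] first keeps the truncated subtraction exact. *)
pose j' := (i + (j + i * n - i) %% n)%N.
have jE m k : (X (k + m * n)%N = X k) * (Y (k + m * n)%N = Y k).
  by elim: m => [|m [IH1 IH2]]; rewrite ?addn0 // mulSnr addnA X_per Y_per.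
have jj : (j' + (j + i * n - i) %/ n * n = j + i * n)%N.
  rewrite /j' -addnA [X in (_ + X)%N]addnC -divn_eq subnKC //.
  by rewrite (leq_trans _ (leq_addl _ _)) // leq_pmulr.
exists j'; first by rewrite leq_addr leq_add2l ltnW ?ltn_mod.
by rewrite -2!(jE i j) -jj !jE.
Qed.

Lemma globally_convex_mod i j : dx i * (Y j - (T i * X j + S i)) <= 0.
Proof.
have [j' jn [-> ->]] := window_representative i j.
have := globally_convex n0 X_per Y_per T_per boundary_edge RT two_asc jn.
by rewrite [Y i]Y_lo; congr (_ <= _); ring.
Qed.

Lemma hull_halfplane i z : convex_hull ps z -> dx i * (z.2 - (T i * z.1 + S i)) <= 0.
Proof.
have H j : - (dx i * T i) * (vertex ps j).1 + dx i * (vertex ps j).2 + - (dx i * S i) <= 0.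
  rewrite ps_vertex; have := globally_convex_mod i j.
  by congr (_ <= _) => /=; ring.
by move=> /(convex_hull_halfplane H); congr (_ <= _); ring.
Qed.

Lemma hull_edge_point i x : X i <= x <= X i.+1 \/ X i.+1 <= x <= X i -> X i != X i.+1 ->
  convex_hull ps (x, T i * x + S i).
Proof.
move=> H ne; have d0 : X i.+1 - X i != 0 by rewrite subr_eq0 eq_sym.
pose la := (x - X i) / (X i.+1 - X i).
have laE : la * (X i.+1 - X i) = x - X i by rewrite /la divfK.
apply: (@convex_hull_convex _ ps (vertex ps i) (vertex ps i.+1) _ la).
- have laE' : (1 - la) * (X i.+1 - X i) = X i.+1 - x by rewrite mulrBl laE mul1r; ring.
  rewrite -[la <= 1]subr_ge0; case: H => /andP[h1 h2].
    have dp : 0 < X i.+1 - X i by rewrite lt_def d0 subr_ge0 (le_trans h1).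
    by rewrite -(pmulr_lge0 la dp) -(pmulr_lge0 (1 - la) dp) laE laE' !subr_ge0 h1.
  have dp : X i.+1 - X i < 0 by rewrite lt_def eq_sym d0 subr_le0 (le_trans h1).
  by rewrite -(nmulr_lle0 la dp) -(nmulr_lle0 (1 - la) dp) laE laE' !subr_le0 h1 h2.
- by apply: convex_hull_vertex; rewrite ps_size.
- by apply: convex_hull_vertex; rewrite ps_size.
rewrite !ps_vertex /=; congr pair.
  have -> : (1 - la) * X i + la * X i.+1 = X i + la * (X i.+1 - X i) by ring.
  by rewrite laE; ring.
rewrite Y_lo Y_hi.
have -> : (1 - la) * (T i * X i + S i) + la * (T i * X i.+1 + S i) =
   T i * (X i + la * (X i.+1 - X i)) + S i by ring.
by rewrite laE; ring.
Qed.

Lemma sum_window (g : nat -> R) i : (forall j, g (j + n)%N = g j) ->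
  \sum_(i <= j < i + n) g j = \sum_(j < n) g j.
Proof.
move=> gp; elim: i => [|i IH]; first by rewrite add0n big_mkord.
rewrite -{}IH addSn; case: n n0 gp => // m _ gp.
have im : (i < i + m.+1)%N by rewrite addnS ltnS leq_addr.
by rewrite [RHS]big_ltn // big_nat_recr //= addrC gp.
Qed.

(** By integration over vertical sections: the section at [x] is the interval between a lower and an
    upper edge, and the oriented pieces sum to its length, since the lower edges are traversed
    backwards. The integral of each piece is a difference of values of the primitive [F j]. *)
Lemma hull_area : area ps = \sum_(j < n) ((F j).[X j.+1] - (F j).[X j]).
Proof.
have [i [p [ip pn up dn]]] := two_parts n0 T_per RT two_asc.
have ltE j : (X j < X j.+1) = (0 < dx j) by rewrite subr_gt0.
have gtE j : (X j.+1 < X j) = (dx j < 0) by rewrite subr_lt0.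
have up1 j : (i <= j < p.+1)%N -> X j < X j.+1 by move=> h; rewrite ltE up.
have dn1 j : (p.+1 <= j < i + n)%N -> X j.+1 < X j by move=> h; rewrite gtE dn.
pose D j : {poly R} := 'X * (T j)%:P + (S j)%:P.
pose sect x := \sum_(i <= j < i + n) oriented_piece (D j) (X j) (X j.+1) x.
have DE j x : (D j).[x] = T j * x + S j by rewrite /D !hornerE mulrC.
have Xmin j : (i <= j <= i + n)%N -> X i <= X j.
  move=> /andP[ij jn]; have [jp|pj] := leqP j p.+1.
    by apply: steps_le => // l /andP[il lj]; apply/ltW/up1; lia.
  rewrite -(X_per i); apply: steps_ge => // l /andP[jl ln]; apply/ltW/dn1; lia.
have Xmax j : (i <= j <= i + n)%N -> X j <= X p.+1.
  move=> /andP[ij jn]; have [jp|pj] := leqP j p.+1.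
    by apply: steps_le => // l /andP[il lj]; apply/ltW/up1; lia.
  apply: steps_ge; first exact: ltnW.
  by move=> l /andP[jl ln]; apply/ltW/dn1; lia.
have Hx z : convex_hull ps z -> X i <= z.1 <= X p.+1.
  move=> zH; apply/andP; split.
    have := @convex_hull_halfplane _ ps (-1) 0 (X i) z _ zH.
    rewrite mulN1r mul0r addr0 addrC subr_le0; apply=> j.
    have [j' jn [Xj _]] := window_representative i j.
    by rewrite ps_vertex /= mulN1r mul0r addr0 addrC subr_le0 Xj; exact: Xmin.
  have := @convex_hull_halfplane _ ps 1 0 (- X p.+1) z _ zH.
  rewrite mul1r mul0r addr0 subr_le0; apply=> j.
  have [j' jn [Xj _]] := window_representative i j.
  by rewrite ps_vertex /= mul1r mul0r addr0 subr_le0 Xj; exact: Xmax.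
have sectE x : mu (xsection (convex_hull ps) x) = (sect x)%:E.
  have [xi|xi] := ltP x (X i).
    have outU : sect x = 0.
      apply: sum_pieces_out => j /andP[ij jn]; left.
      by split; apply: (lt_le_trans xi); apply: Xmin; rewrite ?(leq_trans ij) // ltnW.
    rewrite outU (_ : xsection _ _ = set0) ?measure0 //; apply/seteqP; split=> // y.
    rewrite /xsection /= inE => /Hx/andP[h _].
    by have := lt_le_trans xi h; rewrite ltxx.
  have [xp|xp] := leP (X p.+1) x.
    have outU : sect x = 0.
      apply: sum_pieces_out => j /andP[ij jn]; right.
      by split; apply: (le_trans _ xp); apply: Xmax; rewrite ?(leq_trans ij) // ltnW.
    (* The half-open pieces omit the largest abscissa, where the section is one point and has
       measure zero. *)
    have sub : xsection (convex_hull ps) x = (if x == X p.+1 then [set Y p.+1] else set0).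
      case: eqP => [->|ne]; apply/seteqP; split=> y; rewrite /xsection /= inE.
      - move=> zH; have := hull_halfplane p zH; rewrite /= -Y_hi pmulr_rle0 ?up ?ip ?leqnn //.
        rewrite subr_le0 => y1; have := hull_halfplane p.+1 zH; rewrite /= -Y_lo.
        rewrite nmulr_rle0 ?dn ?ltnSn // subr_ge0 => y2.
        by apply/eqP; rewrite eq_le y1.
      - by move=> ->; rewrite -ps_vertex; apply: convex_hull_vertex; rewrite ps_size.
      - by move=> /Hx/andP[_ /= h]; apply: ne; apply/eqP; rewrite eq_le h.
      - by [].
    by rewrite outU sub; case: eqP => _; rewrite ?lebesgue_measure_set1 ?measure0.
  have [k1 k1r k1x] := piece_cover (E := X) (introT andP (conj xi xp)) (leqW ip).
  have pin : (p.+1 <= i + n)%N by exact: ltnW.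
  have [k2 k2r k2x] : exists2 k, (p.+1 <= k < i + n)%N & X k.+1 <= x < X k.
    by apply: piece_cover_rev => //; rewrite X_per xi.
  have -> : sect x = T k1 * x + S k1 - (T k2 * x + S k2).
    rewrite /sect (@big_cat_nat _ _ _ p.+1) //=; last exact: leqW.
    by rewrite (sum_pieces _ up1 k1r k1x) (sum_pieces_rev _ dn1 k2r k2x) !DE.
  have /andP[k2l k2h] := k2x; have /andP[k1l k1h] := k1x.
  have secE : xsection (convex_hull ps) x = `[T k2 * x + S k2, T k1 * x + S k1]%classic.
    apply/seteqP; split=> y; rewrite /xsection /= inE in_itv /=.
      move=> zH; have := hull_halfplane k1 zH; have := hull_halfplane k2 zH.
      rewrite nmulr_rle0 ?dn // subr_ge0 pmulr_rle0 ?up // subr_le0 /= => h1 h2.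
      by rewrite h1.
    move=> /andP[yl yh].
    have H1 : convex_hull ps (x, T k1 * x + S k1).
      by apply: hull_edge_point; [left; rewrite k1l ltW|rewrite lt_eqF ?up1].
    have H2 : convex_hull ps (x, T k2 * x + S k2).
      by apply: hull_edge_point; [right; rewrite k2l ltW|rewrite gt_eqF ?dn1].
    have [E|E] := eqVneq (T k2 * x + S k2) (T k1 * x + S k1).
      suff -> : y = T k1 * x + S k1 by [].
      by apply/eqP; rewrite eq_le yh -E.
    have d0 : T k1 * x + S k1 - (T k2 * x + S k2) != 0 by rewrite subr_eq0 eq_sym.
    have dp : 0 < T k1 * x + S k1 - (T k2 * x + S k2).
      by rewrite lt_def d0 subr_ge0 (le_trans yl).
    pose la := (y - (T k2 * x + S k2)) / (T k1 * x + S k1 - (T k2 * x + S k2)).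
    apply: (@convex_hull_convex _ ps _ _ _ la _ H2 H1).
      rewrite /la ler_pdivrMr // mul1r lerD2r yh andbT.
      by rewrite divr_ge0 //; [rewrite subr_ge0|exact: ltW].
    congr pair => /=; first by ring.
    have -> : (1 - la) * (T k2 * x + S k2) + la * (T k1 * x + S k1) =
      la * (T k1 * x + S k1 - (T k2 * x + S k2)) + (T k2 * x + S k2) by ring.
    by rewrite /la divfK // subrK.
  (* The section contains its upper end point, so a nonpositive length can only be 0. *)
  rewrite secE lebesgue_measure_itv /= lte_fin; case: ltP => // h.
  have zH : xsection (convex_hull ps) x (T k1 * x + S k1).
    rewrite /xsection /= inE.
    by apply: hull_edge_point; [left; rewrite k1l ltW|rewrite lt_eqF ?up1].
  move: zH; rewrite secE /= in_itv /= lexx andbT => h'.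
  by rewrite (@le_anti _ _ (T k1 * x + S k1) (T k2 * x + S k2)) ?h // subrr.
rewrite /area /product_measure1.
have -> : (\int[mu]_x (mu \o xsection (convex_hull ps)) x = \int[mu]_x (sect x)%:E)%E.
  by apply: eq_integral => x _; exact: sectE.
have -> : (\int[mu]_x (sect x)%:E =
    \sum_(i <= j < i + n) ((F j).[X j.+1] - (F j).[X j])%:E)%E.
  under eq_integral do rewrite /sect -sumEFin.
  rewrite integral_sum //; last by move=> j; exact: oriented_piece_integrable.
  apply: eq_bigr => j _; apply: integral_oriented_piece.
  by rewrite F_deriv /D -mul_polyC mulrC.
rewrite sumEFin /=; apply: sum_window => j.
by rewrite F_per -addSn !X_per.
Qed.

End Area.

(** * Polygons of cyclic sequences of lines *)

Section CyclicSequence.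
Variables (Ob : eqType) (a : Ob) (l : seq Ob).
Local Notation n := (size l).+1.

Definition cyc i := nth a (a :: l) (i %% n).

Lemma cyc_per i : cyc (i + n) = cyc i.
Proof. by rewrite /cyc modnDr. Qed.

Lemma cyc_lt i : (i < n)%N -> cyc i = nth a (a :: l) i.
Proof. by move=> h; rewrite /cyc modn_small. Qed.

Lemma cyc_size : cyc (size l) = last a l.
Proof. by rewrite cyc_lt // -[size l]/((size (a :: l)).-1) nth_last. Qed.

Lemma cyc_eq i j : uniq (a :: l) -> (cyc i == cyc j) = (i == j %[mod n])%N.
Proof. by move=> ul; rewrite /cyc nth_uniq ?ltn_mod. Qed.

Lemma cyc_take i : (i < n)%N -> last a (take i l) = cyc i.
Proof.
move=> il; rewrite cyc_lt //; case: i il => [|i] il; first by rewrite take0.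
by rewrite -nth_last size_takel //= nth_take.
Qed.

Lemma vertex_pairmap (R : realType) (v : Ob -> Ob -> R * R) i :
  vertex (pairmap v a (rcons l a)) i = v (cyc i) (cyc i.+1).
Proof.
rewrite /vertex size_pairmap size_rcons.
have im : (i %% n < n)%N by rewrite ltn_mod.
rewrite (nth_pairmap a) ?size_rcons //; congr v.
  by rewrite -rcons_cons nth_rcons /= im.
rewrite /cyc nth_rcons.
have -> : (i.+1 %% n = (i %% n).+1 %% n)%N by rewrite -[i.+1]addn1 -modnDml addn1.
have [il|] := ltnP (i %% n) (size l).
  by rewrite [in RHS]modn_small.
rewrite ltnS in im; rewrite leq_eqVlt ltnNge im orbF => /eqP <-.
by rewrite eqxx modnn.
Qed.

End CyclicSequence.

Section Ascents.
Variables (R : realType) (Ob : eqType) (t : Ob -> R).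

Lemma sig_ascents a l :
  sig (vdeg t) a l = - (count (fun i => t (nth a (a :: l) i) < t (nth a l i)) (iota 0 (size l)))%:Z.
Proof.
elim: l a => [|b l IH] a //; rewrite sig_cons IH /=.
rewrite -[1%N]/(1 + 0)%N iotaDl count_map PoszD opprD addrC; congr (- _ - _).
by congr Posz; apply: eq_in_count => i; rewrite mem_iota /= => il;
   case: i il => [|i] il /=; rewrite ?(set_nth_default a b) // ltnW.
Qed.

(** The closing turn from [last a l] to [a] adds one ascent when the slope increases there. The
    right side is the degree condition of [lines_const_deg], which is thus the condition of two
    reversals. *)
Lemma cyclic_ascents a l :
  count (fun i => t (cyc a l i.+1) < t (cyc a l i.+2)) (iota 0 (size l).+1) = 2 <->
  sig (vdeg t) a l = if t (last a l) < t a then -1 else -2.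
Proof.
have -> : count (fun i => t (cyc a l i.+1) < t (cyc a l i.+2)) (iota 0 (size l).+1) =
    count (fun i => t (cyc a l i) < t (cyc a l i.+1)) (iota 0 (size l).+1).
  rewrite -(count_shift (P := fun i => t (cyc a l i) < t (cyc a l i.+1)) 1).
    by rewrite -[1%N]/(1 + 0)%N iotaDl count_map.
  by move=> j; rewrite -addSn !cyc_per.
rewrite -[in iota _ _]addn1 iotaD count_cat add0n /= cyc_size.
have -> : cyc a l (size l).+1 = a by rewrite /cyc modnn.
rewrite sig_ascents; set c1 := count _ _; set c2 := count _ _.
have -> : c1 = c2.
  apply: eq_in_count => i; rewrite mem_iota /= => il.
  by rewrite !cyc_lt //= ltnS ltnW.
by case: ifP => _ /=; split; lia.
Qed.

End Ascents.

Section Angle.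
Variable R : realType.
Implicit Types u w : R * R.

(** The angle is the [acos] of the normalised scalar product; the positive cross product makes its
    sine the normalised cross product. *)
Lemma angle_exists u w : 0 < cross u w ->
  exists2 th : R, 0 < th <= pi &
    exists2 la : R, 0 < la & w = (la * (rotate th u).1, la * (rotate th u).2).
Proof.
rewrite /cross; set cr := _ - _ => cr0.
set dt := u.1 * w.1 + u.2 * w.2.
have id : dt ^+ 2 + cr ^+ 2 = (u.1 ^+ 2 + u.2 ^+ 2) * (w.1 ^+ 2 + w.2 ^+ 2).
  by rewrite /dt /cr; ring.
have u0 : 0 < u.1 ^+ 2 + u.2 ^+ 2.
  rewrite lt_def addr_ge0 ?sqr_ge0 // andbT paddr_eq0 ?sqr_ge0 // !sqrf_eq0.
  by apply: contraTN cr0 => /andP[/eqP u1 /eqP u2]; rewrite /cr u1 u2 !mul0r subrr ltxx.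
pose r := Num.sqrt (dt ^+ 2 + cr ^+ 2).
have r2 : r ^+ 2 = dt ^+ 2 + cr ^+ 2 by rewrite sqr_sqrtr // addr_ge0 ?sqr_ge0.
have r0 : 0 < r by rewrite sqrtr_gt0 ltr_wpDl ?sqr_ge0 ?exprn_gt0.
have rn : r != 0 by rewrite gt_eqF.
have drange : -1 <= dt / r <= 1.
  have : (dt / r) ^+ 2 <= 1.
    rewrite expr_div_n ler_pdivrMr ?exprn_gt0 // mul1r r2 lerDl sqr_ge0 //.
  by move: (dt / r) => q q1; apply/andP; split; nra.
pose th := acos (dt / r).
have cth : cos th = dt / r by rewrite acosK.
have sth : sin th = cr / r.
  rewrite sin_acos // (_ : 1 - _ = (cr / r) ^+ 2).
    by rewrite sqrtr_sqr ger0_norm // divr_ge0 // ltW.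
  by rewrite !expr_div_n r2; field; rewrite -r2 expf_neq0.
have thn : th != 0.
  apply/eqP => th0; move: sth; rewrite th0 sin0 => /esym/eqP.
  by rewrite mulf_eq0 invr_eq0 !gt_eqF.
exists th; first by rewrite lt_def thn acos_ge0 // acos_lepi.
exists (r / (u.1 ^+ 2 + u.2 ^+ 2)); first by rewrite divr_gt0.
have un : u.1 ^+ 2 + u.2 ^+ 2 != 0 by rewrite gt_eqF.
rewrite /rotate cth sth /= /dt /cr [LHS]surjective_pairing; congr pair; field; by rewrite rn.
Qed.

End Angle.

Lemma count_unique (P : pred nat) m p : (p < m)%N -> P p ->
  (forall j, (j < m)%N -> P j -> j = p) -> count P (iota 0 m) = 1.
Proof.
move=> pm Pp H; rewrite (@eq_in_count _ _ (pred1 p)).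
  by rewrite count_uniq_mem ?iota_uniq // mem_iota pm.
move=> j; rewrite mem_iota /= => jm; apply/idP/eqP => [/(H _ jm) //|-> //].
Qed.

Section Polygon.
Variables (R : realType) (Ob : eqType) (t s : Ob -> R) (v : Ob -> Ob -> R * R).
Hypothesis t_inj : forall a b, a != b -> t a != t b.
Hypothesis v_left : forall a b, a != b -> (v a b).2 = t a * (v a b).1 + s a.
Hypothesis v_right : forall a b, a != b -> (v a b).2 = t b * (v a b).1 + s b.
Hypothesis v_off : forall a b c, a != b -> b != c -> a != c -> (v a b).2 != t c * (v a b).1 + s c.
Variables (a : Ob) (l : seq Ob).
Hypothesis l_uniq : uniq (a :: l).
Hypothesis l_size : (1 < size l)%N.
Local Notation n := (size l).+1.
Local Notation A := (cyc a l).
(** Edge [i] joins the vertices [i] and [i.+1] and lies on the line of [A i.+1], whence the shift in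
    slope and intercept. *)
Local Notation px i := (v (A i) (A i.+1)).1.
Local Notation py i := (v (A i) (A i.+1)).2.
Local Notation tt_ i := (t (A i.+1)).
Local Notation ss_ i := (s (A i.+1)).
Local Notation dx i := (px i.+1 - px i).
Local Notation vs := (pairmap v a (rcons l a)).

Lemma cyc_neq i k : (0 < k < n)%N -> A i != A (i + k).
Proof.
move=> /andP[k0 kn]; rewrite cyc_eq // -[X in (X == _ %[mod _])%N]addn0 eqn_modDl.
by rewrite mod0n modn_small // eq_sym -lt0n.
Qed.

Lemma cyc_neq1 i : A i != A i.+1.
Proof. by rewrite -addn1; apply: cyc_neq; rewrite /= ltnS ltnW. Qed.

Lemma cyc_neq2 i : A i != A i.+2.
Proof. by rewrite -addn2; apply: cyc_neq; rewrite /= ltnS. Qed.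

Lemma vs_size : size vs = n.
Proof. by rewrite size_pairmap size_rcons. Qed.

Lemma vs_vertex i : vertex vs i = (px i, py i).
Proof. by rewrite vertex_pairmap -surjective_pairing. Qed.

Lemma Y_lo i : py i = tt_ i * px i + ss_ i.
Proof. by rewrite v_right ?cyc_neq1. Qed.

Lemma Y_hi i : py i.+1 = tt_ i * px i.+1 + ss_ i.
Proof. by rewrite v_left ?cyc_neq1. Qed.

Lemma edge_eq i : py i.+1 - py i = tt_ i * dx i.
Proof. by rewrite Y_hi Y_lo; ring. Qed.

(** Equal abscissas on one line would be equal points, where three lines meet. *)
Lemma dx_neq i : dx i != 0.
Proof.
apply/eqP => /eqP; rewrite subr_eq0 => /eqP E.
have := v_off (cyc_neq1 i) (cyc_neq1 i.+1) (cyc_neq2 i).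
by rewrite -E -v_right ?cyc_neq1 // Y_hi Y_lo E eqxx.
Qed.

Lemma cross_edge i j : cross (vertex vs i.+1 - vertex vs i) (vertex vs j - vertex vs i) =
  dx i * (py j - (tt_ i * px j + ss_ i)).
Proof.
rewrite !vs_vertex /cross /=.
by rewrite [py i.+1 - py i]edge_eq [py i]Y_lo; ring.
Qed.

Lemma off_edge i j : (i != j %[mod n])%N -> (i.+1 != j %[mod n])%N -> py j != tt_ i * px j + ss_ i.
Proof.
move=> ij ij1; apply: v_off; first exact: cyc_neq1.
  by rewrite cyc_eq // -[j.+1]addn1 -[i.+1]addn1 eqn_modDr eq_sym.
by rewrite cyc_eq // eq_sym.
Qed.

Lemma polygon_halfplanes : clockwise_convex_polygon vs ->
  forall i j, dx i * (py j - (tt_ i * px j + ss_ i)) <= 0.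
Proof.
case=> _; rewrite vs_size => H _ _ i j; rewrite -cross_edge.
have := H (i %% n)%N (j %% n)%N; rewrite !ltn_mod /vertex vs_size => /(_ isT isT).
by rewrite -addn1 modnDml !modn_mod addn1.
Qed.

(** The half-plane condition of edge [i] at the vertex [i.+2], strict because slopes and successive
    vertices differ. *)
Lemma polygon_right_turns : clockwise_convex_polygon vs ->
  right_turns (fun i => px i) (fun i => tt_ i).
Proof.
move=> /polygon_halfplanes H i.
rewrite lt_def !mulf_neq0 ?dx_neq ?subr_eq0 ?t_inj ?cyc_neq1 //=.
rewrite -oppr_le0; apply: le_trans (H i i.+2).
rewrite le_eqVlt; apply/orP; left; apply/eqP.
have E : ss_ i.+1 = tt_ i * px i.+1 + ss_ i - tt_ i.+1 * px i.+1 by rewrite -Y_hi Y_lo; ring.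
by rewrite [py i.+2]Y_hi E; ring.
Qed.

Lemma cyc_shift i k : A (i %% n + k) = A (i + k).
Proof. by rewrite /cyc modnDml. Qed.

Lemma cyc_mod i : (A (i %% n) = A i) * (A (i %% n).+1 = A i.+1) * (A (i %% n).+2 = A i.+2) *
  (A (i %% n).+3 = A i.+3).
Proof.
have H k : A (k + i %% n)%N = A (k + i)%N by rewrite ![(k + _)%N]addnC cyc_shift.
by have := H 0%N; have := H 1%N; have := H 2%N; have := H 3%N; rewrite !add0n => h3 h2 h1 h0.
Qed.

Lemma polygon_vertex_inj i j : clockwise_convex_polygon vs ->
  px i = px j -> py i = py j -> (i = j %[mod n])%N.
Proof.
move=> [_ _ H _] ex ey; have [] := H (i %% n)%N (j %% n)%N 0 0.
- by rewrite vs_size ltn_mod.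
- by rewrite vs_size ltn_mod.
- by rewrite lexx ltr01.
- by rewrite lexx ltr01.
- rewrite /edge_point !subr0 !mul1r !mul0r !addr0.
  suff -> : vertex vs (i %% n) = vertex vs (j %% n) by [].
  by rewrite /vertex vs_size !modn_mod -vs_size -/(vertex _ i) -/(vertex _ j) !vs_vertex ex ey.
- by [].
Qed.

(** One ascent for each direction of the edge before it. A vertex of extremal abscissa provides it;
    by convexity any other would be the same point, and the boundary visits a point only once. *)
Lemma polygon_two_ascents : clockwise_convex_polygon vs ->
  count (fun i => tt_ i < tt_ i.+1) (iota 0 n) = 2.
Proof.
move=> poly; have H := polygon_halfplanes poly; have RT := polygon_right_turns poly.
have one (eps : R) : is_sign eps ->
    count (fun i => (0 < eps * dx i) && (tt_ i < tt_ i.+1)) (iota 0 n) = 1%N.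
  move=> seps; have eps2 x y : (eps * x) * (eps * y) = x * y.
    by case: seps => ->; rewrite ?mul1r // !mulN1r mulrNN.
  (* a vertex with a locally extremal abscissa is globally extremal *)
  have ext i : tt_ i < tt_ i.+1 -> 0 < eps * dx i ->
      forall j, eps * px j <= eps * px i.+1 /\ (px j = px i.+1 -> py j = py i.+1).
    move=> ti di j; have := asc_flip RT ti; rewrite -eps2 pmulr_rlt0 // => di1.
    have := H i j; rewrite -eps2 pmulr_rle0 // => h1.
    have := H i.+1 j; rewrite -eps2 nmulr_rle0 // => h2.
    have e1 := Y_hi i; have e2 := Y_lo i.+1.
    by clear - seps ti h1 h2 e1 e2; split; [case: seps h1 h2 => ->; nra|
      move=> E; rewrite E in h1 h2; case: seps h1 h2 => ->; lra].
  have [m Hm] : exists m, forall j, eps * px j <= eps * px m.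
    pose F (i : 'I_n) := eps * px i.
    have [k _ Hk] := @arg_maxP _ _ _ ord0 xpredT F isT.
    by exists k => j; have := Hk (Ordinal (ltn_pmod j (ltn0Sn (size l)))) isT; rewrite /F /= !cyc_mod.
  (* The index before [m], as [size l] is [-1] modulo [n]. *)
  pose p := ((m + size l) %% n)%N.
  have pm : (p.+1 = m %[mod n])%N.
    by rewrite /p -addn1 modnDml -addnA addn1 modnDr.
  have Ep : px p.+1 = px m by rewrite -![in LHS](cyc_mod p.+1) pm !cyc_mod.
  have eps0 x : x != 0 -> eps * x != 0.
    by case: seps => ->; rewrite ?mul1r ?mulN1r ?oppr_eq0.
  have d1 : 0 < eps * dx p by rewrite lt_def eps0 ?dx_neq // mulrBr subr_ge0 Ep Hm.
  have d2 : eps * dx p.+1 < 0 by rewrite lt_def eq_sym eps0 ?dx_neq // mulrBr subr_le0 Ep Hm.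
  have ap : tt_ p < tt_ p.+1.
    have := RT p; rewrite -(eps2 (dx p)) nmulr_rgt0 ?subr_lt0 //.
    by rewrite pmulr_rlt0.
  apply: (count_unique (p := p)); rewrite ?ltn_mod ?d1 //.
  move=> j jn /andP[dj aj].
  have [h1 h2] := ext p ap d1 j.+1; have [h3 _] := ext j aj dj p.+1.
  have E : px j.+1 = px p.+1.
    apply/eqP; rewrite -subr_eq0; apply: contraT => /eps0.
    by rewrite mulrBr subr_eq0 eq_le h1 h3.
  have := polygon_vertex_inj poly E (h2 E) => /eqP.
  by rewrite -[j.+1]addn1 -[p.+1]addn1 eqn_modDr /p modn_mod modn_small // => /eqP.
rewrite -size_filter -(count_predC (fun i => 0 < 1 * dx i)) !count_filter.
rewrite (one 1) ?(eq_count (a2 := fun i => (0 < -1 * dx i) && (tt_ i < tt_ i.+1))) ?one //.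
- by right.
- move=> i /=; congr (_ && _); rewrite mul1r mulN1r oppr_gt0.
  by rewrite -leNgt le_eqVlt (negbTE (dx_neq i)).
- by left.
Qed.

Lemma px_per i : px (i + n)%N = px i. Proof. by rewrite -addSn !cyc_per. Qed.
Lemma py_per i : py (i + n)%N = py i. Proof. by rewrite -addSn !cyc_per. Qed.
Lemma slope_per i : tt_ (i + n)%N = tt_ i. Proof. by rewrite -addSn cyc_per. Qed.

Section RightTurns.
Hypothesis RT : right_turns (fun i => px i) (fun i => tt_ i).
Hypothesis two_asc : count (fun i => tt_ i < tt_ i.+1) (iota 0 n) = 2.

Lemma right_turns_halfplane i j : dx i * (py j - (tt_ i * px j + ss_ i)) <= 0.
Proof.
exact: (@globally_convex_mod _ _ (fun i => px i) (fun i => py i) (fun i => tt_ i) (fun i => ss_ i)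
  (ltn0Sn _) px_per py_per slope_per Y_lo Y_hi RT two_asc).
Qed.

Lemma edge_pointE i la : edge_point vs i la =
  (px i + la * dx i, tt_ i * (px i + la * dx i) + ss_ i).
Proof.
rewrite /edge_point !vs_vertex /=; congr pair; first by ring.
by rewrite Y_hi Y_lo; ring.
Qed.

(** The affine equation of edge [i] has one sign along edge [j] and vanishes at the common point. As
    [mu < 1], it also vanishes at vertex [j], and only two vertices lie on the line of edge [i]. *)
Lemma edge_meet i j la mu : 0 <= la < 1 -> 0 <= mu < 1 ->
  edge_point vs i la = edge_point vs j mu -> (i = j %[mod n])%N \/ (i.+1 = j %[mod n])%N.
Proof.
move=> l01 /andP[m0 m1] E.
have [|ij] := eqVneq (i %% n)%N (j %% n)%N; first by left.
have [|ij1] := eqVneq (i.+1 %% n)%N (j %% n)%N; first by right.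
have := off_edge ij ij1; have := right_turns_halfplane i j; have := right_turns_halfplane i j.+1.
set g1 := py j.+1 - _; set g0 := py j - _ => h1 h0 ne.
have g0n : g0 != 0 by rewrite subr_eq0.
have : (1 - mu) * g0 + mu * g1 = 0.
  transitivity ((edge_point vs j mu).2 - (tt_ i * (edge_point vs j mu).1 + ss_ i)).
    by rewrite /g0 /g1 /edge_point !vs_vertex /=; ring.
  by rewrite -E edge_pointE /= subrr.
move=> E0; have /eqP : (1 - mu) * (dx i * g0) + mu * (dx i * g1) = 0.
  by rewrite mulrCA [mu * _]mulrCA -mulrDr E0 mulr0.
have m1' : 0 < 1 - mu by rewrite subr_gt0.
have n1 : (1 - mu) * (dx i * g0) != 0 by apply: mulf_neq0; [rewrite gt_eqF|apply: mulf_neq0 => //; exact: dx_neq].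
have n2 : mu * (dx i * g1) <= 0 by rewrite mulr_ge0_le0.
have n3 : (1 - mu) * (dx i * g0) < 0.
  by rewrite lt_def eq_sym n1 mulr_ge0_le0 // ltW.
by move=> /eqP E1; have := ltr_leD n3 n2; rewrite E1 addr0 ltxx.
Qed.

Lemma polygon_of_right_turns : clockwise_convex_polygon vs.
Proof.
rewrite /clockwise_convex_polygon vs_size; split=> //.
- by move=> i j _ _; rewrite cross_edge right_turns_halfplane.
- move=> i j la mu il jl l01 m01 E.
  have ij : i = j.
    have small : (i = j %[mod n])%N -> i = j by rewrite !modn_small.
    have [/small //|E1] := edge_meet l01 m01 E.
    (* By symmetry each edge would be the successor of the other, which is impossible for
       [n >= 3]. *)
    have [/esym/small //|E2] := edge_meet m01 l01 (esym E).
    have E3 : (i.+2 = i %[mod n])%N.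
      by rewrite -E2 -[i.+2]addn1 -modnDml E1 modnDml addn1.
    by have := cyc_neq2 i; rewrite cyc_eq // E3 eqxx.
  split=> //; move: E; rewrite !edge_pointE -{}ij => -[/addrI E _].
  exact: (mulIf (dx_neq i) E).
- move=> i il; have [|th thp [la la0 E]] := @angle_exists R
    (vertex vs i - vertex vs i.+1) (vertex vs i.+2 - vertex vs i.+1).
    rewrite !vs_vertex /cross /=.
    have e1 : py i - py i.+1 = tt_ i * (px i - px i.+1) by rewrite Y_hi Y_lo; ring.
    rewrite e1 [py i.+2 - _]edge_eq.
    by have := RT i; congr (0 < _); ring.
  by exists th => //; exists la.
Qed.

End RightTurns.

Lemma polygon_area (F : nat -> {poly R}) : (forall i, F (i + n)%N = F i) ->
  (forall i, (F i)^`()%R = tt_ i *: 'X + (ss_ i)%:P) -> clockwise_convex_polygon vs ->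
  area vs = \sum_(j < n) ((F j).[px j.+1] - (F j).[px j]).
Proof.
move=> F_per F_deriv poly.
exact: (@hull_area _ _ (fun i => px i) (fun i => py i) (fun i => tt_ i) (fun i => ss_ i) F
  (ltn0Sn _) px_per py_per slope_per F_per Y_lo Y_hi F_deriv (polygon_right_turns poly)
  (polygon_two_ascents poly) vs vs_size vs_vertex).
Qed.

End Polygon.

Section ChainIndices.
Variables (R : realType) (Ob : eqType) (t : Ob -> R) (p : Ob -> Ob -> R) (d : Ob).
Local Notation sg := (sgl (slope_sign t)).

Lemma chain_nth eta a z l y : chain t p eta a z l y <->
  forall i, (i <= size l)%N -> 0 < eta * sg a (take i l) *
    ((if (i < size l)%N then p (nth d (a :: l) i) (nth d l i) else y) -
     (if i is j.+1 then p (nth d (a :: l) j) (nth d l j) else z)).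
Proof.
elim: l eta a z => [|b l IH] eta a z.
  split=> [h [|i] //=|/(_ 0%N isT)]; by rewrite /= mulr1.
split.
  move=> /andP[h1 /IH h2] [|i] il; first by rewrite /= mulr1.
  by have := h2 i il; rewrite /= mulrA ltnS; case: i il.
move=> h; apply/andP; split; first by have := h 0%N isT; rewrite /= mulr1.
apply/IH => i il; have := h i.+1 il.
by rewrite /= mulrA ltnS; case: i il.
Qed.

End ChainIndices.

(** * Closed walks and right turns *)

Section Walks.
Variables (R : realType) (Ob : eqType) (t s : Ob -> R) (v : Ob -> Ob -> R * R).
Variable p : Ob -> Ob -> R.
Hypothesis t_inj : forall a b, a != b -> t a != t b.
Hypothesis v_left : forall a b, a != b -> (v a b).2 = t a * (v a b).1 + s a.
Hypothesis v_right : forall a b, a != b -> (v a b).2 = t b * (v a b).1 + s b.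
Hypothesis v_off : forall a b c, a != b -> b != c -> a != c -> (v a b).2 != t c * (v a b).1 + s c.
Hypothesis pC : forall a b, p a b = p b a.
Hypothesis p_order : forall a b c, a != b -> b != c -> a != c ->
  Num.sg (p a b - p a c) = Num.sg ((v a b).1 - (v a c).1).

Lemma v_abscissa a b : a != b -> (t a - t b) * (v a b).1 = s b - s a.
Proof.
by move=> ab; have := v_left ab; rewrite (v_right ab); lra.
Qed.

Lemma v_sym a b : a != b -> v a b = v b a.
Proof.
move=> ab; have ba : b != a by rewrite eq_sym.
have E : (v a b).1 = (v b a).1.
  apply: (@mulfI _ (t a - t b)); first by rewrite subr_eq0 t_inj.
  by rewrite v_abscissa // -[t a - _]opprB mulNr v_abscissa // opprB.
rewrite [v a b]surjective_pairing [v b a]surjective_pairing; congr pair => //.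
by rewrite (v_left ab) (v_right ba) E.
Qed.

(** For abscissas both sides are the sign of the height of [v a b] above the line of [e], computed
    along the line of [b] and along that of [a]; ranks have the same order on each line. *)
Lemma position_triangle a b e : a != b -> b != e -> a != e ->
  Num.sg ((t b - t e) * (p a b - p b e)) = Num.sg ((t a - t e) * (p a b - p a e)).
Proof.
move=> ab be ae; rewrite !sgrM (pC a b) (p_order _ ae be) 1?eq_sym //.
rewrite (pC b a) (p_order ab be ae) -!sgrM; congr Num.sg.
rewrite !mulrBr -(v_sym ab) (v_abscissa be) (v_abscissa ae).
by have := v_left ab; have := v_right ab; lra.
Qed.

Lemma pos_sg_eq (k u w : R) : Num.sg u = Num.sg w -> (0 < k * u) = (0 < k * w).
Proof. by move=> E; rewrite -sgr_gt0 sgrM E -sgrM sgr_gt0. Qed.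

Variables (a : Ob) (l : seq Ob).
Hypothesis l_uniq : uniq (a :: l).
Hypothesis l_size : (1 < size l)%N.
Local Notation n := (size l).+1.
Local Notation A := (cyc a l).
Local Notation px i := (v (A i) (A i.+1)).1.
Local Notation tt_ i := (t (A i.+1)).
Local Notation dx i := (px i.+1 - px i).
Local Notation vs := (pairmap v a (rcons l a)).
Local Notation sg := (sgl (slope_sign t)).

(** Step [i] of the walk follows the line of [A i], which carries the edge before vertex [i]; its
    index [i - 1] is written [i + size l]. Ranks are replaced by abscissas through [p_order]. *)
Lemma closed_walk_cyc eta : closed_walk t p eta a l <->
  forall i, (i < n)%N -> 0 < eta * sg a (take i l) * dx (i + size l).
Proof.
have An i : A (i + size l).+1 = A i by rewrite -addnS cyc_per.
have nx i : (i < n)%N ->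
    (if (i < size l)%N then p (nth a (a :: l) i) (nth a l i) else p a (last a l)) = p (A i) (A i.+1).
  move=> il; case: ifP => il'; first by rewrite !cyc_lt.
  have -> : i = size l by apply/eqP; rewrite eqn_leq -ltnS il leqNgt il'.
  by rewrite (An 0%N) cyc_size pC.
have pv i : (i < n)%N ->
    (if i is j.+1 then p (nth a (a :: l) j) (nth a l j) else p a (last a l)) =
    p (A (i + size l)) (A i).
  case: i => [|j] il; first by rewrite add0n cyc_size pC.
  by rewrite addSnnS cyc_per !cyc_lt // ltnW.
rewrite /closed_walk (chain_nth t p a).
have K i : (i < n)%N -> (0 < eta * sg a (take i l) *
      (p (A i) (A i.+1) - p (A (i + size l)) (A i))) = (0 < eta * sg a (take i l) * dx (i + size l)).
  move=> il; apply: pos_sg_eq.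
  have E2 : A (i + size l).+2 = A i.+1 by exact: (An i.+1).
  have n1 := cyc_neq1 l_uniq l_size i; have n3 := cyc_neq1 l_uniq l_size (i + size l).
  have n2 := cyc_neq2 l_uniq l_size (i + size l); rewrite E2 An in n2 n3 *.
  have n2' : A i.+1 != A (i + size l) by rewrite eq_sym.
  have n3' : A i != A (i + size l) by rewrite eq_sym.
  by rewrite [p (A (i + _)) _]pC (p_order n1 n2' n3') (v_sym n3).
by split=> H i il; have := H i il; rewrite nx // pv // K.
Qed.

(** If an edge agrees with the direction of the walk, the turn after it is to the right exactly if
    the next edge agrees with the updated direction. *)
Lemma turn_step (al d d' ta tb : R) : ta != tb -> 0 < al * d ->
  (0 < d * d' * (ta - tb)) = (0 < al * (if ta < tb then -1 else 1) * d').
Proof.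
move=> tab ald.
have -> : (0 < d * d' * (ta - tb)) = (0 < al * d' * (ta - tb)).
  rewrite -(pmulr_rgt0 (d * d' * (ta - tb)) (x := (al * d))) //.
  have -> : al * d * (d * d' * (ta - tb)) = d ^+ 2 * (al * d' * (ta - tb)) by ring.
  rewrite pmulr_rgt0 // exprn_even_gt0 //=.
  by apply: contraTneq ald => ->; rewrite mulr0 ltxx.
case: (ltgtP ta tb) tab => // h _.
  by rewrite nmulr_lgt0 ?subr_lt0 // mulrN1 mulNr oppr_gt0.
by rewrite pmulr_lgt0 ?subr_gt0 // mulr1.
Qed.

Lemma sgl_take i : (i < size l)%N ->
  sg a (take i.+1 l) = sg a (take i l) * slope_sign t (A i) (A i.+1).
Proof.
move=> il; have S1 c e : sgl (slope_sign t) c [:: e] = slope_sign t c e by rewrite /= mulr1.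
rewrite (take_nth a) // -cats1 sgl_cat S1; congr (_ * slope_sign t _ _).
  by rewrite cyc_take // ltnW.
by rewrite cyc_lt.
Qed.

Lemma cyc_wrap i : (A (i + size l).+1 = A i) * (A (i + size l).+2 = A i.+1).
Proof. by split; [rewrite -addnS cyc_per|rewrite -addSn -addnS cyc_per]. Qed.

Lemma slope_wrap i : (tt_ (i + size l) = t (A i)) * (tt_ (i + size l).+1 = t (A i.+1)).
Proof. by rewrite !cyc_wrap. Qed.

Lemma closed_walk_of_right_turns : right_turns (fun i => px i) (fun i => tt_ i) ->
  exists2 eta, is_sign eta & closed_walk t p eta a l.
Proof.
(* Edge [size l] lies on the line of [a], where the walk starts. *)
move=> RT; exists (Num.sg (dx (size l))).
  have := dx_neq v_left v_right v_off l_uniq l_size (size l).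
  by case: (ltgtP (dx (size l)) 0) => // h _; [right; rewrite ltr0_sg|left; rewrite gtr0_sg].
apply/closed_walk_cyc; elim=> [|i IH] il.
  rewrite take0 mulr1 add0n -normrEsg normr_gt0.
  exact: (dx_neq v_left v_right v_off l_uniq l_size (size l)).
rewrite sgl_take // mulrA.
have := RT (i + size l)%N; rewrite !slope_wrap.
rewrite (turn_step _ (t_inj (cyc_neq1 l_uniq l_size i)) (IH (ltnW il))).
by rewrite addSn.
Qed.

Hypothesis two_asc : count (fun i => tt_ i < tt_ i.+1) (iota 0 n) = 2.

(** Two reversals restore the initial direction. *)
Lemma sgl_cycle : sg a l * slope_sign t (last a l) a = 1.
Proof.
have /cyclic_ascents E := two_asc; rewrite sgl_sig E slope_signE.
by case: ifP => _; [rewrite (@sgnz_even _ (-1) _ 1) // sgnz1 mulrN1 opprK|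
  rewrite (@sgnz_even _ (-1) _ 0) // sgnz0 mulr1].
Qed.

Lemma right_turns_of_closed_walk eta : closed_walk t p eta a l ->
  right_turns (fun i => px i) (fun i => tt_ i).
Proof.
move=> /closed_walk_cyc H.
have key j : (j < n)%N -> 0 < dx (j + size l) * dx (j + size l).+1 * (tt_ (j + size l) - tt_ (j + size l).+1).
  move=> jl; rewrite !slope_wrap (turn_step _ (t_inj (cyc_neq1 l_uniq l_size j)) (H j jl)).
  have [jl'|jl'] := ltnP j (size l).
    by have := H j.+1 jl'; rewrite sgl_take // mulrA addSn.
  (* At the last turn the walk has come around, and [sgl_cycle] gives back the direction of its
     first edge. *)
  have -> : j = size l by apply/eqP; rewrite eqn_leq -ltnS jl.
  have Pk k : A ((size l + size l).+1 + k)%N = A (size l + k)%N.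
    by rewrite -addnS -addnA [(n + _)%N]addnC addnA cyc_per.
  have := Pk 2; have := Pk 1%N; have := Pk 0%N; rewrite !addn0 !addn1 !addn2 => -> -> ->.
  have := H 0%N isT; rewrite take0 mulr1 add0n.
  have -> : A (size l).+1 = a by rewrite /cyc modnn.
  rewrite take_size -(slope_signE t) cyc_size -[eta * sg a l * _]mulrA sgl_cycle mulr1.
  by [].
move=> i; have := key ((i + 1) %% n)%N; rewrite ltn_mod => /(_ isT).
have Qk k : A ((i + 1) %% n + size l + k)%N = A (i + k)%N.
  by rewrite -addnA cyc_shift -(cyc_per _ _ (i + k)); congr cyc; lia.
have := Qk 3; have := Qk 2; have := Qk 1%N; have := Qk 0%N.
by rewrite !addn0 !addn1 !addn2 !addn3 => -> -> -> ->.
Qed.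

(** The half-plane of the edge on the line of [last a u], evaluated at the starting vertex. This is
    the convexity condition in [const_lt]. *)
Lemma polygon_crossing eta u w : clockwise_convex_polygon vs -> closed_walk t p eta a l ->
  u ++ w = l -> (0 < size u)%N -> (0 < size w)%N ->
  0 < - (eta * sg a u) * ((t a - t (last a u)) * (p a (last a l) - p a (last a u))).
Proof.
move=> poly /closed_walk_cyc H uw u0 w0; pose k := size u.
have kl : (k < size l)%N by rewrite -uw size_cat -[k]addn0 ltn_add2l.
have uE : u = take k l by rewrite -uw take_size_cat.
have kn : (k < n)%N by exact: ltnW.
have := H k kn; rewrite -uE.
have -> : last a u = A k by rewrite uE cyc_take.
have := polygon_halfplanes v_left v_right l_uniq l_size poly (k + size l) (size l).
rewrite cyc_wrap cyc_size.
have -> : A (size l).+1 = a by rewrite /cyc modnn.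
set d := _ - (v _ _).1; set c := A k => hp wk.
have kk : nth a (a :: l) k = c by rewrite /c cyc_lt.
have ac : a != c.
  have := @cyc_neq _ a l l_uniq 0 k; rewrite u0 kn => /(_ isT).
  by [].
have ec : last a l != c.
  rewrite -(cyc_size a l) /c cyc_eq // !modn_small // gt_eqF //.
have ae : last a l != a.
  have := @cyc_neq _ a l l_uniq 0 (size l); rewrite ltnSn ltnW // => /(_ isT).
  by rewrite add0n cyc_size eq_sym.
have ae' : a != last a l by rewrite eq_sym.
have SG : Num.sg ((t a - t c) * (p a (last a l) - p a c)) =
    Num.sg ((t a - t c) * ((v a (last a l)).1 - (v a c).1)).
  by rewrite !sgrM (p_order ae' ec ac).
rewrite (pos_sg_eq _ SG).
have E : (v (last a l) a).2 - (t c * (v (last a l) a).1 + s c) =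
    (t a - t c) * ((v a (last a l)).1 - (v a c).1).
  by rewrite mulrBr (v_abscissa ac) -(v_sym ae) (v_right ae); ring.
have := v_off ae ac ec; rewrite -subr_eq0 E => ne.
rewrite E in hp; rewrite mulNr oppr_gt0.
move: hp ne wk; set g := _ * (_ - _); set al := eta * _ => hp ne wk.
have d0 : d != 0 by apply: contraTneq wk => ->; rewrite mulr0 ltxx.
have {}hp : d * g < 0 by rewrite lt_def eq_sym mulf_neq0.
have : al * d * (d * g) < 0 by rewrite pmulr_rlt0.
have -> : al * d * (d * g) = d ^+ 2 * (al * g) by ring.
by rewrite pmulr_rlt0 // exprn_even_gt0.
Qed.

End Walks.

(** * The category of lines *)

Section Ranks.
Variables (R : realType) (Ob : finType) (t s : Ob -> R) (v : Ob -> Ob -> R * R).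
Hypothesis t_inj : forall a b, a != b -> t a != t b.
Hypothesis v_left : forall a b, a != b -> (v a b).2 = t a * (v a b).1 + s a.
Hypothesis v_right : forall a b, a != b -> (v a b).2 = t b * (v a b).1 + s b.
Hypothesis v_off : forall a b c, a != b -> b != c -> a != c -> (v a b).2 != t c * (v a b).1 + s c.
Implicit Types z w : R * R.

Definition lexlt z w := (z.1 < w.1) || (z.1 == w.1) && (z.2 < w.2).

Lemma lexlt_irr z : lexlt z z = false.
Proof. by rewrite /lexlt !ltxx andbF. Qed.

Lemma lexlt_trans z w u : lexlt z w -> lexlt w u -> lexlt z u.
Proof.
rewrite /lexlt => /orP[h|/andP[/eqP -> h]] /orP[h'|/andP[/eqP <- h']].
- by rewrite (lt_trans h h').
- by rewrite h.
- by rewrite h'.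
- by rewrite eqxx (lt_trans h h') orbT.
Qed.

Lemma lexlt_total z w : [\/ z = w, lexlt z w | lexlt w z].
Proof.
case: z w => [z1 z2] [w1 w2]; rewrite /lexlt /= [w1 == z1]eq_sym.
case: (ltgtP z1 w1) => [_|_|->]; [by constructor 2|by constructor 3|].
by case: (ltgtP z2 w2) => [_|_|->]; [constructor 2|constructor 3|constructor 1].
Qed.

(* The rank of [v a b] among the intersection points: replacing abscissas by
   ranks preserves the order along each line and separates distinct points by
   at least [1], also where two of them have the same abscissa. *)
Definition point_rank a b : nat :=
  #|[pred q : Ob * Ob | (q.1 != q.2) && lexlt (v q.1 q.2) (v a b)]|.

Lemma point_rankC a b : point_rank a b = point_rank b a.
Proof.
have [->//|ab] := eqVneq a b.
by rewrite /point_rank (v_sym t_inj v_left v_right ab).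
Qed.

Lemma point_rank_lt a b c e : a != b -> lexlt (v a b) (v c e) ->
  (point_rank a b < point_rank c e)%N.
Proof.
move=> ab h; apply/proper_card/properP; split.
  by apply/fintype.subsetP => q; rewrite !inE => /andP[qq lq]; rewrite qq (lexlt_trans lq h).
by exists (a, b); rewrite !inE /= ab ?h // lexlt_irr.
Qed.

Lemma point_rank_inj a b c e : a != b -> c != e -> point_rank a b = point_rank c e ->
  (a == c) && (b == e) || (a == e) && (b == c).
Proof.
move=> ab ce E; case: (lexlt_total (v a b) (v c e)) => [V|h|h]; first last.
- by have := point_rank_lt ce h; rewrite E ltnn.
- by have := point_rank_lt ab h; rewrite E ltnn.
(* No three lines are concurrent, so a line through the common point is that of [a] or of [b]. *)
have on x : (x == c) || (x == e) -> (x == a) || (x == b).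
  move=> xce; apply: contraT; rewrite negb_or => /andP[xa xb].
  have := @v_off a b x ab; rewrite ![_ == x]eq_sym xa xb => /(_ isT isT) /eqP; case.
  by rewrite V; case/orP: xce => /eqP ->; [rewrite v_left|rewrite v_right].
have := on c; have := on e; rewrite !eqxx orbT /= => /(_ isT) he /(_ isT) hc.
case/orP: hc => /eqP hc; case/orP: he => /eqP he; move: ce; rewrite hc he ?eqxx ?orbT //.
Qed.

Lemma point_rank_order a b c : a != b -> b != c -> a != c ->
  Num.sg ((point_rank a b)%:R - (point_rank a c)%:R : R) = Num.sg ((v a b).1 - (v a c).1).
Proof.
move=> ab bc ac; case: (ltgtP (v a b).1 (v a c).1) => h.
- rewrite !ltr0_sg ?subr_lt0 ?ltr_nat //; apply: point_rank_lt => //.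
  by rewrite /lexlt h.
- rewrite !gtr0_sg ?subr_gt0 ?ltr_nat //; apply: point_rank_lt => //.
  by rewrite /lexlt h.
have := v_off ab bc ac; rewrite h (v_left ab) h -(v_left ac) -(v_right ac).
by rewrite eqxx.
Qed.

End Ranks.

Section OneDimensional.
Variables (R : fieldType) (Ob : Type) (D : Ob -> Ob -> int).

Lemma rV_bool_sum (b : bool) (x : 'rV[R]_b) j : \sum_i x 0 i = x 0 j.
Proof.
case: b x j => x j; last by case: j.
by rewrite big_ord_recl big_ord0 addr0 (ord1 j).
Qed.

Lemma chom_const_spec a b (c : R) (e := const_mx c : chom R D a b (D a b)) : c != 0 ->
  [/\ e != 0, forall x, exists k, x = k *: e &
      forall d (x : chom R D a b d), d != D a b -> x = 0].
Proof.
move=> c0; split.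
- apply/eqP => e0; have := @hval_const R Ob D a b (D a b) c.
  rewrite -/e e0 eqxx /hval big1 => [/esym/eqP|i _]; first by rewrite (negbTE c0).
  by rewrite mxE.
- move=> x; exists ((\sum_i (x : 'rV_(D a b == D a b)) 0 i) / c); apply/rowP => j.
  by rewrite !mxE divfK //; exact: esym (rV_bool_sum x j).
move=> d x dD; apply/rowP => j; exfalso; case: j => j /=.
by rewrite (negbTE dD).
Qed.

End OneDimensional.

Section Constants.
Variables (R : realType) (Ob : finType) (f : Ob -> {poly R}) (t s : Ob -> R) (v : Ob -> Ob -> R * R).
Hypothesis hts : forall a, (f a)^`() = t a *: 'X + (s a)%:P.
Hypothesis t_inj : forall a b, a != b -> t a != t b.
Hypothesis v_left : forall a b, a != b -> (v a b).2 = t a * (v a b).1 + s a.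
Hypothesis v_right : forall a b, a != b -> (v a b).2 = t b * (v a b).1 + s b.
Hypothesis v_off : forall a b c, a != b -> b != c -> a != c -> (v a b).2 != t c * (v a b).1 + s c.
Variables (theta rho : R -> R).
Hypothesis dtheta : rderiv theta rho.
Hypothesis theta0 : forall x, x <= - 3^-1 -> theta x = 0.
Hypothesis theta1 : forall x, 3^-1 <= x -> theta x = 1.
Hypothesis rho0 : forall x, 3^-1 <= `|x| -> rho x = 0.
Hypothesis schwartz_rho : forall (q : {poly R}) (m : R),
  schwartz_fun (fun x => expR q.[x] * rho (x - m)).

Definition position a b : R := (point_rank v a b)%:R.

Local Notation B := (lines_const hts t_inj position dtheta theta0 theta1 schwartz_rho).
Local Notation G := (lines_tree hts t_inj position dtheta theta0 theta1 schwartz_rho).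
Local Notation D := (vdeg t).

Lemma positionC a b : position a b = position b a.
Proof. by rewrite /position (point_rankC t_inj v_left v_right). Qed.

Lemma position_order a b c : a != b -> b != c -> a != c ->
  Num.sg (position a b - position a c) = Num.sg ((v a b).1 - (v a c).1).
Proof. exact: point_rank_order v_left v_right v_off _ _ _. Qed.

(** A nonzero constant has two ascents by its degree, and its closed walk then has only right turns.
    Conversely a polygon yields the ascents, the walk and, if the slope of [a] is the smaller one,
    the convexity needed for the crossing. *)
Lemma const_polygon a l : uniq (a :: l) -> (1 < size l)%N ->
  (~ clockwise_convex_polygon (pairmap v a (rcons l a)) -> B a l = 0) /\
  (clockwise_convex_polygon (pairmap v a (rcons l a)) -> is_sign (B a l)).
Proof.
move=> ul l1; set poly := clockwise_convex_polygon _.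
have rkC := point_rankC t_inj v_left v_right.
have rk_inj := point_rank_inj v_left v_right v_off.
have tri := position_triangle t_inj v_left v_right positionC position_order.
have al : a != last a l.
  have := @cyc_neq _ a l ul 0 (size l); rewrite ltnSn ltnW // => /(_ isT).
  by rewrite add0n cyc_size.
have last_lt : (t (last a l) < t a) = ~~ (t a < t (last a l)).
  by rewrite -leNgt [in RHS]le_eqVlt eq_sym (negbTE (t_inj al)).
have GT := const_gt (p := position) (fun _ _ => erefl) dtheta theta0 theta1 rho0 t_inj rkC rk_inj tri
  (coord0_one hts t_inj position dtheta theta0 theta1 schwartz_rho)
  (coord1_one hts t_inj position dtheta theta0 theta1 schwartz_rho)
  (coord1_long hts t_inj position dtheta theta0 theta1 schwartz_rho)
  (coord0_ode hts t_inj position dtheta theta0 theta1 schwartz_rho) ul l1.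
have LT := const_lt (p := position) (fun _ _ => erefl) dtheta theta0 theta1 rho0 t_inj rkC rk_inj tri
  (coord0_nil hts t_inj position dtheta theta0 theta1 schwartz_rho)
  (coord0_one hts t_inj position dtheta theta0 theta1 schwartz_rho)
  (coord0_deg hts t_inj position dtheta theta0 theta1 schwartz_rho)
  (coord1_one hts t_inj position dtheta theta0 theta1 schwartz_rho)
  (coord1_long hts t_inj position dtheta theta0 theta1 schwartz_rho)
  (coord0_ode hts t_inj position dtheta theta0 theta1 schwartz_rho)
  (lines_const_lt hts t_inj position dtheta theta0 theta1 schwartz_rho) ul.
split.
  move=> npoly; apply/eqP; apply: contraT => B0; case: npoly.
  have := lines_const_deg B0; rewrite /vdeg => E.
  have two : count (fun i => t (cyc a l i.+1) < t (cyc a l i.+2)) (iota 0 (size l).+1) = 2.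
    apply/cyclic_ascents; rewrite last_lt.
    by move: E; case: (t a < t (last a l)) => /= E; apply: (addIr 1); rewrite E.
  have [eta _ W] : exists2 eta, is_sign eta & closed_walk t position eta a l.
    case: (boolP (t a < t (last a l))) E => tl E; rewrite /= in E.
      have [||_ H _] := LT; [by apply: (addIr 1); rewrite E|by []|apply: H; exact/eqP].
    have [||_ [H _]] := GT; [by apply: (addIr 1); rewrite E|by []|apply: H; exact/eqP].
  apply: (polygon_of_right_turns v_left v_right v_off ul l1 _ two).
  exact: (right_turns_of_closed_walk t_inj v_left v_right positionC position_order ul l1 two W).
move=> P; have two := polygon_two_ascents t_inj v_left v_right v_off ul l1 P.
have RT := polygon_right_turns t_inj v_left v_right v_off ul l1 P.
have [eta seta W] := closed_walk_of_right_turns t_inj v_left v_right v_off positionC position_order ul l1 RT.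
move/cyclic_ascents: two; rewrite last_lt.
case: (boolP (t a < t (last a l))) => tl /= E.
  have [[B0|//] _ H] := LT E tl; exfalso; apply: (H eta seta W _ B0) => u w.
  exact: (polygon_crossing t_inj v_left v_right v_off positionC position_order ul l1 P W).
have [[B0|//] [_ H]] := GT E tl.
by have := H (ex_intro2 _ _ eta seta W); rewrite B0.
Qed.

Lemma const_nil a : B a [::] = 0.
Proof. exact: lines_const_small. Qed.

Lemma const_one a b : B a [:: b] = 0.
Proof. exact: lines_const_small. Qed.

Definition lines_category : ainf_category R Ob :=
  C_const const_nil (lines_const_deg (schwartz_rho := schwartz_rho))
    (lines_const_rel hts t_inj position dtheta theta0 theta1 schwartz_rho).

Lemma lines_category_de_rham : homotopy_equivalent lines_category (C_DR f).
Proof.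
apply: (homotopy_equivalent_const (G := G)).
- exact: const_one.
- by [].
- by move=> a l e; exact: form_part_lines_tree.
- exact: lines_functor_rel.
- by move=> a b c w; exact: lines_coh_inj.
- by move=> a b w; exact: lines_coh_surj.
Qed.

Definition gap a b : R := (f a - f b).[(v a b).1].

(** Divides by the factor [expR (f a - f b)] of the representative at the true abscissa of [v a b],
    not at the rank used in the transfer. *)
Definition basis_elt a b : ahom lines_category a b (D a b) := const_mx (expR (- gap a b)).

Fixpoint gap_sum a l : R := if l is b :: l' then gap a b + gap_sum b l' else 0.

Lemma pval_vpath a l : pval (vpath basis_elt a l) = expR (- gap_sum a l).
Proof.
elim: l a => [|b l IH] a /=; first by rewrite oppr0 expR0.
by rewrite hval_const eqxx IH opprD expRD.
Qed.

Lemma pobj_vpath a l : pobj (vpath basis_elt a l) = l.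
Proof. by elim: l a => [|b l IH] a //=; rewrite IH. Qed.

Lemma gap_sumE a l : gap_sum a l = \sum_(i < size l) gap (nth a (a :: l) i) (nth a l i).
Proof.
have H d : gap_sum a l = \sum_(i < size l) gap (nth d (a :: l) i) (nth d l i).
  elim: l a => [|b l IH] a /=; first by rewrite big_ord0.
  by rewrite big_ord_recl /= IH.
exact: H.
Qed.

(** Summation by parts: the area is a sum over edges of differences of primitives, and collecting
    the terms at each vertex gives the gaps. The closing vertex appears with its lines in the
    opposite order. *)
Lemma polygon_area_gaps a l : uniq (a :: l) -> (1 < size l)%N ->
  clockwise_convex_polygon (pairmap v a (rcons l a)) ->
  area (pairmap v a (rcons l a)) = gap_sum a l - gap a (last a l).
Proof.
move=> ul l1 P.
have al : a != last a l.
  have := @cyc_neq _ a l ul 0 (size l); rewrite ltnSn ltnW // => /(_ isT).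
  by rewrite add0n cyc_size.
rewrite (polygon_area t_inj v_left v_right v_off ul l1 (F := fun i => f (cyc a l i.+1))) //.
- rewrite sumrB.
  have -> : \sum_(j < (size l).+1) (f (cyc a l j.+1)).[(v (cyc a l j.+1) (cyc a l j.+2)).1] =
      \sum_(j < (size l).+1) (f (cyc a l j)).[(v (cyc a l j) (cyc a l j.+1)).1].
    rewrite big_ord_recr [RHS]big_ord_recl addrC /=; congr (_ + _).
    by have := cyc_per a l 1; have := cyc_per a l 0; rewrite add0n add1n => -> ->.
  rewrite -sumrB big_ord_recr /= cyc_size.
  have -> : cyc a l (size l).+1 = a by rewrite /cyc modnn.
  rewrite gap_sumE; congr (_ + _).
    apply: eq_bigr => i _; have iS : (i < (size l).+1)%N by rewrite ltnS ltnW.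
    have i1S : (i.+1 < (size l).+1)%N by rewrite ltnS.
    by rewrite /gap hornerD hornerN (cyc_lt a iS) (cyc_lt a i1S).
  by rewrite /gap -(v_sym t_inj v_left v_right al) hornerD hornerN opprB.
- by move=> i; rewrite -addSn cyc_per.
Qed.

End Constants.

Theorem theorem3p2 (R : realType) (N : nat) (hN : (2 <= N)%N)
  (f : 'I_N -> {poly R}) (hf : forall a, (size (f a) <= 3)%N)
  (t s : 'I_N -> R) (hts : forall a, (f a)^`()%R = t a *: 'X + (s a)%:P)
  (ht : forall a b : 'I_N, a != b -> t a != t b)
  (hL : forall a b c : 'I_N, a != b -> b != c -> a != c ->
     line (t a) (s a) `&` line (t b) (s b) `&` line (t c) (s c) = set0)
  (v : 'I_N -> 'I_N -> R * R)
  (hv : forall a b : 'I_N, a != b ->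
     line (t a) (s a) (v a b) /\ line (t b) (s b) (v a b)) :
  exists (C : ainf_category R 'I_N) (e : forall a b, ahom C a b (vdeg t a b)),
  [/\ forall a b : 'I_N, a != b ->
        [/\ e a b != 0,
            forall x : ahom C a b (vdeg t a b), exists c : R, x = c *: e a b &
            forall (d : int) (x : ahom C a b d), d != vdeg t a b -> x = 0],
      forall a b : 'I_N, a != b -> forall (d : int) (x : ahom C a b d) (d' : int),
        mult (pcons (hel x) (pnil b)) d' = 0,
      forall (a : 'I_N) (l : seq 'I_N), (2 <= size l)%N -> uniq (a :: l) ->
        let vs := pairmap v a (rcons l a) in
        exists c : R,
        [/\ mult (vpath e a l) (vdeg t a (last a l)) = c *: e a (last a l),
            ~ clockwise_convex_polygon vs -> c = 0 &
            clockwise_convex_polygon vs ->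
              c = expR (- area vs) \/ c = - expR (- area vs)] &
      homotopy_equivalent C (C_DR f)].
Proof.
have v_left a b : a != b -> (v a b).2 = t a * (v a b).1 + s a by move=> /hv[].
have v_right a b : a != b -> (v a b).2 = t b * (v a b).1 + s b by move=> /hv[].
have v_off a b c : a != b -> b != c -> a != c -> (v a b).2 != t c * (v a b).1 + s c.
  move=> ab bc ac; apply/eqP => E; have [h1 h2] := hv _ _ ab.
  by suff : set0 (v a b) by []; rewrite -(hL _ _ _ ab bc ac); split.
have [theta [rho [dtheta theta0 theta1 rho0 schwartz_rho]]] := @step_exists R.
pose C := lines_category v hts ht dtheta theta0 theta1 schwartz_rho.
exists C, (basis_elt v hts ht dtheta theta0 theta1 schwartz_rho).
split.
- by move=> a b _; apply: chom_const_spec; rewrite gt_eqF ?expR_gt0.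
- move=> a b _ d x d'; apply: const_mx0E.
  by rewrite /cval /= const_one mulr0.
- move=> a l l1 ul vs; have [npoly poly] := const_polygon hts ht v_left v_right v_off dtheta theta0 theta1 rho0 schwartz_rho ul l1.
  (* The desuspension sign, the change of normalisation from inputs to output, and the suspended
     constant. *)
  pose c := sgnz R (uexp (vpath (basis_elt v hts ht dtheta theta0 theta1 schwartz_rho) a l)) *
    expR (gap f v a (last a l) - gap_sum f v a l) *
    lines_const hts ht (position v) dtheta theta0 theta1 schwartz_rho a l.
  exists c; split.
  + rewrite /= /cmult /cval pval_vpath pobj_vpath.
    have E : expR (- gap_sum f v a l) =
        expR (gap f v a (last a l) - gap_sum f v a l) * expR (- gap f v a (last a l)).
      by rewrite -expRD; congr expR; ring.
    by apply/rowP => j; rewrite !mxE /c E !mulrA [RHS]mulrAC.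
  + by move=> /npoly E; rewrite /c E mulr0.
  + move=> P; rewrite /c (polygon_area_gaps hts ht v_left v_right v_off ul l1 P) opprB.
    have /eqP := @sgnzK R (uexp (vpath (basis_elt v hts ht dtheta theta0 theta1 schwartz_rho) a l)).
    rewrite -expr2 sqrf_eq1 => /orP[] /eqP ->; case: (poly P) => ->;
      rewrite ?mul1r ?mulN1r ?mulr1 ?mulrN1 ?opprK; auto.
- exact: lines_category_de_rham.
Qed.
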